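(* Let $\Omega\subset\mathbb{C}^n$ be a bounded domain and let $1\le p<\infty$. For every $z\in\Omega$, the function $w\mapsto K_p(z,w)$ (defined on $\Omega$) is differentiable (in the real sense) at $w=z$.
   Context: For a bounded domain $\Omega\subset\mathbb{C}^n$ and $1\le p<\infty$, let $A^p(\Omega)=\{f\in\mathcal{O}(\Omega):\|f\|_p^p=\int_\Omega|f|^p<\infty\}$. The $p$-Bergman kernel is $K_p(z):=\sup\{|f(z)|^p: f\in A^p(\Omega),\ \|f\|_p=1\}$. Let $m_p(z):=\inf\{\|f\|_p: f\in A^p(\Omega),\ f(z)=1\}$; it is known that this infimum is attained by a unique function $m_p(\cdot,z)\in A^p(\Omega)$, and $K_p(z)=m_p(z)^{-p}$. The off-diagonal $p$-Bergman kernel is $K_p(\zeta,z):=K_p(z)\,m_p(\zeta,z)$, $\zeta,z\in\Omega$. *)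

(* Defs.v *)
From HB Require Import structures.
From mathcomp Require Import all_boot all_order all_algebra.
From mathcomp Require Import complex.
From mathcomp Require Import all_classical all_reals all_analysis.

Set Implicit Arguments.
Unset Strict Implicit.
Unset Printing Implicit Defensive.

Import Order.TTheory GRing.Theory Num.Theory.
Import numFieldNormedType.Exports.

Local Open Scope classical_set_scope.
Local Open Scope ring_scope.
Local Open Scope complex_scope.

(* R[i] is a concrete type: unlike a variable numFieldType, it does not inherit
   the instances exported by numFieldNormedType. *)
HB.instance Definition _ (R : realType) :=
  PseudoPointedMetric.copy R[i] (R[i])^o.
HB.instance Definition _ (R : realType) := NormedModule.copy R[i] (R[i])^o.

Section tuple_cons_measure.
Local Open Scope ereal_scope.
Context d (T : measurableType d) (R : realType) (n : nat).

Definition tuple_cons (x : T * n.-tuple T) : n.+1.-tuple T :=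
  [tuple of x.1 :: x.2].

Lemma measurable_tuple_cons : measurable_fun [set: T * n.-tuple T] tuple_cons.
Proof. exact: measurable_cons. Qed.

HB.instance Definition _ :=
  isMeasurableFun.Build _ _ _ _ tuple_cons measurable_tuple_cons.

Variables (m1 : {sigma_finite_measure set T -> \bar R})
  (m2 : {sigma_finite_measure set (n.-tuple T) -> \bar R}).

Definition tuple_cons_measure : set (n.+1.-tuple T) -> \bar R :=
  pushforward (m1 \x m2) tuple_cons.

Let tcm0 : tuple_cons_measure set0 = 0.
Proof. exact: measure0. Qed.

Let tcm_ge0 A : 0 <= tuple_cons_measure A.
Proof. exact: measure_ge0. Qed.

Let tcm_sigma_additive : semi_sigma_additive tuple_cons_measure.
Proof. exact: measure_semi_sigma_additive. Qed.

HB.instance Definition _ := isMeasure.Build _ _ _ tuple_cons_measure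
  tcm0 tcm_ge0 tcm_sigma_additive.

(* Instance inference on [m1 \x m2] does not find its sigma-finiteness, hence
   the explicit exhaustion. *)
Let tcm_sigma_finite : sigma_finite setT tuple_cons_measure.
Proof.
have /sigma_finiteP[F [FT ndF Foo]] := sigma_finiteT m1.
have /sigma_finiteP[G [GT ndG Goo]] := sigma_finiteT m2.
have FGT : \bigcup_k (F k `*` G k) = setT.
  rewrite -setXTT FT GT predeqE => -[x y]; split.
    by move=> [k _ []/= ? ?]; split; exists k.
  move=> [/= [i _ Fix] [j _ Gjy]]; exists (maxn i j) => //; split.
  - by move: x Fix; exact/subsetPset/ndF/leq_maxl.
  - by move: y Gjy; exact/subsetPset/ndG/leq_maxr.
pose g (t : n.+1.-tuple T) : T * n.-tuple T := (thead t, [tuple of behead t]).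
have tcK : cancel tuple_cons g.
  move=> [x t]; rewrite /g /tuple_cons/=; congr pair.
  exact/val_inj.
have gK : cancel g tuple_cons by move=> t; rewrite [RHS]tuple_eta.
have mg : measurable_fun setT g.
  apply: measurable_fun_pair; first exact: measurable_tnth.
  exact: measurable_behead.
exists (fun k => g @^-1` (F k `*` G k)); first by rewrite -preimage_bigcup FGT.
move=> k; have [mF Fkoo] := Foo k; have [mG Gkoo] := Goo k; split.
  by rewrite -[X in measurable X]setTI; apply: mg => //; exact: measurableX.
rewrite /tuple_cons_measure /pushforward -comp_preimage.
rewrite (_ : g \o tuple_cons = id); last by apply/funext => x; exact: tcK.
by rewrite preimage_id product_measure1E// lte_mul_pinfty// ge0_fin_numE.
Qed.

HB.instance Definition _ := Measure_isSigmaFinite.Build _ _ _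
  tuple_cons_measure tcm_sigma_finite.

End tuple_cons_measure.

Fixpoint lebesgue_tuple (R : realType) (n : nat) :
    {sigma_finite_measure set (n.-tuple (measurableTypeR R)) -> \bar R} :=
  match n with
  | 0 => \d_([tuple] : 0.-tuple (measurableTypeR R))
  | n'.+1 => tuple_cons_measure (@lebesgue_measure R) (lebesgue_tuple R n')
  end.

Section bergman.
Context (R : realType) (n : nat).
Local Notation C := R[i].
Local Notation Cn := 'rV[R[i]]_n.
Local Notation Rn := (n.-tuple (measurableTypeR R)).
Implicit Types (f : Cn -> C) (p : R) (Omega : set Cn).

Definition cvec (x y : 'I_n -> R) : Cn := \row_j (x j +i* y j).

(* Lebesgue measure on C^n is taken on R^n x R^n through this bijection. *)
Definition cpoint (x : Rn * Rn) : Cn := cvec (tnth x.1) (tnth x.2).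

(* Functions on Omega are represented by total functions; when Omega is open,
   complex differentiability on Omega does not depend on the values outside. *)
Definition holomorphic_on Omega f : Prop :=
  forall z, Omega z -> differentiable f z.

Definition pnorm p Omega f : \bar R :=
  ((\int[lebesgue_tuple R n \x lebesgue_tuple R n]_(x in cpoint @^-1` Omega)
     (Normc.normc (f (cpoint x)) `^ p)%:E) `^ p^-1)%E.

Definition bergman_space p Omega : set (Cn -> C) :=
  [set f | holomorphic_on Omega f /\ (pnorm p Omega f < +oo)%E].

Definition bergman_kernel p Omega (z : Cn) : R :=
  sup [set Normc.normc (f z) `^ p |
        f in [set f | bergman_space p Omega f /\ pnorm p Omega f = 1%E]].

Definition bergman_min p Omega (z : Cn) : \bar R :=
  ereal_inf [set pnorm p Omega f |
              f in [set f | bergman_space p Omega f /\ f z = 1]].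

(* The minimizer is unique as a function on Omega only: its values outside
   Omega are arbitrary. *)
Definition bergman_minimizer p Omega (z : Cn) : Cn -> C :=
  [get f | [/\ bergman_space p Omega f, f z = 1
             & pnorm p Omega f = bergman_min p Omega z]].

Definition bergman_offdiag p Omega (zeta z : Cn) : C :=
  (bergman_kernel p Omega z)%:C * bergman_minimizer p Omega z zeta.

(* 'rV[R[i]]_n is a normed module over R[i] only: the real structure comes from
   reading g as a map from R^n x R^n to R^2. *)
Definition real_differentiable (g : Cn -> C) (z : Cn) : Prop :=
  differentiable
    (fun u : 'rV[R]_n * 'rV[R]_n =>
       let w := g (cvec (u.1 ord0) (u.2 ord0)) in
       (complex.Re w, complex.Im w) : R * R)
    (map_mx (@complex.Re R) z, map_mx (@complex.Im R) z).

End bergman.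

(* Main.v *)
(* Write E(f) for the integral of |f|^p over Omega, I(w) for the minimum of E over
   the f with f(w) = 1, and M_w for a minimizer, so that K_p(w) = 1/I(w). Rescaling
   M_z and M_w to compete with each other gives
     |M_z(w)|^p <= I(z)/I(w) <= |M_w(z)|^(-p).
   For p = 1 the norm is not strictly convex, but equality in the triangle
   inequality makes the quotient of two minimizers at z real near z, so all
   minimizers at z share one gradient a at z. By Cauchy estimates and a Montel
   argument, the M_w converge to minimizers at z as w tends to z, together with
   their gradients; Taylor's formula at w then yields
     M_w(z) = 1 - a.(w - z) + o(|w - z|).
   Inserted in the sandwich above this gives
     I(z)/I(w) = 1 + p Re(a.(w - z)) + o(|w - z|),
   and the product I(w)^(-1) M_w(z) is real-differentiable at z. *)
From HB Require Import structures.
From mathcomp Require Import all_boot all_order all_algebra.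
From mathcomp Require Import complex.
From mathcomp Require Import ring lra.
From mathcomp Require Import all_classical all_reals all_analysis.
From mathcomp Require Import measurable_realfun.
Require Import Defs.
Set Implicit Arguments.
Unset Strict Implicit.
Unset Printing Implicit Defensive.
Import Order.TTheory GRing.Theory Num.Theory.
Import numFieldNormedType.Exports.
Local Open Scope classical_set_scope.
Local Open Scope ring_scope.

(** * Cauchy's estimate on squares *)

(** The point [w] enters only as the parameter of an extremal problem, so nothing is known in
    advance about how M_w depends on it. Two facts make up for this: the sandwich involves only the
    numbers M_z(w) and M_w(z), and since all minimizers at z share one gradient, it does not matter
    which of them the M_w approach. The first-order terms combine to the real differential v -> (p
    Re(a.v) - a.v) / I(z), whose antilinear part is p/2 times the conjugate of a.v, divided by I(z).
    Holomorphy is given as complex differentiability at each point and the measure as a product of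
    Lebesgue measures. Cauchy's inequality is therefore obtained by Goursat's argument on squares,
    and integrating it over their sizes gives the mean value inequality behind all local bounds.
    Ultrafilter limits stand in for repeated extraction of subsequences; only Fatou's lemma asks for
    an actual sequence. *)

Section interval_integral.
Context {R : realType}.
Implicit Types (f g : R -> R) (a b m k e : R).

Definition itv_int a b f := \int[@lebesgue_measure R]_(x in `[a, b]) f x.

Lemma integrable_itv f a b : {within `[a, b], continuous f} ->
  (@lebesgue_measure R).-integrable `[a, b] (EFin \o f).
Proof. by move=> fc; apply: continuous_compact_integrable => //; exact: segment_compact. Qed.

Lemma itv_int_split f a m b : a <= m -> m <= b -> {within `[a, b], continuous f} ->
  itv_int a b f = itv_int a m f + itv_int m b f.
Proof.
move=> am mb fc; rewrite /itv_int.
have := @Rintegral_itvB R f (BLeft a) (BRight b) m (integrable_itv fc).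
rewrite !bnd_simp => /(_ am mb); rewrite Rintegral_itv_obnd_cbnd.
  by move=> <-; rewrite addrC subrK.
by apply: integrableS (integrable_itv fc) => //; apply: subset_itv; rewrite bnd_simp.
Qed.

Lemma itv_intD f g a b : {within `[a, b], continuous f} ->
  {within `[a, b], continuous g} ->
  itv_int a b (fun x => f x + g x) = itv_int a b f + itv_int a b g.
Proof. by move=> fc gc; apply: RintegralD => //; exact: integrable_itv. Qed.

Lemma itv_intB f g a b : {within `[a, b], continuous f} ->
  {within `[a, b], continuous g} ->
  itv_int a b (fun x => f x - g x) = itv_int a b f - itv_int a b g.
Proof. by move=> fc gc; apply: RintegralB => //; exact: integrable_itv. Qed.

Lemma itv_int_cst a b k : a <= b -> itv_int a b (fun=> k) = k * (b - a).
Proof.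
move=> ab; rewrite /itv_int Rintegral_cst//. rewrite /= lebesgue_measure_itv/= lte_fin.
have [_|/(conj ab)/andP/le_anti->] := ltP a b; last by rewrite subrr.
by rewrite -EFinB.
Qed.

Lemma le_itv_int f g a b : {within `[a, b], continuous f} ->
  {within `[a, b], continuous g} -> (forall x, a <= x <= b -> f x <= g x) ->
  itv_int a b f <= itv_int a b g.
Proof.
by move=> fc gc fg; apply: le_Rintegral => //; exact: integrable_itv.
Qed.

Lemma within_cst a b k : {within `[a, b], continuous (fun=> k : R)}.
Proof. by apply: continuous_subspaceT => x; exact: cvg_cst. Qed.

Lemma itv_int_near f a b k e : a <= b -> {within `[a, b], continuous f} ->
  (forall x, a <= x <= b -> `|f x - k| <= e) ->
  `|itv_int a b f - k * (b - a)| <= e * (b - a).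
Proof.
move=> ab fc fk; rewrite ler_distl -mulrBl -mulrDl -!itv_int_cst//.
apply/andP; split; apply: le_itv_int => //; try exact: within_cst;
  by move=> x /fk; rewrite ler_distl => /andP[].
Qed.

Lemma within_continuousD f g a b : {within `[a, b], continuous f} ->
  {within `[a, b], continuous g} -> {within `[a, b], continuous (fun x => f x + g x)}.
Proof. by move=> fc gc x; apply: continuousD; [exact: fc|exact: gc]. Qed.

Lemma within_continuousB f g a b : {within `[a, b], continuous f} ->
  {within `[a, b], continuous g} -> {within `[a, b], continuous (fun x => f x - g x)}.
Proof. by move=> fc gc x; apply: continuousB; [exact: fc|exact: gc]. Qed.

Lemma within_continuousZ f a b k : {within `[a, b], continuous f} ->
  {within `[a, b], continuous (fun x => k * f x)}.
Proof. by move=> fc x; apply: continuousM; [exact: cvg_cst|exact: fc]. Qed.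

Lemma within_continuousP f a b :
  (forall x, a <= x <= b -> {for x, continuous f}) -> {within `[a, b], continuous f}.
Proof.
move=> fc; apply: continuous_in_subspaceT => x; rewrite inE/= in_itv/=; exact: fc.
Qed.

Lemma continuous_epsP f x :
  (forall e, 0 < e -> exists2 d : R, 0 < d & forall h, `|h| < d -> `|f (x + h) - f x| <= e) ->
  {for x, continuous f}.
Proof.
move=> H; apply/cvgrPdist_le => e e0; have [d d0 hd] := H e e0.
near=> y; have := hd (y - x); rewrite [x + _]addrC subrK [`|f y - _|]distrC; apply.
by near: y; apply/nbhs_ballP; exists d => //= y; rewrite /ball/= distrC.
Unshelve. all: by end_near. Qed.

End interval_integral.

(** * Goursat's argument on rectangles *)

Section bisection.
Context {R : realType}.
Variables (J : R -> R -> R -> R -> R) (a0 c0 w h : R).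
Hypotheses (w0 : 0 < w) (h0 : 0 < h).
Hypothesis Jadd : forall a m b c q d, a0 <= a -> a <= m -> m <= b -> b <= a0 + w ->
  c0 <= c -> c <= q -> q <= d -> d <= c0 + h ->
  J a b c d = J a m c q + J m b c q + J a m q d + J m b q d.

Let W k := w / 2 ^+ k.
Let H k := h / 2 ^+ k.
Let good k (p : R * R) := [/\ a0 <= p.1, p.1 + W k <= a0 + w, c0 <= p.2,
  p.2 + H k <= c0 + h & `|J a0 (a0 + w) c0 (c0 + h)| / 4 ^+ k <=
     `|J p.1 (p.1 + W k) p.2 (p.2 + H k)| ].

Let WS k : W k = 2 * W k.+1.
Proof. by rewrite /W exprS; field. Qed.
Let HS k : H k = 2 * H k.+1.
Proof. by rewrite /H exprS; field. Qed.
Let W_gt0 k : 0 < W k. Proof. by rewrite divr_gt0// exprn_gt0. Qed.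
Let H_gt0 k : 0 < H k. Proof. by rewrite divr_gt0// exprn_gt0. Qed.

Let step k p : exists p', good k p -> [/\ good k.+1 p', p.1 <= p'.1,
  p'.1 + W k.+1 <= p.1 + W k, p.2 <= p'.2 & p'.2 + H k.+1 <= p.2 + H k].
Proof.
have [[]|] := pselect (good k p); last by exists p.
case: p => a c /= h1 h2 h3 h4 h5.
have Wk := WS k; have Hk := HS k; have W1 := W_gt0 k.+1; have H1 := H_gt0 k.+1.
set w' := W k.+1 in Wk W1 *; set h' := H k.+1 in Hk H1 *.
set A := (X in `|X| / _ <= _) in h5.
have E : J a (a + W k) c (c + H k) =
  J a (a + w') c (c + h') + J (a + w') (a + w' + w') c (c + h') +
  J a (a + w') (c + h') (c + h' + h') + J (a + w') (a + w' + w') (c + h') (c + h' + h').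
  rewrite (_ : a + w' + w' = a + W k); last by rewrite Wk; ring.
  rewrite (_ : c + h' + h' = c + H k); last by rewrite Hk; ring.
  by apply: Jadd; lra.
set B := `|A| / 4 ^+ k.+1.
have AB : `|A| / 4 ^+ k = 4 * B.
  by rewrite /B exprS invfM; field; rewrite expf_neq0.
have K a' c' : `|A| / 4 ^+ k.+1 <= `|J a' (a' + w') c' (c' + h')| ->
  a <= a' -> a' + w' <= a + W k -> c <= c' -> c' + h' <= c + H k ->
  exists p' : R * R, good k (a, c) ->
  [/\ good k.+1 p', a <= p'.1, p'.1 + w' <= a + W k, c <= p'.2 & p'.2 + h' <= c + H k].
  move=> *; exists (a', c') => _; split => //=; split => //=; rewrite -/w' -/h'; lra.
case: (leP B `|J a (a + w') c (c + h')|) => [|l1]; first by move/K; apply; lra.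
case: (leP B `|J (a + w') (a + w' + w') c (c + h')|) => [|l2]; first by move/K; apply; lra.
case: (leP B `|J a (a + w') (c + h') (c + h' + h')|) => [|l3]; first by move/K; apply; lra.
case: (leP B `|J (a + w') (a + w' + w') (c + h') (c + h' + h')|) => [|l4]; first by move/K; apply; lra.
exfalso; move: h5; rewrite AB E leNgt => /negP; apply.
apply: le_lt_trans (ler_normD _ _) _; apply: le_lt_trans (lerD (ler_normD _ _) (lexx _)) _.
apply: le_lt_trans (lerD (lerD (ler_normD _ _) (lexx _)) (lexx _)) _; lra.
Qed.

(* Goursat: repeatedly keep the quarter on which the additive function [J] is
   largest, and take the common point of these rectangles. *)
Lemma bisection : exists x y, forall k, exists a c,
  [/\ a0 <= a, a <= x <= a + w / 2 ^+ k & a + w / 2 ^+ k <= a0 + w] /\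
  [/\ c0 <= c, c <= y <= c + h / 2 ^+ k & c + h / 2 ^+ k <= c0 + h] /\
  `|J a0 (a0 + w) c0 (c0 + h)| / 4 ^+ k <= `|J a (a + w / 2 ^+ k) c (c + h / 2 ^+ k)|.
Proof.
have [g gP] := choice (fun kp : nat * (R * R) => step kp.1 kp.2).
pose s := fix s k := if k is k'.+1 then g (k', s k') else (a0, c0).
have sg k : good k (s k).
  elim: k => [|k IH] /=; last by have [] := gP (k, s k) IH.
  by split => //=; rewrite /W /H expr0 !divr1.
have sP k := gP (k, s k) (sg k).
have mono k j : (s k).1 <= (s (k + j)%N).1 /\ (s (k + j)%N).1 + W (k + j) <= (s k).1 + W k /\
   (s k).2 <= (s (k + j)%N).2 /\ (s (k + j)%N).2 + H (k + j) <= (s k).2 + H k.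
  elim: j => [|j [i1 [i2 [i3 i4]]]]; first by rewrite addn0.
  rewrite addnS /=; have [_ /= j1 j2 j3 j4] := sP (k + j)%N; repeat split; lra.
(* Every lower left corner lies below every upper right corner, whatever the two stages, so the
   suprema of the lower left coordinates belong to all the rectangles. *)
have up k m : (s k).1 <= (s m).1 + W m /\ (s k).2 <= (s m).2 + H m.
  case: (leqP k m) => [km|/ltnW km].
    have := mono k (m - k)%N; rewrite subnKC// => -[? [_ [? _]]].
    by have := W_gt0 m; have := H_gt0 m; split; lra.
  have := mono m (k - m)%N; rewrite subnKC// => -[_ [? [_ ?]]].
  by have := W_gt0 k; have := H_gt0 k; split; lra.
pose S1 := range (fun k => (s k).1); pose S2 := range (fun k => (s k).2).
have S1P : has_sup S1.
  split; first by exists (s 0).1, 0%N.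
  by exists ((s 0).1 + W 0) => _ [k _ <-]; have [] := up k 0.
have S2P : has_sup S2.
  split; first by exists (s 0).2, 0%N.
  by exists ((s 0).2 + H 0) => _ [k _ <-]; have [] := up k 0.
exists (sup S1), (sup S2) => k; exists (s k).1, (s k).2.
have [g1 g2 g3 g4 g5] := sg k.
split; last split => //; split => //; apply/andP; split.
- by apply: (ub_le_sup (proj2 S1P)); exists k.
- by apply: ge_sup (proj1 S1P) _ => _ [m _ <-]; have [] := up m k.
- by apply: (ub_le_sup (proj2 S2P)); exists k.
- by apply: ge_sup (proj1 S2P) _ => _ [m _ <-]; have [] := up m k.
Qed.
End bisection.

Section green.
Context {R : realType}.
Implicit Types (P Q : R -> R -> R) (a b c d m x y s e : R).

(** Counterclockwise line integral of the form [P dx + Q dy] around [[a, b] x [c, d]]. *)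
Definition boundary_int P Q a b c d :=
  itv_int a b (P^~ c) - itv_int a b (P^~ d) + (itv_int c d (Q b) - itv_int c d (Q a)).

Lemma boundary_int_hsplit P Q a m b c d : a <= m -> m <= b ->
  {within `[a, b], continuous (P^~ c)} -> {within `[a, b], continuous (P^~ d)} ->
  boundary_int P Q a b c d = boundary_int P Q a m c d + boundary_int P Q m b c d.
Proof.
by move=> am mb cc cd; rewrite /boundary_int (itv_int_split am mb cc) (itv_int_split am mb cd); ring.
Qed.

Lemma boundary_int_vsplit P Q a b c m d : c <= m -> m <= d ->
  {within `[c, d], continuous (Q a)} -> {within `[c, d], continuous (Q b)} ->
  boundary_int P Q a b c d = boundary_int P Q a b c m + boundary_int P Q a b m d.
Proof.
by move=> am mb cc cd; rewrite /boundary_int (itv_int_split am mb cc) (itv_int_split am mb cd); ring.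
Qed.

(* The shared coefficient [b] encodes [dP/dy = dQ/dx]. *)
Definition closed_form_at P Q x y := exists a b c, forall e, 0 < e ->
  exists2 d : R, 0 < d & forall h k, `|h| < d -> `|k| < d ->
    `|P (x + h) (y + k) - P x y - (a * h + b * k)| <= e * (`|h| + `|k|) /\
    `|Q (x + h) (y + k) - Q x y - (b * h + c * k)| <= e * (`|h| + `|k|).

Lemma diff_continuous1 (f : R -> R) x a : (forall e, 0 < e -> exists2 d : R, 0 < d & forall h, `|h| < d ->
    `|f (x + h) - f x - a * h| <= e * `|h|) -> {for x, continuous f}.
Proof.
move=> H; apply: continuous_epsP => e e0; have [d d0 hd] := H 1 ltr01.
pose K : R := 1 + `|a|; have K0 : 0 < K by rewrite /K ltr_pwDl.
exists (Num.min d (e / K)); first by rewrite lt_min d0 divr_gt0.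
move=> h; rewrite lt_min ltr_pdivlMr// => /andP[/hd h1 h2].
rewrite -(subrK (a * h) (f _ - _)); apply: le_trans (ler_normD _ _) _.
rewrite normrM; have := ltW h2; rewrite /K; lra.
Qed.

Lemma closed_form_continuous P Q x y : closed_form_at P Q x y ->
  {for x, continuous (P^~ y)} /\ {for y, continuous (Q x)}.
Proof.
move=> [a [b [c H]]]; split.
  apply: (@diff_continuous1 _ _ a) => e /H[d d0 hd]; exists d => // h hh.
  have [] := hd h 0 hh; first by rewrite normr0.
  by rewrite addr0 mulr0 normr0 !addr0.
apply: (@diff_continuous1 _ _ c) => e /H[d d0 hd]; exists d => // h hh.
have [] := hd 0 h _ hh; first by rewrite normr0.
by move=> _; rewrite addr0 mulr0 normr0 !add0r.
Qed.

Section rectangle.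
Variables (P Q : R -> R -> R) (a0 b0 c0 d0 : R).
Hypotheses (ab : a0 < b0) (cd : c0 < d0).
Hypothesis PQ : forall x y, a0 <= x <= b0 -> c0 <= y <= d0 -> closed_form_at P Q x y.

Let cP a b c : a0 <= a -> b <= b0 -> c0 <= c <= d0 -> {within `[a, b], continuous (P^~ c)}.
Proof.
move=> ha hb hc; apply: within_continuousP => x /andP[ax xb].
by apply: (proj1 (closed_form_continuous (PQ _ hc))); rewrite (le_trans ha)// (le_trans _ hb).
Qed.

Let cQ a c d : c0 <= c -> d <= d0 -> a0 <= a <= b0 -> {within `[c, d], continuous (Q a)}.
Proof.
move=> ha hb hc; apply: within_continuousP => x /andP[ax xb].
by apply: (proj2 (closed_form_continuous (PQ hc _))); rewrite (le_trans ha)// (le_trans _ hb).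
Qed.

(** Near the common point of the nested rectangles [P] and [Q] are affine up to a small multiple of
    the distance. The affine parts integrate to 0 around a rectangle because they share the
    coefficient [b], so the integral is small compared with [4 ^- k], whereas bisection keeps it at
    least [|J| / 4 ^ k]. *)
Lemma green_eq0 : boundary_int P Q a0 b0 c0 d0 = 0.
Proof.
pose w := b0 - a0; pose h := d0 - c0.
have w0 : 0 < w by rewrite subr_gt0.
have h0 : 0 < h by rewrite subr_gt0.
have bE : a0 + w = b0 by rewrite /w addrC subrK.
have dE : c0 + h = d0 by rewrite /h addrC subrK.
have /= := @bisection R (boundary_int P Q) a0 c0 w h w0 h0.
rewrite bE dE => -[|x [y xyP]].
  move=> a m b c q d h1 h2 h3 h4 h5 h6 h7 h8.
  rewrite (@boundary_int_vsplit _ _ a b c q d)//; do ?[apply: cQ; lra].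
  rewrite (@boundary_int_hsplit _ _ a m b)//; do ?[apply: cP; lra].
  rewrite (@boundary_int_hsplit _ _ a m b q)//; do ?[apply: cP; lra].
  by rewrite addrA.
set J := boundary_int P Q a0 b0 c0 d0 in xyP *.
apply/eqP; apply: contraT => J0; have {}J0 : 0 < `|J| by rewrite normr_gt0.
have xyI : a0 <= x <= b0 /\ c0 <= y <= d0.
  have [a [c [[h1 h2 h3] [[h4 h5 h6] _]]]] := xyP 0; lra.
have [a [b [c abc]]] := PQ (proj1 xyI) (proj2 xyI).
(* The estimate below yields [2 * e * (W + H) ^ 2], which is two fifths of [|J| / 4 ^ k]; any factor
   above 2 in place of 5 would contradict [xyP]. *)
pose e := `|J| / (5 * (w + h) ^+ 2).
have e0 : 0 < e by rewrite /e divr_gt0// mulr_gt0// exprn_gt0// addr_gt0.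
have [d dpos hd] := abc e e0.
have [k kd] : exists k : nat, (w + h) / 2 ^+ k < d.
  have [k kP] : exists k : nat, (w + h) / d < k%:R.
    by exists (Num.Def.archi_bound ((w + h) / d)); apply: archi_boundP; rewrite divr_ge0// ltW// addr_gt0.
  exists k; rewrite ltr_pdivrMr ?exprn_gt0// mulrC -ltr_pdivrMr//.
  by apply: lt_trans kP _; rewrite -natrX ltr_nat ltn_expl.
have [al [ga [[h1 h2 h3] [[h4 h5 h6]]]]] := xyP k.
have t0 : 0 < 2 ^+ k :> R by rewrite exprn_gt0.
have -> : 4 ^+ k = 2 ^+ k * 2 ^+ k :> R by rewrite -exprMn; congr (_ ^+ k); ring.
move: t0 kd h2 h3 h5 h6; set t := 2 ^+ k => t0.
have wt : 0 < w / t by rewrite divr_gt0.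
have ht : 0 < h / t by rewrite divr_gt0.
rewrite mulrDl; move: wt ht; set W := w / t; set H := h / t => wt ht kd h2 h3 h5 h6.
suff : `|boundary_int P Q al (al + W) ga (ga + H)| <= 2 * e * (W + H) ^+ 2.
  move=> B A; have : `|J| / (t * t) <= 2 * e * (W + H) ^+ 2 by exact: le_trans A B.
  rewrite ler_pdivrMr ?mulr_gt0// (_ : 2 * e * _ * _ = 2 / 5 * `|J|); first lra.
  rewrite /e /W /H; field; rewrite !gt_eqF//=; last exact: addr_gt0.
have est u v : al <= u <= al + W -> ga <= v <= ga + H ->
   `|P u v - P x y - (a * (u - x) + b * (v - y))| <= e * (W + H) /\
   `|Q u v - Q x y - (b * (u - x) + c * (v - y))| <= e * (W + H).
  move=> hu hv; have u1 : `|u - x| <= W by rewrite ler_norml; lra.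
  have v1 : `|v - y| <= H by rewrite ler_norml; lra.
  have [|| A B] := hd (u - x) (v - y); [lra|lra|].
  move: A B; rewrite ![_ + (_ - _)]addrC !subrK => A B.
  by split; [apply: le_trans A _|apply: le_trans B _]; rewrite ler_pM2l// lerD.
rewrite /boundary_int -itv_intB; do ?[apply: cP; lra].
rewrite -itv_intB; do ?[apply: cQ; lra].
(* The affine parts contribute [- b * H * W] and [b * W * H], which cancel. *)
rewrite (_ : itv_int _ _ _ + _ = (itv_int al (al + W) (fun x => P x ga - P x (ga + H)) - (- b * H) * (al + W - al))
  + (itv_int ga (ga + H) (fun y => Q (al + W) y - Q al y) - (b * W) * (ga + H - ga))); last ring.
apply: le_trans (ler_normD _ _) _.
rewrite (_ : 2 * e * _ = 2 * e * (W + H) * (al + W - al) + 2 * e * (W + H) * (ga + H - ga)); last ring.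
apply: lerD; apply: itv_int_near; try lra.
- by apply: within_continuousB; apply: cP; lra.
- move=> u hu; have [] := est u ga hu; first lra.
  have [] := est u (ga + H) hu; first lra.
  rewrite !ler_norml => *; lra.
- by apply: within_continuousB; apply: cQ; lra.
- move=> v hv; have [|_ +] := est al v _ hv; first lra.
  have [|_ +] := est (al + W) v _ hv; first lra.
  rewrite !ler_norml => *; lra.
Qed.
End rectangle.

(** The frame between the two squares is cut into four rectangles avoiding the origin: two
    full-height strips at the sides, then the pieces below and above the inner square. *)
Lemma punctured_boundary_int P Q s e : 0 < e < s ->
  (forall x y, `|x| <= s -> `|y| <= s -> (x != 0) || (y != 0) -> closed_form_at P Q x y) ->
  boundary_int P Q (- s) s (- s) s = boundary_int P Q (- e) e (- e) e.
Proof.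
move=> es PQ.
have cP a b c : - s <= a -> b <= s -> c != 0 -> `|c| <= s -> {within `[a, b], continuous (P^~ c)}.
  move=> ? ? c0 cs; apply: within_continuousP => x xab.
  by apply: (proj1 (closed_form_continuous (PQ _ _ _ _ _))) => //; rewrite ?c0 ?orbT// ler_norml; lra.
have cQ a b c : - s <= a -> b <= s -> c != 0 -> `|c| <= s -> {within `[a, b], continuous (Q c)}.
  move=> ? ? c0 cs; apply: within_continuousP => x xab.
  by apply: (proj2 (closed_form_continuous (PQ _ _ _ _ _))) => //; rewrite ?c0 ?orbT// ler_norml; lra.
have nz c : e <= `|c| -> c != 0 by rewrite -normr_gt0; lra.
have e1 : `|e| = e by rewrite ger0_norm; lra.
have s1 : `|s| = s by rewrite ger0_norm; lra.
have gr a b c d : - s <= a -> a < b -> b <= s -> - s <= c -> c < d -> d <= s ->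
   [|| e <= a, b <= - e, e <= c | d <= - e] -> boundary_int P Q a b c d = 0.
  move=> h1 h2 h3 h4 h5 h6 h7; apply: green_eq0 => // x y hx hy.
  apply: PQ; [by rewrite ler_norml; lra|by rewrite ler_norml; lra|].
  apply: contraTT h7 => /norP[]; rewrite !negbK => /eqP x0 /eqP y0.
  by rewrite !negb_or -!ltNge; apply/and4P; split; lra.
rewrite (@boundary_int_hsplit _ _ (- s) (- e)); try lra; do ?[apply: cP; rewrite ?nz ?normrN ?s1 ?e1//; lra].
rewrite gr ?lexx ?orbT// ?add0r; try lra.
rewrite (@boundary_int_hsplit _ _ (- e) e); try lra; do ?[apply: cP; rewrite ?nz ?normrN ?s1 ?e1//; lra].
rewrite (gr e) ?lexx ?orbT// ?addr0; try lra.
rewrite (@boundary_int_vsplit _ _ _ _ (- s) (- e)); try lra; do ?[apply: cQ; rewrite ?nz ?normrN ?s1 ?e1//; lra].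
rewrite gr ?lexx ?orbT// ?add0r; try lra.
rewrite (@boundary_int_vsplit _ _ _ _ (- e) e); try lra; do ?[apply: cQ; rewrite ?nz ?normrN ?s1 ?e1//; lra].
by rewrite (gr _ _ e) ?lexx ?orbT// ?addr0; lra.
Qed.

End green.

(** * Averaging over squares in the plane and over boxes *)

Section lebesgue_substitution.
Local Open Scope ereal_scope.
Context {R : realType}.
Implicit Types (f : measurableTypeR R -> \bar R) (a : R).
Notation mu := (@lebesgue_measure R).

Definition translate a : measurableTypeR R -> measurableTypeR R := fun x => (a + x)%R.

Lemma measurable_translate a : measurable_fun setT (translate a).
Proof. exact: measurable_funD. Qed.

HB.instance Definition _ a := isMeasurableFun.Build _ _ _ _ (translate a) (measurable_translate a).

Lemma lebesgue_integral_shift f a : measurable_fun setT f -> (forall x, 0 <= f x) ->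
  \int[mu]_x f (a + x)%R = \int[mu]_x f x.
Proof.
move=> mf f0.
have := @ge0_integral_pushforward _ _ _ _ R _ (measurable_translate a) mu setT f measurableT mf (fun x _ => f0 x).
rewrite preimage_setT => <-; apply: eq_measure_integral => //= A mA _.
apply/esym/lebesgue_measure_unique => //= _ [[b c]] _ <-.
rewrite /pushforward (_ : _ @^-1` _ = `](b - a)%R, (c - a)%R]%classic).
  by rewrite !lebesgue_measure_itv/= !lte_fin ltrD2r; case: ifP => // _; rewrite -!EFinB; congr (_%:E); ring.
apply/seteqP; split => x /=; rewrite /translate !in_itv/= => /andP[? ?]; apply/andP; split; lra.
Qed.

Lemma lebesgue_integral_opp f : measurable_fun setT f -> (forall x, 0 <= f x) ->
  \int[mu]_x f (- x)%R = \int[mu]_x f x.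
Proof.
move=> mf f0.
have mN : measurable_fun setT (fun x : measurableTypeR R => (- x)%R : measurableTypeR R) by exact: measurableT_comp.
have := @ge0_integral_pushforward _ _ _ _ R _ mN mu setT f measurableT mf (fun x _ => f0 x).
rewrite preimage_setT => <-; apply: eq_measure_integral => //= A mA _.
exact: lebesgue_measureN.
Qed.

Lemma lebesgue_integral_sub f a : measurable_fun setT f -> (forall x, 0 <= f x) ->
  \int[mu]_x f (a - x)%R = \int[mu]_x f x.
Proof.
move=> mf f0; rewrite -(lebesgue_integral_shift a mf f0).
rewrite (lebesgue_integral_opp (f := fun x => f (a + x)%R))//.
by apply: measurableT_comp => //; exact: measurable_translate.
Qed.

Lemma ge0_integralD4 d (T : measurableType d) (nu : {measure set T -> \bar R}) (f1 f2 f3 f4 : T -> \bar R) :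
  measurable_fun setT f1 -> measurable_fun setT f2 -> measurable_fun setT f3 -> measurable_fun setT f4 ->
  (forall x, 0 <= f1 x) -> (forall x, 0 <= f2 x) -> (forall x, 0 <= f3 x) -> (forall x, 0 <= f4 x) ->
  \int[nu]_x (f1 x + f2 x + (f3 x + f4 x)) =
  \int[nu]_x f1 x + \int[nu]_x f2 x + (\int[nu]_x f3 x + \int[nu]_x f4 x).
Proof.
move=> m1 m2 m3 m4 p1 p2 p3 p4; rewrite ge0_integralD//.
- by rewrite ge0_integralD// ge0_integralD.
- by move=> x _; exact: adde_ge0.
- exact: emeasurable_funD.
- by move=> x _; exact: adde_ge0.
- exact: emeasurable_funD.
Qed.

Lemma double_integral_subst (G : measurableTypeR R * measurableTypeR R -> \bar R)
    (p q : measurableTypeR R -> measurableTypeR R) :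
  measurable_fun setT G -> (forall z, 0 <= G z) ->
  (forall f, measurable_fun setT f -> (forall x, 0 <= f x) -> \int[mu]_x f (p x) = \int[mu]_x f x) ->
  (forall f, measurable_fun setT f -> (forall x, 0 <= f x) -> \int[mu]_x f (q x) = \int[mu]_x f x) ->
  \int[mu]_x \int[mu]_y G (p x, q y) = \int[mu]_x \int[mu]_y G (x, y).
Proof.
move=> mG G0 Hp Hq.
rewrite -(Hp (fun x => \int[mu]_y G (x, y))).
- apply: eq_integral => x _; rewrite (Hq (fun y => G (p x, y)))//.
  by apply: measurableT_comp => //; exact: pair1_measurable.
- exact: (measurable_fun_fubini_tonelli_F (m2 := mu) G).
- by move=> x; exact: integral_ge0.
Qed.

(* Integrates the bound over the boundary of the square of half-side [s] for [s] in
   [[r, 2r]]: as [s] runs over R, each of the four sides sweeps the plane once. *)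
Lemma area_mean (G : measurableTypeR R * measurableTypeR R -> \bar R) (a b r k : R) :
  measurable_fun setT G -> (forall z, 0 <= G z) -> (0 < r)%R ->
  (forall s, (r <= s <= 2 * r)%R -> k%:E <= \int[mu]_t
     (G (a + t, b - s)%R + G (a + t, b + s)%R + (G (a + s, b + t)%R + G (a - s, b + t)%R))) ->
  (k * r)%:E <= 4%:E * \int[mu]_x \int[mu]_y G (x, y).
Proof.
move=> mG G0 r0 H; set I := \int[mu]_x _.
have ms (c : R) := measurable_translate c.
have mN (c : R) : measurable_fun setT (fun x : measurableTypeR R => (c - x)%R : measurableTypeR R).
  exact: measurable_funB.
pose g1 (s t : R) := G (a + t, b - s)%R; pose g2 (s t : R) := G (a + t, b + s)%R.
pose g3 (s t : R) := G (a + s, b + t)%R; pose g4 (s t : R) := G (a - s, b + t)%R.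
have mg (p q : measurableTypeR R -> measurableTypeR R) : measurable_fun setT p -> measurable_fun setT q ->
  measurable_fun setT (fun st : measurableTypeR R * measurableTypeR R => G (p st.1, q st.2)) /\
  measurable_fun setT (fun st : measurableTypeR R * measurableTypeR R => G (p st.2, q st.1)).
  move=> mp mq; split; apply: measurableT_comp => //; apply: measurable_fun_pair => //=;
  by apply: measurableT_comp.
have m1 : measurable_fun setT (fun st : measurableTypeR R * measurableTypeR R => g1 st.1 st.2) by have [] := mg _ _ (ms a) (mN b).
have m2 : measurable_fun setT (fun st : measurableTypeR R * measurableTypeR R => g2 st.1 st.2) by have [] := mg _ _ (ms a) (ms b).
have m3 : measurable_fun setT (fun st : measurableTypeR R * measurableTypeR R => g3 st.1 st.2) by have [] := mg _ _ (ms a) (ms b).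
have m4 : measurable_fun setT (fun st : measurableTypeR R * measurableTypeR R => g4 st.1 st.2) by have [] := mg _ _ (mN a) (ms b).
have sl (g : R -> R -> \bar R) (s : R) : measurable_fun setT (fun st : measurableTypeR R * measurableTypeR R => g st.1 st.2) ->
   measurable_fun setT (fun t : measurableTypeR R => g s t).
  by move=> m; apply: (measurableT_comp (f := fun st : measurableTypeR R * measurableTypeR R => g st.1 st.2) m (g := fun t => (s, t))); exact: pair1_measurable.
have mI (g : R -> R -> \bar R) : measurable_fun setT (fun st : measurableTypeR R * measurableTypeR R => g st.1 st.2) ->
   (forall s t, 0 <= g s t) -> measurable_fun setT (fun s : measurableTypeR R => \int[mu]_t g s t).
  by move=> m g0; apply: (measurable_fun_fubini_tonelli_F (m2 := mu) _ m) => -[s t].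
have sT c := fun f => @lebesgue_integral_shift f c.
have sN c := fun f => @lebesgue_integral_sub f c.
(* In [g1] and [g2] the size [s] moves the second coordinate, so the order of integration is
   exchanged first; in [g3] and [g4] it moves the first. *)
have E1 : \int[mu]_s \int[mu]_t g1 s t = I.
  transitivity (\int[mu]_t \int[mu]_s g1 s t).
    exact: (fubini_tonelli (m1 := mu) (m2 := mu) (fun st => g1 st.1 st.2) m1 (fun _ => G0 _)).
  exact: (double_integral_subst mG G0 (sT a) (sN b)).
have E2 : \int[mu]_s \int[mu]_t g2 s t = I.
  transitivity (\int[mu]_t \int[mu]_s g2 s t).
    exact: (fubini_tonelli (m1 := mu) (m2 := mu) (fun st => g2 st.1 st.2) m2 (fun _ => G0 _)).
  exact: (double_integral_subst mG G0 (sT a) (sT b)).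
have E3 : \int[mu]_s \int[mu]_t g3 s t = I by exact: (double_integral_subst mG G0 (sT a) (sT b)).
have E4 : \int[mu]_s \int[mu]_t g4 s t = I by exact: (double_integral_subst mG G0 (sN a) (sT b)).
clear sT sN ms mN mg.
pose S (s : R) := \int[mu]_t (g1 s t + g2 s t + (g3 s t + g4 s t)).
have SE s : S s = (\int[mu]_t g1 s t + \int[mu]_t g2 s t) + (\int[mu]_t g3 s t + \int[mu]_t g4 s t).
  by apply: (@ge0_integralD4 _ _ mu _ _ _ _ (sl _ s m1) (sl _ s m2) (sl _ s m3) (sl _ s m4)) => t; exact: G0.
have [q1 q2 q3 q4] := And4 (mI _ m1 (fun _ _ => G0 _)) (mI _ m2 (fun _ _ => G0 _)) (mI _ m3 (fun _ _ => G0 _)) (mI _ m4 (fun _ _ => G0 _)).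
have mS : measurable_fun setT (S : measurableTypeR R -> _).
  rewrite (_ : S = fun s => (\int[mu]_t g1 s t + \int[mu]_t g2 s t) + (\int[mu]_t g3 s t + \int[mu]_t g4 s t)); last by apply/funext => s; exact: SE.
  by apply: emeasurable_funD; exact: emeasurable_funD.
have S0 s : 0 <= S s.
  by apply: integral_ge0 => t _; apply: adde_ge0; apply: adde_ge0; exact: G0.
have I0 (g : R -> R -> \bar R) s : (forall s t, 0 <= g s t) -> 0 <= \int[mu]_t g s t by move=> g0; exact: integral_ge0.
have IS : \int[mu]_s S s = 4%:E * I.
  have /funext -> := SE.
  rewrite (@ge0_integralD4 _ _ mu _ _ _ _ q1 q2 q3 q4); do ?[by move=> s; apply: I0 => ? ?; exact: G0].
  rewrite E1 E2 E3 E4.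
  have Ige : 0 <= I by apply: integral_ge0 => x _; exact: integral_ge0.
  rewrite (_ : 4%:E = 1 + 1 + (1 + 1) :> \bar R); last by rewrite -!EFinD; congr (_%:E); ring.
  by rewrite !ge0_muleDl ?mul1e ?adde_ge0 ?lee01.
rewrite -IS; apply: (@le_trans _ _ (\int[mu]_(s in `[r, (2 * r)%R]) S s)); last first.
  by apply: ge0_subset_integral; [exact: measurable_itv|exact: measurableT|exact: mS|by []|exact: subsetT].
clear - S0 mS H r0.
apply: (@le_trans _ _ (\int[mu]_(s in `[r, (2 * r)%R]) (cst k%:E s))).
  rewrite integral_cst//= lebesgue_measure_itv/= lte_fin ifT; last lra.
  by rewrite -EFinB -EFinM lee_fin le_eqVlt; apply/orP; left; apply/eqP; ring.
have [k0|k0] := leP 0%R k.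
  apply: ge0_le_integral.
  - exact: measurable_itv.
  - by move=> s _; rewrite lee_fin.
  - exact: measurable_cst.
  - exact: measurable_funTS.
  - by move=> s /=; rewrite in_itv/=; exact: H.
apply: (@le_trans _ _ 0); last exact: integral_ge0.
by rewrite integral_cst//= mule_le0_ge0// lee_fin ltW.
Qed.
End lebesgue_substitution.

Section tuple_mean.
Local Open Scope ereal_scope.
Context {R : realType}.
Notation mu := (@lebesgue_measure R).
Notation MR := (measurableTypeR R).

Definition set_tnth T n (X : n.-tuple T) (j : 'I_n) (v : T) : n.-tuple T :=
  [tuple (if i == j then v else tnth X i) | i < n].

Lemma set_tnth_cons0 T n (x v : T) (X : n.-tuple T) :
  set_tnth [tuple of x :: X] ord0 v = [tuple of v :: X].
Proof.
apply: eq_from_tnth => i; rewrite tnth_mktuple.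
by case: (unliftP ord0 i) => [k|] -> /=; rewrite ?eqxx ?tnth0// !tnthS.
Qed.

Lemma set_tnth_consS T n (x v : T) (X : n.-tuple T) (j : 'I_n) :
  set_tnth [tuple of x :: X] (lift ord0 j) v = [tuple of x :: set_tnth X j v].
Proof.
apply: eq_from_tnth => i; rewrite tnth_mktuple.
case: (unliftP ord0 i) => [k|] -> /=; first by rewrite !tnthS tnth_mktuple (inj_eq lift_inj).
by rewrite !tnth0.
Qed.

(** Induction on the number of coordinates: the one-variable inequality for the head is combined
    with the induction hypothesis under the integral. The assumption for [j] concerns only points
    whose [j]-th coordinates are those of the base point, the others being free. This is what a box
    provides: a square around the centre in one coordinate does not leave it. *)
Lemma tuple_mean n (K : R) (h : n.-tuple MR * n.-tuple MR -> \bar R) (X0 Y0 : n.-tuple MR) :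
  (0 <= K)%R -> measurable_fun setT h -> (forall z, 0 <= h z) ->
  (forall j X Y, tnth X j = tnth X0 j -> tnth Y j = tnth Y0 j ->
    h (X, Y) <= K%:E * \int[mu]_x \int[mu]_y h (set_tnth X j x, set_tnth Y j y)) ->
  h (X0, Y0) <= (K ^+ n)%:E * \int[lebesgue_tuple R n \x lebesgue_tuple R n]_z h z.
Proof.
move=> K0; elim: n h X0 Y0 => [|n IH] h X0 Y0 mh h0 H.
  rewrite expr0 mul1e fubini_tonelli1//= /fubini_F.
  rewrite !integral_dirac//; last 2 first.
  - by apply: measurableT_comp => //; exact: pair1_measurable.
  - exact: (measurable_fun_fubini_tonelli_F (m2 := lebesgue_tuple R 0) h).
  by rewrite !diracE !mem_set// !mul1e (tuple0 X0) (tuple0 Y0).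
pose c (x : MR) (X : n.-tuple MR) : n.+1.-tuple MR := [tuple of x :: X].
have mc : measurable_fun setT (fun xX : MR * n.-tuple MR => c xX.1 xX.2) by exact: measurable_tuple_cons.
case/tupleP: X0 H => a X0; case/tupleP: Y0 => b Y0 H.
pose nu := lebesgue_tuple R n.
have mcc d (T : measurableType d) (x y : T -> MR) (X Y : T -> n.-tuple MR) :
    measurable_fun setT x -> measurable_fun setT y -> measurable_fun setT X -> measurable_fun setT Y ->
    measurable_fun setT (fun t => h (c (x t) (X t), c (y t) (Y t))).
  move=> mx my mX mY; apply: measurableT_comp => //; apply: measurable_fun_pair.
    by apply: (measurableT_comp mc (g := fun t => (x t, X t))); exact: measurable_fun_pair.
  by apply: (measurableT_comp mc (g := fun t => (y t, Y t))); exact: measurable_fun_pair.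
(* The heads [x] and [y] are frozen and arbitrary; [H] at [lift ord0 j] restricts only a tail
   coordinate and hence still applies. *)
have step x y : h (c x X0, c y Y0) <= (K ^+ n)%:E * \int[nu]_X \int[nu]_Y h (c x X, c y Y).
  have mh' : measurable_fun setT (fun z : n.-tuple MR * n.-tuple MR => h (c x z.1, c y z.2)).
    by apply: mcc.
  have := @IH (fun z => h (c x z.1, c y z.2)) X0 Y0 mh' (fun _ => h0 _).
  rewrite (@fubini_tonelli1 _ _ _ _ _ nu nu _ mh' (fun _ => h0 _)); apply => j X Y jX jY.
  have := H (lift ord0 j) (c x X) (c y Y).
  rewrite !tnthS => /(_ jX jY) => /le_trans; apply.
  by rewrite le_eqVlt; apply/orP; left; apply/eqP; congr (_ * _); apply: eq_integral => u _;
    apply: eq_integral => v _; rewrite !set_tnth_consS.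
have J0 x y : 0 <= \int[nu]_X \int[nu]_Y h (c x X, c y Y).
  by apply: integral_ge0 => X _; apply: integral_ge0 => Y _; exact: h0.
(* Tonelli's theorem brings both head variables outermost. *)
have I1 : \int[lebesgue_tuple R n.+1 \x lebesgue_tuple R n.+1]_z h z =
    \int[mu]_x \int[mu]_y \int[nu]_X \int[nu]_Y h (c x X, c y Y).
  rewrite fubini_tonelli1//.
  have push (f : n.+1.-tuple MR -> \bar R) : measurable_fun setT f -> (forall X, 0 <= f X) ->
      \int[lebesgue_tuple R n.+1]_X f X = \int[mu]_x \int[nu]_X f (c x X).
    move=> mf f0.
    have := @ge0_integral_pushforward _ _ _ _ R _ (@measurable_tuple_cons _ MR n) (mu \x nu) setT f measurableT mf (fun x _ => f0 x).
    rewrite preimage_setT => E; transitivity (\int[mu \x nu]_z f (c z.1 z.2)); first exact: E.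
    by rewrite (@fubini_tonelli1 _ _ _ _ _ mu nu (fun z => f (c z.1 z.2)))//; exact: measurableT_comp.
  rewrite push; last 2 first.
  - exact: (measurable_fun_fubini_tonelli_F (m2 := lebesgue_tuple R n.+1) h).
  - by move=> X; exact: integral_ge0.
  apply: eq_integral => x _.
  transitivity (\int[nu]_X \int[mu]_y \int[nu]_Y h (c x X, c y Y)).
    apply: eq_integral => X _; rewrite /fubini_F push//.
    by apply: measurableT_comp => //; exact: pair1_measurable.
  apply: (@fubini_tonelli _ _ _ _ _ nu mu (fun Xy => \int[nu]_Y h (c x Xy.1, c Xy.2 Y))).
    apply: (measurable_fun_fubini_tonelli_F (m2 := nu) (fun z : (n.-tuple MR * MR) * n.-tuple MR => h (c x z.1.1, c z.1.2 z.2))).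
      by apply: mcc => //; exact: measurableT_comp.
    by move=> z; exact: h0.
  by move=> z; exact: integral_ge0.
have mstep : measurable_fun setT (fun xy : MR * MR => h (c xy.1 X0, c xy.2 Y0)) by apply: mcc.
have mJ : measurable_fun setT (fun xy : MR * MR => \int[nu]_X \int[nu]_Y h (c xy.1 X, c xy.2 Y)).
  apply: (measurable_fun_fubini_tonelli_F (m2 := nu) (fun z : (MR * MR) * n.-tuple MR => \int[nu]_Y h (c z.1.1 z.2, c z.1.2 Y))).
    apply: (measurable_fun_fubini_tonelli_F (m2 := nu) (fun z : ((MR * MR) * n.-tuple MR) * n.-tuple MR => h (c z.1.1.1 z.1.2, c z.1.1.2 z.2))).
      by apply: mcc => //; apply: measurableT_comp => //; apply: measurableT_comp.
    by move=> z; exact: h0.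
  by move=> z; exact: integral_ge0.
rewrite I1; apply: le_trans (H ord0 _ _ _ _) _; rewrite ?tnth0//.
rewrite exprS EFinM -muleA lee_wpmul2l ?lee_fin//.
apply: (@le_trans _ _ (\int[mu]_x \int[mu]_y h (c x X0, c y Y0))).
  rewrite le_eqVlt; apply/orP; left; apply/eqP; apply: eq_integral => u _;
    apply: eq_integral => v _; by rewrite !set_tnth_cons0.
have mK : measurable_fun setT (fun xy : MR * MR => (K ^+ n)%:E * \int[nu]_X \int[nu]_Y h (c xy.1 X, c xy.2 Y)).
  exact: measurable_funeM.
have K0' : 0 <= (K ^+ n)%:E by rewrite lee_fin exprn_ge0.
rewrite -(@fubini_tonelli1 _ _ _ _ _ mu mu (fun xy => h (c xy.1 X0, c xy.2 Y0)))//.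
rewrite -(@fubini_tonelli1 _ _ _ _ _ mu mu (fun xy => \int[nu]_X \int[nu]_Y h (c xy.1 X, c xy.2 Y)))//.
rewrite -ge0_integralZl//.
apply: ge0_le_integral => //.
Qed.
End tuple_mean.

Local Open Scope complex_scope.

(** * Cauchy's inequality in one complex variable *)

Section complex_norm.
Context {R : realType}.
Implicit Types (z w : R[i]) (x y : R).

(** Real-valued, whereas [|z|] is again an element of [R[i]]; it is the modulus that occurs in
    [pnorm]. *)
Definition cnorm z : R := Normc.normc z.

Lemma cnormE z : `|z| = (cnorm z)%:C. Proof. by case: z. Qed.
Lemma cnorm_ge0 z : 0 <= cnorm z. Proof. by case: z => *; exact: sqrtr_ge0. Qed.
Lemma cnorm0 : cnorm 0 = 0. Proof. exact: Normc.normc0. Qed.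
Lemma cnorm1 : cnorm 1 = 1. Proof. exact: Normc.normc1. Qed.
Lemma cnormM z w : cnorm (z * w) = cnorm z * cnorm w. Proof. exact: Normc.normcM. Qed.
Lemma cnormV z : cnorm z^-1 = (cnorm z)^-1. Proof. exact: Normc.normcV. Qed.
Lemma cnormN z : cnorm (- z) = cnorm z. Proof. exact: normcN. Qed.
Lemma cnormD z w : cnorm (z + w) <= cnorm z + cnorm w. Proof. exact: le_normcD. Qed.
Lemma cnormB z w : cnorm (z - w) <= cnorm z + cnorm w.
Proof. by rewrite -(cnormN w); exact: cnormD. Qed.
Lemma cnorm_eq0 z : (cnorm z == 0) = (z == 0).
Proof. by apply/eqP/eqP => [/Normc.eq0_normc//|->]; exact: cnorm0. Qed.
Lemma cnorm_gt0 z : (0 < cnorm z) = (z != 0).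
Proof. by rewrite lt_def cnorm_eq0 cnorm_ge0 andbT. Qed.
Lemma cnormC z w : cnorm (z - w) = cnorm (w - z).
Proof. by rewrite -cnormN opprB. Qed.
Lemma cnorm_real x : cnorm x%:C = `|x|.
Proof. by rewrite /cnorm/= expr0n addr0 sqrtr_sqr. Qed.
Lemma cnorm_dist z w : `|cnorm z - cnorm w| <= cnorm (z - w).
Proof.
rewrite ler_norml; apply/andP; split.
  by rewrite lerNl opprB lerBlDr cnormC; apply: le_trans (cnormD _ _); rewrite subrK.
by rewrite lerBlDr; apply: le_trans (cnormD _ _); rewrite subrK.
Qed.
Lemma normRe z : `|complex.Re z| <= cnorm z.
Proof. by case: z => x y; rewrite /cnorm/= -sqrtr_sqr ler_wsqrtr// lerDl sqr_ge0. Qed.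
Lemma normIm z : `|complex.Im z| <= cnorm z.
Proof. by case: z => x y; rewrite /cnorm/= -sqrtr_sqr ler_wsqrtr// lerDr sqr_ge0. Qed.
Lemma cnorm_le x y : cnorm (x +i* y) <= `|x| + `|y|.
Proof.
rewrite -(@ger0_norm _ (`|x| + `|y|)) ?addr_ge0// -sqrtr_sqr /cnorm/= ler_wsqrtr//.
by rewrite sqrrD !real_normK ?num_real// -addrA lerD2l lerDr mulrn_wge0// mulr_ge0.
Qed.
End complex_norm.

Section complex_derivative.
Context {R : realType}.
Local Notation C := R[i].
Implicit Types (g : C -> C) (t l k u : C).

Definition cderiv_at g t l := forall e : R, 0 < e ->
  exists2 d : R, 0 < d & forall h : C, cnorm h < d -> cnorm (g (t + h) - g t - l * h) <= e * cnorm h.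

Lemma cderiv_scale g t l u : cderiv_at g t l -> cderiv_at (fun t => u * g t) t (u * l).
Proof.
move=> gl e e0; have u0 : 0 < 1 + cnorm u by rewrite ltr_pwDl// cnorm_ge0.
have [d d0 hd] := gl (e / (1 + cnorm u)) (divr_gt0 e0 u0); exists d => // h /hd H.
rewrite /= -mulrA -!mulrBr cnormM; apply: le_trans (ler_wpM2l (cnorm_ge0 _) H) _.
rewrite mulrA ler_wpM2r ?cnorm_ge0// mulrA ler_pdivrMr//.
by have := cnorm_ge0 u; nra.
Qed.

Lemma cderiv_bound g t l : cderiv_at g t l -> exists2 d : R, 0 < d &
  forall h : C, cnorm h < d -> cnorm (g (t + h) - g t) <= (1 + cnorm l) * cnorm h.
Proof.
move=> gl; have [d d0 hd] := gl 1 ltr01; exists d => // h /hd.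
rewrite mul1r => H; rewrite -(subrK (l * h) (_ - _)); apply: le_trans (cnormD _ _) _.
by rewrite cnormM mulrDl mul1r lerD2r.
Qed.

Lemma cderiv_continuous g t l : cderiv_at g t l -> forall e : R, 0 < e ->
  exists2 d : R, 0 < d & forall h : C, cnorm h < d -> cnorm (g (t + h) - g t) <= e.
Proof.
move=> /cderiv_bound[d d0 hd] e e0; have K0 : 0 < 1 + cnorm l by rewrite ltr_pwDl// cnorm_ge0.
exists (Num.min d (e / (1 + cnorm l))); first by rewrite lt_min d0 divr_gt0.
move=> h; rewrite lt_min ltr_pdivlMr// => /andP[/hd h1 h2].
by apply: le_trans h1 _; rewrite mulrC ltW.
Qed.

Lemma cderiv_divided g t l k : t != 0 -> cderiv_at g t l ->
  cderiv_at (fun t => (g t - k) / t) t ((l * t - (g t - k)) / t ^+ 2).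
Proof.
move=> t0 gl e e0; set A := g t - k; set B := l * t - A.
have nt : 0 < cnorm t by rewrite cnorm_gt0.
have B0 := cnorm_ge0 B.
pose c : R := 1 + cnorm B; have c0 : 0 < c by rewrite ltr_pwDl.
have e1 : 0 < e * cnorm t / 4 by rewrite divr_gt0// mulr_gt0.
have [d d0 hd] := gl _ e1.
(* Since [|t + h| >= |t| / 2], the part of the remainder quadratic in [h] is at most
   [2 * c * |h| ^ 2 / |t| ^ 3]; this radius brings it below [e / 2 * |h|]. *)
pose d' := e * (cnorm t) ^+ 3 / (4 * c).
have d'0 : 0 < d' by rewrite divr_gt0// mulr_gt0// exprn_gt0.
exists (Num.min d (Num.min (cnorm t / 2) d')).
  by rewrite !lt_min d0 d'0 divr_gt0.
move=> h; rewrite !lt_min => /and3P[/hd h1 h2 h3].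
have th : cnorm t / 2 <= cnorm (t + h).
  have : cnorm t <= cnorm (t + h) + cnorm h by apply: le_trans (cnormB _ _); rewrite addrK.
  by lra.
have th0 : t + h != 0 by rewrite -cnorm_gt0; apply: lt_le_trans th; rewrite divr_gt0.
set r := g (t + h) - g t - l * h in h1.
have -> : (g (t + h) - k) / (t + h) - A / t - B / t ^+ 2 * h =
   r / (t + h) - h ^+ 2 * B / (t ^+ 2 * (t + h)).
  by rewrite /B /r /A; field; rewrite th0.
apply: le_trans (cnormB _ _) _.
rewrite !cnormM !cnormV !cnormM.
have V : (cnorm (t + h))^-1 <= 2 / cnorm t.
  by rewrite -[_ / _]invrK lef_pV2 ?posrE ?invr_gt0 ?divr_gt0// ?invf_div// cnorm_gt0.
have V0 : 0 < (cnorm (t + h))^-1 by rewrite invr_gt0 cnorm_gt0.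
have -> : e * cnorm h = e / 2 * cnorm h + e / 2 * cnorm h by field.
have H0 := cnorm_ge0 h.
apply: lerD.
  apply: le_trans (ler_pM (cnorm_ge0 _) (ltW V0) h1 V) _.
  by rewrite le_eqVlt; apply/orP; left; apply/eqP; field; rewrite gt_eqF.
rewrite -!expr2 invfM.
have Bc : cnorm B <= c by rewrite /c lerDr.
apply: (@le_trans _ _ (cnorm h ^+ 2 * c * ((cnorm t ^+ 2)^-1 * (2 / cnorm t)))).
  apply: ler_pM => //; rewrite ?mulr_ge0 ?invr_ge0 ?sqr_ge0 ?cnorm_ge0//.
  - by rewrite ler_wpM2l ?sqr_ge0.
  - by rewrite ler_wpM2l ?invr_ge0 ?sqr_ge0.
have -> : e / 2 * cnorm h = d' * cnorm h * c * ((cnorm t ^+ 2)^-1 * (2 / cnorm t)).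
  by rewrite /d'; field; rewrite !gt_eqF.
rewrite expr2 ler_wpM2r ?mulr_ge0 ?invr_ge0 ?sqr_ge0//; first by rewrite ltW.
by rewrite ler_wpM2r ?(ltW c0)// ler_wpM2r// ltW.
Qed.

(** The pair is chosen because [Im (g dz) = Im g dx + Re g dy]. By the Cauchy-Riemann equations the
    shared coefficient is [Re l]. *)
Lemma cderiv_closed_form g x y l : cderiv_at g (x +i* y) l ->
  closed_form_at (fun x y => complex.Im (g (x +i* y))) (fun x y => complex.Re (g (x +i* y))) x y.
Proof.
move=> gl; exists (complex.Im l), (complex.Re l), (- complex.Im l) => e e0.
have [d d0 hd] := gl e e0; exists (d / 2); first by rewrite divr_gt0.
move=> h k hh hk; have := cnorm_le h k => hkl.
have /hd H : cnorm (h +i* k) < d by apply: le_lt_trans hkl _; lra.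
have {}H : cnorm (g ((x + h) +i* (y + k)) - g (x +i* y) - l * (h +i* k)) <= e * (`|h| + `|k|).
  by apply: le_trans H _; rewrite ler_pM2l.
split; apply: le_trans H; [apply: le_trans (normIm _)|apply: le_trans (normRe _)];
  rewrite le_eqVlt; apply/orP; left; apply/eqP; congr `| _ |;
  case: l {gl hd} => ? ?; case: (g _) => ? ?; case: (g _) => ? ? /=; ring.
Qed.

End complex_derivative.

Section cauchy.
Context {R : realType}.
Local Notation C := R[i].
Implicit Types (g : C -> C) (t l k u : C) (s x y r : R).

(** One point on each side of the square of half-side [s]; the integral over [[- s, s]] is the
    integral of [|g|] along its boundary. *)
Definition square_sum g s x : R :=
  cnorm (g (x -i* s)) + cnorm (g (x +i* s)) + (cnorm (g (s +i* x)) + cnorm (g ((- s) +i* x))).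

(** [phi] stands for [Re], [Im] or their opposites, one for each side of the square, according to
    which part of [F dz] that side contributes. *)
Lemma divided_le (phi : C -> R) (r s : R) (z w : C) : 0 < s -> s <= cnorm z -> 0 <= r ->
  (forall u, phi u <= cnorm u) -> (forall u v, phi (u - v) = phi u - phi v) ->
  (forall u, phi (r%:C * u) = r * phi u) -> (2 * s)^-1 <= phi z^-1 ->
  phi ((w - r%:C) / z) <= s^-1 * cnorm w - r / (2 * s).
Proof.
move=> s0 sz r0 p1 p2 p3 p4; rewrite mulrBl p2 p3.
apply: lerB; last by rewrite ler_wpM2l.
apply: le_trans (p1 _) _; rewrite cnormM cnormV mulrC ler_wpM2r ?cnorm_ge0//.
by rewrite lef_pV2// posrE// (lt_le_trans s0).
Qed.

Lemma cnorm_ge_coord s x y : (s <= `|x|) || (s <= `|y|) -> s <= cnorm (x +i* y).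
Proof. by move=> /orP[|] /le_trans; apply; [have := normRe (x +i* y)|have := normIm (x +i* y)]. Qed.

(** [s / (s ^ 2 + x ^ 2)] is the density of [Im (dz / z)] along a side of the square. The crude
    bound replaces its total 2 pi by 4, so no arctangent has to be integrated. *)
Lemma half_inv_le s x : 0 < s -> `|x| <= s -> (2 * s)^-1 <= s / (s ^+ 2 + x ^+ 2).
Proof.
move=> s0 xs; have x2 : x ^+ 2 <= s ^+ 2 by rewrite -[x ^+ 2]real_normK ?num_real// lerXn2r// nnegrE ltW.
have s2 : 0 < s ^+ 2 by rewrite exprn_gt0.
have D : 0 < s ^+ 2 + x ^+ 2 by rewrite ltr_pwDl// sqr_ge0.
rewrite -div1r ler_pdivrMr ?mulr_gt0// mulrAC ler_pdivlMr// mul1r.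
by rewrite expr2 in x2 s2 *; nra.
Qed.

Lemma slice_continuous g a (b : R) l : cderiv_at g (a +i* b) l ->
  {for a, continuous (fun x => cnorm (g (x +i* b)))} /\ {for b, continuous (fun y => cnorm (g (a +i* y)))}.
Proof.
move=> /cderiv_continuous H; split; apply: continuous_epsP => e /H[d d0 hd]; exists d => // h hh.
  have := hd h%:C; rewrite cnorm_real => /(_ hh); apply: le_trans.
  by apply: le_trans (cnorm_dist _ _) _; rewrite [X in g X](_ : _ = (a +i* b) + h%:C)//; congr (_ +i* _); rewrite addr0.
have := hd (0 +i* h); have -> : cnorm (0 +i* h) = `|h| by rewrite /cnorm/= expr0n add0r sqrtr_sqr.
move=> /(_ hh); apply: le_trans.
by apply: le_trans (cnorm_dist _ _) _; rewrite [X in g X](_ : _ = (a +i* b) + (0 +i* h))//; congr (_ +i* _); rewrite addr0.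
Qed.

Section square.
Variables (g : C -> C) (s : R).
Hypotheses (s0 : 0 < s)
  (g0 : forall e : R, 0 < e -> exists2 d : R, 0 < d & forall h, cnorm h < d -> cnorm (g h - g 0) <= e)
  (gd : forall x y, `|x| <= s -> `|y| <= s -> (x != 0) || (y != 0) -> exists l, cderiv_at g (x +i* y) l).

Let r := cnorm (g 0).
Let u := if g 0 == 0 then 1 else r%:C / g 0.
Let F t := (u * g t - r%:C) / t.
Let P x y := complex.Im (F (x +i* y)).
Let Q x y := complex.Re (F (x +i* y)).

Let nu : cnorm u = 1.
Proof.
rewrite /u; case: eqVneq => [|gn]; first by rewrite cnorm1.
by rewrite cnormM cnormV cnorm_real ger0_norm ?cnorm_ge0// divff// cnorm_eq0.
Qed.
Let ug0 : u * g 0 = r%:C.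
Proof.
rewrite /u; case: eqVneq => [g00|gn]; first by rewrite /r g00 mulr0 cnorm0.
by rewrite divfK.
Qed.

Let PQ x y : `|x| <= s -> `|y| <= s -> (x != 0) || (y != 0) -> closed_form_at P Q x y.
Proof.
move=> xs ys xy; have [l gl] := gd xs ys xy.
apply: (cderiv_closed_form (l := (u * l * (x +i* y) - (u * g (x +i* y) - r%:C)) / (x +i* y) ^+ 2)).
apply: (@cderiv_divided _ (fun t => u * g t)); last exact: cderiv_scale.
by rewrite eq_complex/= negb_and.
Qed.

Let cP y a b : y != 0 -> `|y| <= s -> - s <= a -> b <= s -> {within `[a, b], continuous (P^~ y)}.
Proof.
move=> y0 ys aS bS; apply: within_continuousP => x xab.
by apply: (proj1 (closed_form_continuous (PQ _ _ _))); rewrite ?y0 ?orbT// ler_norml; lra.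
Qed.
Let cQ y a b : y != 0 -> `|y| <= s -> - s <= a -> b <= s -> {within `[a, b], continuous (Q y)}.
Proof.
move=> y0 ys aS bS; apply: within_continuousP => x xab.
by apply: (proj2 (closed_form_continuous (PQ _ _ _))); rewrite ?y0 ?orbT// ler_norml; lra.
Qed.

Let small e : 0 < e -> exists2 d, 0 < d < s & `|boundary_int P Q (- d) d (- d) d| <= e.
Proof.
(* With [|u * g t - r| <= e / 8] and [|t| >= f] on the boundary of the square of half-side [f], each
   side, of length [2 * f], contributes at most [e / 4]. *)
move=> e0; have [d d0 hd] := g0 (divr_gt0 e0 (ltr0n R 8)).
pose f := Num.min (d / 3) (s / 2).
have f0 : 0 < f by rewrite lt_min !divr_gt0.
have fd : f <= d / 3 by rewrite ge_min lexx.
have fs : f <= s / 2 by rewrite ge_min lexx orbT.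
exists f; first by rewrite f0; lra.
have FB x y : `|x| <= f -> `|y| <= f -> (`|x| == f) || (`|y| == f) -> cnorm (F (x +i* y)) <= e / 8 / f.
  move=> xf yf xyf; rewrite /F cnormM cnormV -ug0 -mulrBr cnormM nu mul1r.
  have nf : f <= cnorm (x +i* y).
    by apply: cnorm_ge_coord; case/orP: xyf => /eqP ->; rewrite lexx ?orbT.
  apply: ler_pM; rewrite ?cnorm_ge0 ?invr_ge0 ?cnorm_ge0//.
    by apply: hd; apply: le_lt_trans (cnorm_le _ _) _; lra.
  by rewrite lef_pV2// posrE// (lt_le_trans f0).
have nf : `|f| = f by rewrite ger0_norm// ltW.
have fn0 : f != 0 by rewrite gt_eqF.
have B h : {within `[- f, f], continuous h} -> (forall x, - f <= x <= f -> `|h x| <= e / 8 / f) ->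
   `|itv_int (- f) f h| <= e / 4.
  move=> hc hb; have := @itv_int_near _ h (- f) f 0 (e / 8 / f).
  rewrite mul0r subr0 (_ : e / 8 / f * (f - - f) = e / 4); last by field.
  by apply => //; [lra|move=> x /hb; rewrite subr0].
have T x : - f <= x <= f -> `|x| <= f by rewrite ler_norml.
have fs' : `|f| <= s by rewrite nf; lra.
have fS : - s <= - f by lra.
have fS' : f <= s by lra.
have b1 : `|itv_int (- f) f (P^~ (- f))| <= e / 4.
  apply: B; first by apply: cP; rewrite ?oppr_eq0 ?normrN.
  by move=> x /T xf; apply: (le_trans (normIm (F (x -i* f)))); apply: FB; rewrite ?normrN ?nf ?eqxx ?orbT.
have b2 : `|itv_int (- f) f (P^~ f)| <= e / 4.
  apply: B; first by apply: cP.
  by move=> x /T xf; apply: (le_trans (normIm (F (x +i* f)))); apply: FB; rewrite ?nf ?eqxx ?orbT.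
have b3 : `|itv_int (- f) f (Q f)| <= e / 4.
  apply: B; first by apply: cQ.
  by move=> x /T xf; apply: (le_trans (normRe (F (f +i* x)))); apply: FB; rewrite ?nf ?eqxx ?orbT.
have b4 : `|itv_int (- f) f (Q (- f))| <= e / 4.
  apply: B; first by apply: cQ; rewrite ?oppr_eq0 ?normrN.
  by move=> x /T xf; apply: (le_trans (normRe (F ((- f) +i* x)))); apply: FB; rewrite ?normrN ?nf ?eqxx ?orbT.
rewrite /boundary_int; apply: le_trans (ler_normD _ _) _.
by have := ler_normB (itv_int (- f) f (P^~ (- f))) (itv_int (- f) f (P^~ f));
   have := ler_normB (itv_int (- f) f (Q f)) (itv_int (- f) f (Q (- f))); lra.
Qed.

Let T x : - s <= x <= s -> `|x| <= s. Proof. by rewrite ler_norml. Qed.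
Let ns : `|s| = s. Proof. by rewrite ger0_norm// ltW. Qed.
Let sn0 : s != 0. Proof. by rewrite gt_eqF. Qed.

Lemma square_sum_continuous : {within `[- s, s], continuous (square_sum g s)}.
Proof.
have gc b : b != 0 -> `|b| <= s -> {within `[- s, s], continuous (fun x => cnorm (g (x +i* b)))} /\
   {within `[- s, s], continuous (fun y => cnorm (g (b +i* y)))}.
  move=> b0 bs; split; apply: within_continuousP => x /T xs.
    by have [|l gl] := gd xs bs; [rewrite b0 orbT|have [] := slice_continuous gl].
  by have [|l gl] := gd bs xs; [rewrite b0|have [] := slice_continuous gl].
have [|g1 g2] := gc s sn0; first by rewrite ns.
have [||g3 g4] := gc (- s); [by rewrite oppr_eq0|by rewrite normrN ns|].
by do 2 apply: within_continuousD.
Qed.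
Let sqc := square_sum_continuous.

(* Normalize by [u] so that [r = u * g 0] is nonnegative. Then [F = (u * g - r) / t] is
   [o(1/t)] at 0, so its boundary integral vanishes, and the term [r / t] has boundary
   integral at least [4 * r] in absolute value. *)
Lemma cauchy_square : 4 * cnorm (g 0) <= s^-1 * itv_int (- s) s (square_sum g s).
Proof.
have J0 : boundary_int P Q (- s) s (- s) s = 0.
  apply/eqP; rewrite -normr_le0; apply/ler_addgt0Pr => e e0; rewrite add0r.
  by have [d ds H] := small e0; rewrite (punctured_boundary_int ds).
have ss : - s <= s by rewrite -subr_ge0 opprK addr_ge0 ?ltW.
have [c1 c2] : {within `[- s, s], continuous (P^~ (- s))} /\ {within `[- s, s], continuous (P^~ s)}.
  by split; apply: cP; rewrite ?oppr_eq0 ?normrN ?ns.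
have [c3 c4] : {within `[- s, s], continuous (Q s)} /\ {within `[- s, s], continuous (Q (- s))}.
  by split; apply: cQ; rewrite ?oppr_eq0 ?normrN ?ns.
have rE : itv_int (- s) s (fun=> 2 * r / s) = 4 * r.
  by rewrite itv_int_cst//; field.
have -> : s^-1 * itv_int (- s) s (square_sum g s) = itv_int (- s) s (fun x => s^-1 * square_sum g s x).
  by rewrite /itv_int RintegralZl//; exact: integrable_itv.
have zc : {within `[- s, s], continuous (fun x => s^-1 * square_sum g s x)}.
  exact: within_continuousZ.
rewrite -/r -rE -subr_ge0 -itv_intB//; last exact: within_cst.
move: J0; rewrite /boundary_int -!itv_intB// -itv_intD; last 2 first.
- exact: within_continuousB.
- exact: within_continuousB.
(* The 0 on the left of the inequality is replaced by the vanishing boundary integral of [F], so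
   only integrands remain to be compared, one side of the square at a time. *)
move=> <-; apply: le_itv_int.
- by apply: within_continuousD; exact: within_continuousB.
- by apply: within_continuousB => //; exact: within_cst.
move=> x /T xs; have r0 : 0 <= r := cnorm_ge0 _.
have hi := half_inv_le s0 xs.
have nb a b : (s <= `|a|) || (s <= `|b|) -> s <= cnorm (a +i* b) := @cnorm_ge_coord s a b.
have gE t : cnorm (g t) = cnorm (u * g t) by rewrite cnormM nu mul1r.
have e1 : P x (- s) <= s^-1 * cnorm (g (x -i* s)) - r / (2 * s).
  rewrite gE /P /Q /F. apply: (@divided_le (@complex.Im R) r s (x -i* s) (u * g (x -i* s))) => //.
  - by apply: nb; rewrite normrN ns lexx orbT.
  - by move=> w; apply: le_trans (normIm w); exact: ler_norm.
  - by move=> [? ?] [? ?].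
  - by move=> [? ?] /=; ring.
  - by rewrite /= mulNr opprK sqrrN addrC.
have e2 : - P x s <= s^-1 * cnorm (g (x +i* s)) - r / (2 * s).
  rewrite gE /P /Q /F; apply: (@divided_le (fun z => - complex.Im z) r s (x +i* s) (u * g (x +i* s))) => //.
  - by apply: nb; rewrite ns lexx orbT.
  - by move=> w; apply: le_trans (normIm w); rewrite -normrN; exact: ler_norm.
  - by move=> [? ?] [? ?] /=; ring.
  - by move=> [? ?] /=; ring.
  - by rewrite /= opprK addrC.
have e3 : Q s x <= s^-1 * cnorm (g (s +i* x)) - r / (2 * s).
  rewrite gE /P /Q /F; apply: (@divided_le (@complex.Re R) r s (s +i* x) (u * g (s +i* x))) => //.
  - by apply: nb; rewrite ns lexx.
  - by move=> w; apply: le_trans (normRe w); exact: ler_norm.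
  - by move=> [? ?] [? ?].
  - by move=> [? ?] /=; ring.
have e4 : - Q (- s) x <= s^-1 * cnorm (g ((- s) +i* x)) - r / (2 * s).
  rewrite gE /P /Q /F; apply: (@divided_le (fun z => - complex.Re z) r s ((- s) +i* x) (u * g ((- s) +i* x))) => //.
  - by apply: nb; rewrite normrN ns lexx.
  - by move=> w; apply: le_trans (normRe w); rewrite -normrN; exact: ler_norm.
  - by move=> [? ?] [? ?] /=; ring.
  - by move=> [? ?] /=; ring.
  - by rewrite /= mulNr opprK sqrrN.
rewrite /square_sum !mulrDr (_ : 2 * r / s = 4 * (r / (2 * s))); last by field.
lra.
Qed.

Lemma cauchy_square_bound (M : R) : (forall x y, `|x| <= s -> `|y| <= s -> (`|x| == s) || (`|y| == s) -> cnorm (g (x +i* y)) <= M) ->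
  cnorm (g 0) <= 2 * M.
Proof.
move=> gM; have ss : - s <= s by rewrite -subr_ge0 opprK addr_ge0 ?ltW.
have : itv_int (- s) s (square_sum g s) <= itv_int (- s) s (fun=> 4 * M).
  apply: le_itv_int => [||x /T xs]; [exact: sqc|exact: within_cst|].
  have m1 : cnorm (g (x -i* s)) <= M by apply: gM; rewrite ?normrN ?ns ?eqxx ?orbT.
  have m2 : cnorm (g (x +i* s)) <= M by apply: gM; rewrite ?ns ?eqxx ?orbT.
  have m3 : cnorm (g (s +i* x)) <= M by apply: gM; rewrite ?ns ?eqxx ?orbT.
  have m4 : cnorm (g ((- s) +i* x)) <= M by apply: gM; rewrite ?normrN ?ns ?eqxx ?orbT.
  by rewrite /square_sum; lra.
rewrite itv_int_cst// => H; have := cauchy_square.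
move: H; rewrite -(ler_pM2l (x := s^-1)) ?invr_gt0// => H1 H2.
have := le_trans H2 H1; rewrite (_ : s^-1 * _ = 8 * M); last by field.
lra.
Qed.
End square.

(** The bound on squares is applied to the difference quotient [G], extended by [l] at 0. There only
    its continuity is known, which is why the preceding section asks for differentiability away from
    0 only. On the boundary [G] is at most [2 * M / s]. *)
Lemma cauchy_derivative g s M l : 0 < s -> cderiv_at g 0 l ->
  (forall x y, `|x| <= s -> `|y| <= s -> exists l, cderiv_at g (x +i* y) l) ->
  (forall x y, `|x| <= s -> `|y| <= s -> cnorm (g (x +i* y)) <= M) ->
  cnorm l <= 4 * M / s.
Proof.
move=> s0 gl gd gM.
pose G t := if t == 0 then l else (g t - g 0) / t.
have ns : `|s| = s by rewrite ger0_norm// ltW.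
have sn0 : s != 0 by rewrite gt_eqF.
have s00 : `|0 : R| <= s by rewrite normr0 ltW.
have g0M : cnorm (g 0) <= M by exact: (gM 0 0).
have M0 : 0 <= M by apply: le_trans (cnorm_ge0 _) g0M.
have GE t : t != 0 -> G t = (g t - g 0) / t by rewrite /G => /negbTE ->.
have := @cauchy_square_bound G s s0.
have -> : G 0 = l by rewrite /G eqxx.
move=> H.
have {}H : cnorm l <= 2 * (2 * M / s).
  apply: H => [e e0|x y xs ys xy|x y xs ys xy].
  - have [d d0 hd] := gl e e0; exists d => // h hh.
    have [->|h0] := eqVneq h 0; first by rewrite /G eqxx subrr cnorm0 ltW.
    rewrite GE//.
    have := hd h hh; rewrite add0r => D.
    rewrite (_ : _ / _ - l = (g h - g 0 - l * h) / h); last by field.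
    by rewrite cnormM cnormV ler_pdivrMr// cnorm_gt0.
  - have t0 : x +i* y != 0 by rewrite eq_complex/= negb_and.
    have [k gk] := gd x y xs ys.
    have [d d0 hd] : exists2 d : R, 0 < d & forall h, cnorm h < d -> (x +i* y) + h != 0.
      exists (cnorm (x +i* y)); first by rewrite cnorm_gt0.
      move=> h; apply: contraTneq => /eqP; rewrite addr_eq0 => /eqP ->.
      by rewrite cnormN ltxx.
    eexists; move=> e /(cderiv_divided (g 0) t0 gk)[d' d'0 hd'].
    exists (Num.min d d'); first by rewrite lt_min d0.
    by move=> h; rewrite lt_min => /andP[/hd h1 h2]; rewrite !GE//; exact: hd'.
  - have sxy : s <= cnorm (x +i* y).
      by apply: cnorm_ge_coord; case/orP: xy => /eqP ->; rewrite lexx ?orbT.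
    have t0 : x +i* y != 0 by rewrite -cnorm_gt0 (lt_le_trans s0).
    rewrite GE// cnormM cnormV; apply: ler_pM; rewrite ?cnorm_ge0 ?invr_ge0 ?cnorm_ge0//.
      by apply: le_trans (cnormB _ _) _; have := gM x y xs ys; lra.
    by rewrite lef_pV2// posrE// (lt_le_trans s0).
by apply: le_trans H _; rewrite le_eqVlt; apply/orP; left; apply/eqP; field.
Qed.
End cauchy.

(** * Gradients and Taylor's formula in several complex variables *)

Section differentiable_eps.
Context {K : numFieldType} {V W : normedModType K}.
Implicit Types (f : V -> W) (x : V).

Lemma differentiable_of f x (df : {linear V -> W}) : continuous df ->
  (forall e, 0 < e -> \forall h \near (0 : V), `|f (h + x) - f x - df h| <= e * `|h|) ->
  differentiable f x.
Proof.
move=> dfc H.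
have E : f \o shift x = cst (f x) + df +o_ 0 id.
  apply/eqaddoP => e e0; apply: filterS (H e e0) => h.
  by rewrite -addrA -opprD.
apply/diff_locallyP; rewrite (diff_unique dfc E); split => //.
Qed.

Lemma differentiable_eps f x : differentiable f x -> forall e, 0 < e ->
  \forall h \near (0 : V), `|f (h + x) - f x - 'd f x h| <= e * `|h|.
Proof.
move=> /diff_locally /eqaddoP H e e0; apply: filterS (H e e0) => h.
by rewrite -addrA -opprD.
Qed.
End differentiable_eps.

Lemma real_is_derive (R : realType) (f : R -> R) (x l : R) :
  (forall e, 0 < e -> exists2 d : R, 0 < d & forall h, `|h| < d -> `|f (x + h) - f x - l * h| <= e * `|h|) ->
  is_derive x (1 : R) f l.
Proof.
move=> H.
have E : f \o shift x = cst (f x) + ( *:%R l : {linear R -> R}) +o_ 0 id.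
  apply/eqaddoP => e e0; have [d d0 hd] := H e e0.
  apply/nbhs_ballP; exists d => //= h; rewrite /ball/= sub0r normrN => hh.
  by have := hd h hh; rewrite -addrA -opprD [x + h]addrC.
have dc : continuous ( *:%R l : {linear R -> R}) by move=> y; apply: (@mulrl_continuous R l y).
have D := diff_unique dc E.
have fd : differentiable f x by apply/diff_locallyP; rewrite D; split.
apply: DeriveDef; first exact/derivable1_diffP.
by rewrite deriveE// D; exact: mulr1.
Qed.

Section complex_space.
Context {R : realType} {n : nat}.
Local Notation C := R[i].
Local Notation Cn := 'rV[R[i]]_n.
Implicit Types (f : Cn -> C) (u v w z a : Cn) (k : C).

(* The norm of ['rV[R[i]]_n] takes its values in [R[i]]. *)
Definition vnorm v : R := complex.Re `|v|.

Lemma realcD (x y : R) : (x + y)%:C = x%:C + y%:C :> C. Proof. exact: rmorphD. Qed.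
Lemma realcM (x y : R) : (x * y)%:C = x%:C * y%:C :> C. Proof. exact: rmorphM. Qed.

Lemma vnormE v : `|v| = (vnorm v)%:C.
Proof. by rewrite /vnorm RRe_real// normr_real. Qed.
Lemma vnorm_ge0 v : 0 <= vnorm v. Proof. by rewrite -lecR -vnormE normr_ge0. Qed.
Lemma vnormD v w : vnorm (v + w) <= vnorm v + vnorm w.
Proof. by rewrite -lecR realcD -!vnormE ler_normD. Qed.
Lemma vnormZ k v : vnorm (k *: v) = cnorm k * vnorm v.
Proof. by apply: complexI; rewrite realcM -!vnormE -cnormE normrZ. Qed.
Lemma vnormN v : vnorm (- v) = vnorm v. Proof. by rewrite /vnorm normrN. Qed.
Lemma vnorm0 : vnorm 0 = 0. Proof. by rewrite /vnorm normr0. Qed.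
Lemma vnorm_eq0 v : (vnorm v == 0) = (v == 0).
Proof. by rewrite -(inj_eq (@complexI R)) -vnormE normr_eq0. Qed.
Lemma vnorm_gt0 v : (0 < vnorm v) = (v != 0).
Proof. by rewrite lt_def vnorm_eq0 vnorm_ge0 andbT. Qed.
Lemma vnormC v w : vnorm (v - w) = vnorm (w - v).
Proof. by rewrite -vnormN opprB. Qed.

Lemma cnorm_coord v j : cnorm (v 0 j) <= vnorm v.
Proof.
rewrite -lecR -vnormE -cnormE {2}/Num.Def.normr/= mx_normE -[leLHS]nngE num_le.
by apply: (le_bigmax _ (fun i => `|v i.1 i.2|%:nng) (0, j)).
Qed.

Lemma vnorm_le v (e : R) : 0 <= e -> (forall j, cnorm (v 0 j) <= e) -> vnorm v <= e.
Proof.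
move=> e0 H; have [->|v0] := eqVneq (vnorm v) 0; first by [].
have := v0; rewrite -(inj_eq (@complexI R)) -vnormE => /mx_norm_neq0[[i j]/=].
rewrite -[mx_norm v]/`|v| vnormE cnormE (ord1 i) => /complexI ->; exact: H.
Qed.

Definition cdot a v : C := \sum_j a 0 j * v 0 j.

Lemma cdot_is_linear a : linear (cdot a).
Proof.
move=> k u v; rewrite /cdot scaler_sumr -big_split/=; apply: eq_bigr => j _.
by rewrite !mxE /GRing.scale/=; ring.
Qed.
HB.instance Definition _ a := GRing.isLinear.Build C Cn C _ (cdot a) (cdot_is_linear a).

Lemma cdotBl a b v : cdot (a - b) v = cdot a v - cdot b v.
Proof. by rewrite /cdot -sumrB; apply: eq_bigr => j _; rewrite !mxE mulrBl. Qed.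

Lemma cdot_scale a k v : cdot a (k *: v) = k * cdot a v.
Proof. by rewrite linearZ. Qed.

(** The l1 norm of [a], dual to the sup norm [vnorm]. *)
Definition cdot_norm a : R := \sum_j cnorm (a 0 j).

Lemma cnorm_sum (I : Type) (r : seq I) (F : I -> C) : cnorm (\sum_(i <- r) F i) <= \sum_(i <- r) cnorm (F i).
Proof.
elim/big_rec2: _ => [|i x y _ H]; first by rewrite cnorm0.
by apply: le_trans (cnormD _ _) _; rewrite lerD2l.
Qed.

Lemma cdot_le a v : cnorm (cdot a v) <= cdot_norm a * vnorm v.
Proof.
apply: le_trans (cnorm_sum _ _) _; rewrite mulr_suml; apply: ler_sum => j _.
by rewrite cnormM ler_wpM2l ?cnorm_ge0// cnorm_coord.
Qed.

Lemma cdot_norm_ge0 a : 0 <= cdot_norm a.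
Proof. by apply: sumr_ge0 => j _; exact: cnorm_ge0. Qed.

Lemma linear_cdot (l : {linear Cn -> C}) v : l v = cdot (\row_j l (delta_mx 0 j)) v.
Proof.
rewrite {1}(row_sum_delta v) linear_sum; apply: eq_bigr => j _.
by rewrite linearZ mxE /GRing.scale/= mulrC.
Qed.

(** Carrying the differential as an explicit row vector allows gradients to be compared and passed
    to the limit coordinate by coordinate. *)
Definition cgrad f z a := forall e : R, 0 < e ->
  exists2 d : R, 0 < d & forall v, vnorm v < d -> cnorm (f (z + v) - f z - cdot a v) <= e * vnorm v.

Lemma nbhs0_vnorm (P : Cn -> Prop) :
  (\forall v \near (0 : Cn), P v) <-> exists2 d : R, 0 < d & forall v, vnorm v < d -> P v.
Proof.
split=> [/nbhs_ballP[d /= d0 H]|[d d0 H]].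
  have dE : (complex.Re d)%:C = d by rewrite RRe_real// gtr0_real.
  exists (complex.Re d); first by rewrite -ltcR dE.
  by move=> v vd; apply: H; rewrite -ball_normE/= sub0r normrN vnormE -dE ltcR.
apply/nbhs_ballP; exists d%:C; first by rewrite /= ltcR.
by move=> v; rewrite -ball_normE/= sub0r normrN vnormE ltcR => /H.
Qed.

Lemma nbhs_vnorm z (P : Cn -> Prop) :
  (\forall w \near z, P w) <-> exists2 d : R, 0 < d & forall v, vnorm v < d -> P (z + v).
Proof.
rewrite -(nbhs0_vnorm (fun v => P (z + v))) [X in X <-> _](near_shift 0 z) subr0.
by split; apply: filterS => v /=; rewrite addrC.
Qed.

Lemma cgradP f z : differentiable f z <-> exists a, cgrad f z a.
Proof.
split=> [df|[a fa]].
  exists (\row_j 'd f z (delta_mx 0 j)) => e e0.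
  have := @differentiable_eps _ _ _ f z df e%:C.
  rewrite ltcR => /(_ e0)/nbhs0_vnorm[d d0 hd]; exists d => // v /hd.
  by rewrite -linear_cdot [z + v]addrC -lecR realcM -vnormE -cnormE.
apply: (@differentiable_of _ _ _ f z (cdot a)).
  move=> y; apply/(@cvgrPdist_le _ _ _ (nbhs y)) => e e0.
  have eE : (complex.Re e)%:C = e by rewrite RRe_real// gtr0_real.
  have {}e0 : 0 < complex.Re e by rewrite -ltcR eE.
  have K0 : 0 < 1 + cdot_norm a by rewrite ltr_pwDl// cdot_norm_ge0.
  apply/nbhs_vnorm; exists (complex.Re e / (1 + cdot_norm a)); first by rewrite divr_gt0.
  move=> v; rewrite ltr_pdivlMr// => H; rewrite -eE -linearB opprD addrA subrr sub0r linearN normrN.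
  rewrite cnormE lecR; apply: le_trans (cdot_le _ _) _; have := vnorm_ge0 v; nra.
move=> e e0; have eE : (complex.Re e)%:C = e by rewrite RRe_real// gtr0_real.
apply/nbhs0_vnorm; have [|d d0 hd] := fa (complex.Re e); first by rewrite -ltcR eE.
exists d => // v /hd; rewrite -lecR realcM eE -vnormE -cnormE [v + z]addrC. exact.
Qed.

End complex_space.

Section gradient.
Context {R : realType} {n : nat}.
Local Notation C := R[i].
Local Notation Cn := 'rV[R[i]]_n.
Implicit Types (f : Cn -> C) (u v w z a : Cn) (t : C).

Lemma cdot0 a : cdot a 0 = 0. Proof. exact: linear0. Qed.

Lemma cgrad_slice f w v t a : cgrad f (w + t *: v) a ->
  cderiv_at (fun t => f (w + t *: v)) t (cdot a v).
Proof.
move=> fa e e0; have K0 : 0 < 1 + vnorm v by rewrite ltr_pwDl// vnorm_ge0.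
have [d d0 hd] := fa _ (divr_gt0 e0 K0).
exists (d / (1 + vnorm v)); first by rewrite divr_gt0.
move=> h; rewrite ltr_pdivlMr// => hh.
have H0 := cnorm_ge0 h; have V0 := vnorm_ge0 v.
have := hd (h *: v); rewrite vnormZ => /(_ _)/le_trans; rewrite scalerDl addrA cdot_scale mulrC.
rewrite [cdot a v * h]mulrC; apply; first by nra.
rewrite (_ : _ / _ * _ = e * cnorm h * (vnorm v / (1 + vnorm v))); last by ring.
by rewrite ler_piMr ?mulr_ge0 ?(ltW e0)// ler_pdivrMr// mul1r lerDr.
Qed.

Lemma cgradB f g z a b : cgrad f z a -> cgrad g z b -> cgrad (fun w => f w - g w) z (a - b).
Proof.
move=> fa gb e e0; have e2 : 0 < e / 2 by rewrite divr_gt0.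
have [d d0 hd] := fa _ e2; have [d' d'0 hd'] := gb _ e2.
exists (Num.min d d'); first by rewrite lt_min d0.
move=> v; rewrite lt_min => /andP[/hd h1 /hd' h2].
rewrite cdotBl (_ : _ - _ - _ = (f (z + v) - f z - cdot a v) - (g (z + v) - g z - cdot b v)); last by ring.
apply: le_trans (cnormB _ _) _.
rewrite (_ : e * vnorm v = e / 2 * vnorm v + e / 2 * vnorm v); last by field.
exact: lerD.
Qed.

Lemma cgrad_shift f z a h : cgrad f (z + h) a -> cgrad (fun w => f (w + h)) z a.
Proof. by move=> fa e /fa[d d0 hd]; exists d => // v /hd; rewrite [z + v + h]addrAC. Qed.

Lemma cgrad_cdot a b z : cgrad (fun w => cdot a (w - b)) z a.
Proof.
move=> e e0; exists 1 => // v _.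
rewrite -linearB (_ : z + v - b - (z - b) = v) ?subrr ?cnorm0 ?mulr_ge0 ?vnorm_ge0 ?ltW//.
by rewrite opprB addrA subrK addrC addKr.
Qed.

Lemma unimodular_conj (c : C) : exists2 u : C, cnorm u = 1 & u * c = (cnorm c)%:C.
Proof.
have [->|c0] := eqVneq c 0; first by exists 1; rewrite ?cnorm1// mulr0 cnorm0.
exists ((cnorm c)%:C / c); last by rewrite divfK.
by rewrite cnormM cnormV cnorm_real ger0_norm ?cnorm_ge0// divff// cnorm_eq0.
Qed.

(** A unimodular factor [u] makes the increment real and nonnegative; the real mean value theorem
    then applies to the real part of [u * f] along the segment. *)
Lemma mean_value f w v (B : R) :
  (forall t : R, 0 <= t <= 1 -> exists2 a, cgrad f (w + t%:C *: v) a & cnorm (cdot a v) <= B) ->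
  cnorm (f (w + v) - f w) <= B.
Proof.
move=> H; have [u u1 uE] := unimodular_conj (f (w + v) - f w).
have [F FP] : exists F : R -> C, forall t : R, 0 <= t <= 1 ->
    cderiv_at (fun t : C => u * f (w + t *: v)) t%:C (u * F t) /\ cnorm (u * F t) <= B.
  suff /choice[F FP] : forall t : R, exists d, 0 <= t <= 1 -> cderiv_at (fun t : C => u * f (w + t *: v)) t%:C (u * d) /\ cnorm (u * d) <= B by exists F.
  move=> t; have [t01|] := boolP (0 <= t <= 1); last by exists 0.
  have [a fa aB] := H t t01; exists (cdot a v) => _; split; last by rewrite cnormM u1 mul1r.
  exact/cderiv_scale/cgrad_slice.
pose phi (t : R) := complex.Re (u * f (w + t%:C *: v)).
have phid (t : R) : 0 <= t <= 1 -> is_derive t (1 : R) phi (complex.Re (u * F t)).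
  move=> /FP[+ _] => dF; apply: real_is_derive => e /dF[d d0 hd]; exists d => // h hh.
  have := hd h%:C; rewrite cnorm_real => /(_ hh); apply: le_trans.
  apply: le_trans (normRe _); rewrite le_eqVlt; apply/orP; left; apply/eqP; congr `| _ |.
  rewrite /phi realcD scalerDl addrA; case: (u * f _) => ? ?; case: (u * f _) => ? ?; case: (u * F _) => ? ? /=; ring.
have [||c] := @MVT R phi (fun t : R => complex.Re (u * F t)) 0 1 ltr01.
- by move=> t; rewrite in_itv/= => /andP[t0 t1]; apply: phid; rewrite !ltW.
- apply: within_continuousP => t /phid phit; apply: differentiable_continuous.
  by apply/derivable1_diffP; exact: ex_derive.
rewrite in_itv/= => /andP[c0 c1]; rewrite /phi scale1r scale0r addr0 subr0 mulr1 => E.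
have -> : cnorm (f (w + v) - f w) = complex.Re (u * F c).
  rewrite -E -[LHS]/(complex.Re (cnorm (f (w + v) - f w))%:C) -uE mulrBr.
  by case: (u * _) => ? ?; case: (u * _).
have [|_ HB] := FP c; first by rewrite !ltW.
by apply: le_trans HB; apply: le_trans (ler_norm _) (normRe _).
Qed.

Section ball.
Variables (f : Cn -> C) (z : Cn) (r M : R).
Hypotheses (r0 : 0 < r) (fd : forall w, vnorm (w - z) <= r -> exists a, cgrad f w a)
  (fM : forall w, vnorm (w - z) <= r -> cnorm (f w) <= M).

Lemma cgrad_bound a v : cgrad f z a -> cnorm (cdot a v) <= 8 * M / r * vnorm v.
Proof.
move=> fa; have [->|v0] := eqVneq v 0; first by rewrite cdot0 cnorm0 vnorm0 mulr0.
have V0 : 0 < vnorm v by rewrite vnorm_gt0.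
(* Points of the square of half-side [s] have modulus at most [2 * s], so the slice through [z] in
   direction [v] stays in the ball of radius [r]. *)
pose s := r / (2 * vnorm v).
have s0 : 0 < s by rewrite divr_gt0// mulr_gt0.
have sz x y : `|x| <= s -> `|y| <= s -> vnorm (z + (x +i* y) *: v - z) <= r.
  move=> xs ys; rewrite addrC addKr vnormZ -ler_pdivlMr//; apply: le_trans (cnorm_le _ _) _.
  by apply: le_trans (lerD xs ys) _; rewrite /s le_eqVlt; apply/orP; left; apply/eqP; field; rewrite gt_eqF.
have := @cauchy_derivative R (fun t => f (z + t *: v)) s M (cdot a v) s0.
rewrite (_ : 4 * M / s = 8 * M / r * vnorm v); last by rewrite /s; field; rewrite !gt_eqF.
apply.
- by apply: cgrad_slice; rewrite scale0r addr0.
- by move=> x y xs ys; have [b fb] := fd (sz x y xs ys); exists (cdot b v); exact: cgrad_slice.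
- by move=> x y xs ys; apply/fM/sz.
Qed.
End ball.

Section taylor.
Variables (f : Cn -> C) (z : Cn) (r M : R).
Hypotheses (r0 : 0 < r) (fd : forall w, vnorm (w - z) <= r -> exists a, cgrad f w a)
  (fM : forall w, vnorm (w - z) <= r -> cnorm (f w) <= M).

Lemma cgrad_bound_half a v w : vnorm (w - z) <= r / 2 -> cgrad f w a ->
  cnorm (cdot a v) <= 16 * M / r * vnorm v.
Proof.
move=> wz fa; have r2 : 0 < r / 2 by rewrite divr_gt0.
have sub u : vnorm (u - w) <= r / 2 -> vnorm (u - z) <= r.
  move=> uw; rewrite -(subrK w u) -addrA; apply: le_trans (vnormD _ _) _; have := r0; lra.
have := @cgrad_bound f w (r / 2) M r2 (fun u uw => fd (sub u uw)) (fun u uw => fM (sub u uw)) a v fa.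
by rewrite (_ : 8 * M / (r / 2) = 16 * M / r)//; field; rewrite gt_eqF.
Qed.

Lemma ball_convex w h (t : R) (s : R) : 0 <= t <= 1 -> vnorm (w - z) <= s -> vnorm (w + h - z) <= s ->
  vnorm (w + t%:C *: h - z) <= s.
Proof.
move=> /andP[t0 t1] h1 h2.
rewrite (_ : _ - z = (1 - t)%:C *: (w - z) + t%:C *: (w + h - z)).
  apply: le_trans (vnormD _ _) _; rewrite !vnormZ !cnorm_real !ger0_norm ?subr_ge0//.
  by nra.
rewrite (_ : (1 - t)%:C = 1 - t%:C); last exact: (rmorphB (@real_complex R)).
apply/rowP => j; rewrite !mxE; ring.
Qed.

Lemma lipschitz_half w h : vnorm (w - z) <= r / 2 -> vnorm (w + h - z) <= r / 2 ->
  cnorm (f (w + h) - f w) <= 16 * M / r * vnorm h.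
Proof.
move=> wz whz; apply: mean_value => t t01.
have B : vnorm (w + t%:C *: h - z) <= r / 2 by exact: ball_convex.
have [|a fa] := fd (w := w + t%:C *: h); first by apply: le_trans B _; have := r0; lra.
by exists a => //; exact: cgrad_bound_half B fa.
Qed.

(** The gradient estimate is applied to the difference of [f] and its translate by [h], which is
    itself small by [lipschitz_half]; no second derivative appears. The constant is 8 * 16 * 4. *)
Lemma cgrad_lipschitz a b h v : vnorm h <= r / 4 -> cgrad f z a -> cgrad f (z + h) b ->
  cnorm (cdot b v - cdot a v) <= 512 * M / r ^+ 2 * vnorm h * vnorm v.
Proof.
move=> hr fa fb; have r4 : 0 < r / 4 by rewrite divr_gt0.
have sub w : vnorm (w - z) <= r / 4 -> vnorm (w + h - z) <= r / 2.
  by move=> wz; rewrite addrAC; apply: le_trans (vnormD _ _) _; have := r0; lra.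
have := @cgrad_bound (fun w => f (w + h) - f w) z (r / 4) (16 * M / r * vnorm h) r4.
move=> /(_ _ _ (b - a) v) H.
rewrite -cdotBl (_ : 512 * M / r ^+ 2 * vnorm h * vnorm v = 8 * (16 * M / r * vnorm h) / (r / 4) * vnorm v); last first.
  by field; rewrite gt_eqF.
apply: H.
- move=> w wz; have [|c fc] := fd (w := w); first by have := r0; lra.
  have [|d fD] := fd (w := w + h); first by apply: le_trans (sub _ wz) _; have := r0; lra.
  by exists (d - c); apply: cgradB => //; exact: cgrad_shift.
- by move=> w wz; apply: lipschitz_half; [by have := r0; lra|exact: sub].
- by apply: cgradB => //; exact: cgrad_shift.
Qed.

(** Mean value inequality for [f w - cdot a (w - z)], whose gradient along the segment is controlled
    by [cgrad_lipschitz]. The constant depends on [M] and [r] only, so the estimate is uniform over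
    a bounded family. *)
Lemma taylor a v : vnorm v <= r / 4 -> cgrad f z a ->
  cnorm (f (z + v) - f z - cdot a v) <= 512 * M / r ^+ 2 * vnorm v ^+ 2.
Proof.
move=> vr fa.
have M0 : 0 <= M by apply: le_trans (cnorm_ge0 (f z)) (fM _); rewrite subrr vnorm0 ltW.
have := @mean_value (fun w => f w - cdot a (w - z)) z v (512 * M / r ^+ 2 * vnorm v ^+ 2).
rewrite [z + v - z]addrC addKr subrr cdot0 subr0 addrAC; apply => t /andP[t0 t1].
have tv : vnorm (t%:C *: v) <= vnorm v.
  by rewrite vnormZ cnorm_real ger0_norm// ler_piMl// vnorm_ge0.
have [|b fb] := fd (w := z + t%:C *: v).
  by rewrite addrC addKr; have := r0; lra.
exists (b - a); first by apply: cgradB => //; exact: cgrad_cdot.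
rewrite cdotBl; apply: le_trans (cgrad_lipschitz (h := t%:C *: v) v _ fa fb) _; first by have := r0; lra.
have K0 : 0 <= 512 * M / r ^+ 2.
  by apply: divr_ge0; [apply: mulr_ge0 M0; exact: ler0n|exact/exprn_ge0/ltW].
rewrite [vnorm v ^+ 2]expr2 mulrA; apply: ler_wpM2r; first exact: vnorm_ge0.
exact: ler_wpM2l.
Qed.
End taylor.
End gradient.

(** * Local bounds by integral means *)

Section measure_space.
Context {R : realType} {n : nat}.
Local Notation C := R[i].
Local Notation Cn := 'rV[R[i]]_n.
Local Notation Rn := (n.-tuple (measurableTypeR R)).
Local Notation cp := (@cpoint R n).
Implicit Types (f : Cn -> C) (v w z a : Cn) (x : Rn * Rn) (e : R).

Definition real_box (b : 'I_n -> R) e : set Rn := [set X | forall j, `|tnth X j - b j| <= e].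

Lemma measurable_real_box (b : 'I_n -> R) e : measurable (real_box b e).
Proof.
rewrite (_ : real_box b e = \bigcap_(j in [set: 'I_n]) ((fun X : Rn => tnth X j) @^-1` `[b j - e, b j + e])).
  apply: fin_bigcap_measurable => // j _; rewrite -[X in measurable X]setTI.
  by apply: measurable_tnth => //; exact: measurable_itv.
apply/seteqP; split => X /= H.
  by move=> j _ /=; rewrite in_itv/=; have := H j; rewrite ler_distl.
by move=> j; have := H j I; rewrite /= in_itv/= ler_distl.
Qed.

Definition coord_box z e : set (Rn * Rn) :=
  real_box (fun j => complex.Re (z 0 j)) e `*` real_box (fun j => complex.Im (z 0 j)) e.

Lemma measurable_coord_box z e : measurable (coord_box z e).
Proof. by apply: measurableX; exact: measurable_real_box. Qed.

Lemma cpointE x j : cp x 0 j = tnth x.1 j +i* tnth x.2 j.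
Proof. by rewrite mxE. Qed.

Lemma coord_box_vnorm z e x : 0 <= e -> coord_box z e x -> vnorm (cp x - z) <= 2 * e.
Proof.
move=> e0 [h1 h2]; apply: vnorm_le => [|j]; first by rewrite mulr_ge0.
have := h1 j; have := h2 j; rewrite !mxE; case: (z 0 j) => p q /= h3 h4.
by apply: le_trans (cnorm_le _ _) _; rewrite mulr_natl mulr2n; apply: lerD.
Qed.

Lemma vnorm_coord_box z e x : vnorm (cp x - z) <= e -> coord_box z e x.
Proof.
move=> H; have Hj j : cnorm (cp x 0 j - z 0 j) <= e.
  by apply: le_trans H; apply: le_trans (cnorm_coord _ j); rewrite !mxE.
split => j /=; have := Hj j; rewrite cpointE; case: (z 0 j) => p q; apply: le_trans.
  exact: (normRe ((tnth x.1 j +i* tnth x.2 j) - (p +i* q))).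
exact: (normIm ((tnth x.1 j +i* tnth x.2 j) - (p +i* q))).
Qed.

Definition coords z : Rn * Rn :=
  ([tuple complex.Re (z 0 j) | j < n], [tuple complex.Im (z 0 j) | j < n]).

Lemma coordsK z : cp (coords z) = z.
Proof. by apply/rowP => j; rewrite cpointE !tnth_mktuple; case: (z 0 j). Qed.

Local Notation Qn := (n.-tuple rat * n.-tuple rat)%type.

Definition rat_point (q : Qn) : Cn := \row_j (ratr (tnth q.1 j) +i* ratr (tnth q.2 j)).

Lemma rat_approx (t e : R) : 0 < e -> exists q : rat, `|t - ratr q| < e.
Proof.
move=> e0; have [|q] := @rat_in_itvoo R (t - e) (t + e); first by lra.
by rewrite in_itv/= => /andP[? ?]; exists q; rewrite ltr_norml; lra.
Qed.

Lemma rat_point_dense w e : 0 < e -> exists q, vnorm (rat_point q - w) < e.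
Proof.
move=> e0; have e2 : 0 < e / 3 by rewrite divr_gt0.
have [F FP] := choice (fun j => rat_approx (complex.Re (w 0 j)) e2).
have [G GP] := choice (fun j => rat_approx (complex.Im (w 0 j)) e2).
exists ([tuple F j | j < n], [tuple G j | j < n]).
apply: (@le_lt_trans _ _ (2 * (e / 3))); last by lra.
apply: vnorm_le => [|j]; first by rewrite mulr_ge0// ltW.
have := FP j; have := GP j; rewrite !mxE !tnth_mktuple; case: (w 0 j) => x y /= h1 h2.
apply: le_trans (cnorm_le _ _) _; rewrite [2 * _]mulr_natl mulr2n; apply: lerD.
  by rewrite distrC ltW.
by rewrite distrC ltW.
Qed.

(** The sigma-algebra on tuples is generated by coordinates, so an open set is exhausted by
    countably many boxes with rational centres and half-sides [1 / (k + 1)]. *)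
Lemma measurable_open_preimage (U : set Cn) : open U -> measurable (cp @^-1` U).
Proof.
move=> oU.
pose V (qk : Qn * nat) := coord_box (rat_point qk.1) (qk.2.+1%:R^-1).
rewrite (_ : _ @^-1` _ = \bigcup_qk (if `[< V qk `<=` cp @^-1` U >] then V qk else set0)).
  apply: countable_bigcupT_measurable; first exact: countableP.
  by move=> qk; case: ifP => // _; exact: measurable_coord_box.
apply/seteqP; split => [x /= Ux|x /= [qk _]]; last by case: ifP => // /asboolP; exact.
have /nbhs_vnorm[d d0 hd] : \forall w \near cp x, U w by exact: open_nbhs_nbhs.
(* The rational centre lies within [1 / (k + 1)] of [cp x] and the box within [2 / (k + 1)] of its
   centre, hence the third of [d]. *)
have [k kP] : exists k : nat, k.+1%:R^-1 < d / 3 :> R.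
  exists (Num.Def.archi_bound (d / 3)^-1); have d3 : 0 < d / 3 by rewrite divr_gt0.
  rewrite -[ltRHS]invrK ltf_pV2 ?posrE ?invr_gt0 ?ltr0n//.
  apply: (@lt_trans _ _ (Num.Def.archi_bound (d / 3)^-1)%:R); last by rewrite ltr_nat.
  by apply: archi_boundP; rewrite invr_ge0 ltW.
have k0 : 0 < k.+1%:R^-1 :> R by rewrite invr_gt0 ltr0n.
have [q qP] := rat_point_dense (cp x) k0.
have xV : V (q, k) x by apply: vnorm_coord_box; rewrite vnormC ltW.
exists (q, k) => //; case: ifP => // /asboolP; apply => y Vy /=.
have /= yq := coord_box_vnorm (ltW k0) Vy.
have /hd : vnorm (cp y - cp x) < d; last by rewrite addrC subrK.
rewrite -(subrK (rat_point q) (cp y)) -addrA; apply: le_lt_trans (vnormD _ _) _.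
by move: kP qP yq; move: (k.+1%:R^-1 : R) => i; lra.
Qed.

Lemma measurable_continuous (U : set Cn) (F : Cn -> R) : open U ->
  (forall w, U w -> {for w, continuous F}) ->
  measurable_fun (cp @^-1` U) (F \o cp).
Proof.
move=> oU cF mU; apply: (measurability _ (RGenOInfty.measurableE R)) => //.
move=> /= _ [_ [b ->] <-].
rewrite (_ : _ `&` _ = cp @^-1` (U `&` F @^-1` `]b, +oo[)); last by [].
apply: measurable_open_preimage; rewrite openE => w [/= Uw]; rewrite in_itv/= andbT => bF.
apply: filterI; first exact: open_nbhs_nbhs.
have : nbhs (F w) `]b, +oo[%classic by apply: open_nbhs_nbhs; split; [exact: rray_open|rewrite /= in_itv/= bF].
exact: (cF w Uw).
Qed.

Lemma cgrad_continuous_cnorm f w a : cgrad f w a -> {for w, continuous (fun v => cnorm (f v))}.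
Proof.
move=> fa; apply/(@cvgrPdist_le _ _ _ (nbhs w)) => e e0; apply/nbhs_vnorm.
have K0 : 0 < 1 + cdot_norm a by rewrite ltr_pwDl// cdot_norm_ge0.
have [d d0 hd] := fa 1 ltr01.
exists (Num.min d (e / (1 + cdot_norm a))); first by rewrite lt_min d0 divr_gt0.
move=> v; rewrite lt_min ltr_pdivlMr// => /andP[/hd h1 h2].
rewrite distrC; apply: le_trans (cnorm_dist _ _) _.
rewrite -(subrK (cdot a v) (_ - _)); apply: le_trans (cnormD _ _) _.
by have := cdot_le a v; lra.
Qed.

End measure_space.

Section box_measure.
Context {R : realType}.
Local Open Scope ereal_scope.

Lemma lebesgue_tuple_box_lty n (b : 'I_n -> R) (e : R) : lebesgue_tuple R n (real_box b e) < +oo.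
Proof.
elim: n b => [|n IH] b; first by rewrite /= diracE ltry.
have := IH (fun j => b (lift ord0 j)).
set A := real_box _ e => Alty.
rewrite /=/tuple_cons_measure /pushforward (_ : _ @^-1` _ = `[(b ord0 - e)%R, (b ord0 + e)%R]%classic `*` A).
  rewrite product_measure1E//; last exact: measurable_real_box.
  rewrite /= lebesgue_measure_itv/=; case: ifP => [ab|_]; last by rewrite mul0e ltry.
  by rewrite -EFinB lte_mul_pinfty// lee_fin subr_ge0 -lee_fin ltW.
apply/seteqP; split => -[x X]/=.
  move=> H; split; last by move=> j; have := H (lift ord0 j); rewrite /tuple_cons/= tnthS.
  by have := H ord0; rewrite /tuple_cons tnth0/= in_itv/= ler_distl.
move=> [/= h1 h2] j; rewrite /tuple_cons; case: (unliftP ord0 j) => [k|] -> /=.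
  by rewrite tnthS; exact: h2.
by rewrite tnth0; move: h1; rewrite in_itv/= ler_distl.
Qed.

Lemma coord_box_lty n (z : 'rV[R[i]]_n) (e : R) :
  (lebesgue_tuple R n \x lebesgue_tuple R n) (coord_box z e) < +oo.
Proof.
rewrite product_measure1E; try exact: measurable_real_box.
by rewrite lte_mul_pinfty ?lebesgue_tuple_box_lty// ge0_fin_numE// lebesgue_tuple_box_lty.
Qed.
End box_measure.

Section local_mean.
Context {R : realType} {n : nat}.
Local Notation C := R[i].
Local Notation Cn := 'rV[R[i]]_n.
Local Notation MR := (measurableTypeR R).
Local Notation Rn := (n.-tuple (measurableTypeR R)).
Local Notation cp := (@cpoint R n).
Local Notation leb := (@lebesgue_measure R).

Definition holo (U : set Cn) (f : Cn -> C) := forall w, U w -> exists a, cgrad f w a.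

Lemma cpoint_set_tnth (X Y : Rn) j (x y : R) :
  cp (set_tnth X j (tnth X j + x), set_tnth Y j (tnth Y j + y)) =
  cp (X, Y) + (x +i* y) *: delta_mx 0 j.
Proof.
apply/rowP => i; rewrite !mxE /= !tnth_mktuple; case: eqVneq => [->|_].
  by rewrite mulr1.
by rewrite mulr0 addr0.
Qed.

Lemma measurable_set_tnth (X : Rn) j : measurable_fun setT (fun v : MR => set_tnth X j v : Rn).
Proof.
apply/measurable_fun_tnthP => i.
rewrite (_ : _ \o _ = fun v : MR => if i == j then v else tnth X i).
  by case: (i == j) => //; exact: measurable_cst.
by apply/funext => v /=; rewrite tnth_mktuple.
Qed.

(** In each coordinate [cauchy_square] is integrated over the half-sides [s] in [[r, 2r]] by
    [area_mean], and [tuple_mean] joins the coordinates. *)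
Lemma local_mean (U : set Cn) (f : Cn -> C) (z : Cn) (r : R) :
  open U -> holo U f -> 0 < r -> (forall w, vnorm (w - z) <= 4 * r -> U w) ->
  ((cnorm (f z))%:E <= ((r ^- 2) ^+ n)%:E *
    \int[lebesgue_tuple R n \x lebesgue_tuple R n]_(x in coord_box z (2 * r)%R) (cnorm (f (cp x)))%:E)%E.
Proof.
move=> oU fU r0 zU; set B := coord_box z (2 * r).
have r20 : 0 <= 2 * r by rewrite mulr_ge0// ltW.
have BU x : B x -> U (cp x).
  by move=> /(coord_box_vnorm r20) H; apply: zU; lra.
have mB : measurable B := measurable_coord_box _ _.
have mf : measurable_fun B (fun x => (cnorm (f (cp x)))%:E).
  apply/measurable_EFinP; apply: (measurable_funS (E := cp @^-1` U)) => //.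
    exact: measurable_open_preimage.
  apply: (measurable_continuous (F := fun w => cnorm (f w))) => // w /fU[a fa].
  exact: cgrad_continuous_cnorm fa.
(* Extension by 0, because the averaging lemmas integrate over the whole space. *)
pose h := (fun x => (cnorm (f (cp x)))%:E) \_ B.
have mh : measurable_fun setT h by exact: (measurable_restrictT _ mB).1 mf.
have h0 x : (0 <= h x)%E by apply: erestrict_ge0 => y _; rewrite lee_fin cnorm_ge0.
have hB x : B x -> h x = (cnorm (f (cp x)))%:E by move=> Bx; rewrite /h patchE mem_set.
rewrite integral_mkcond -/h.
have Bz : B (coords z) by apply: vnorm_coord_box; rewrite coordsK subrr vnorm0.
rewrite -{1}(coordsK z) -hB//.
have K0 : 0 <= r ^- 2 by rewrite invr_ge0 sqr_ge0.
have := @tuple_mean R n (r ^- 2) h (coords z).1 (coords z).2 K0 mh h0; apply => j X Y jX jY.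
have [Bw|nBw] := pselect (B (X, Y)); last first.
  rewrite {1}/h patchE memNset// mule_ge0 ?lee_fin//.
  by apply: integral_ge0 => x _; apply: integral_ge0 => y _; exact: h0.
rewrite hB//=; set w := cp (X, Y).
pose g (t : C) := f (w + t *: delta_mx 0 j).
have jX0 : tnth X j = complex.Re (z 0 j) by rewrite jX tnth_mktuple.
have jY0 : tnth Y j = complex.Im (z 0 j) by rewrite jY tnth_mktuple.
pose G (xy : MR * MR) := h (set_tnth X j xy.1, set_tnth Y j xy.2).
have mG : measurable_fun setT G.
  apply: measurableT_comp => //; apply: measurable_fun_pair.
    by apply: (measurableT_comp (measurable_set_tnth X j)).
  by apply: (measurableT_comp (measurable_set_tnth Y j)).
(* The [j]-th coordinate of the point is that of the centre [z], so moving it by at most [2 * r]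
   does not leave the box. *)
have BG x y : `|x| <= 2 * r -> `|y| <= 2 * r ->
    B (set_tnth X j (tnth X j + x), set_tnth Y j (tnth Y j + y)).
  move=> hx hy; have [h1 h2] := Bw; split => i /=; rewrite tnth_mktuple; case: eqVneq => [->|_].
  - by rewrite jX0 addrC addKr.
  - exact: h1.
  - by rewrite jY0 addrC addKr.
  - exact: h2.
have GE x y : `|x| <= 2 * r -> `|y| <= 2 * r -> G (tnth X j + x, tnth Y j + y) = (cnorm (g (x +i* y)))%:E.
  by move=> hx hy; rewrite /G hB ?cpoint_set_tnth//; exact: BG.
have gd x y : `|x| <= 2 * r -> `|y| <= 2 * r -> exists l, cderiv_at g (x +i* y) l.
  move=> hx hy; have /fU[a fa] := BU _ (BG _ _ hx hy).
  by exists (cdot a (delta_mx 0 j)); apply: cgrad_slice; rewrite -cpoint_set_tnth.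
have g0 : g 0 = f w by rewrite /g scale0r addr0.
have main s : r <= s <= 2 * r -> ((4 * r * cnorm (f w))%:E <= \int[leb]_t
     (G (tnth X j + t, tnth Y j - s)%R + G (tnth X j + t, tnth Y j + s)%R +
     (G (tnth X j + s, tnth Y j + t)%R + G (tnth X j - s, tnth Y j + t)%R)))%E.
  move=> /andP[rs s2]; have s0 : 0 < s by lra.
  have gc (e : R) : 0 < e -> exists2 d : R, 0 < d & forall k, cnorm k < d -> cnorm (g k - g 0) <= e.
    have [||l gl] := gd 0 0; rewrite ?normr0//.
    by move=> /(cderiv_continuous gl)[d d0 hd]; exists d => // k /hd; rewrite add0r.
  have gd' x y : `|x| <= s -> `|y| <= s -> (x != 0) || (y != 0) -> exists l, cderiv_at g (x +i* y) l.
    by move=> xs ys _; apply: gd; apply: le_trans s2.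
  have ns : `|s| <= 2 * r by rewrite ger0_norm// ltW.
  have := cauchy_square s0 gc gd'; rewrite g0 => csq.
  have sqc := square_sum_continuous s0 gd'.
  have csq' : 4 * r * cnorm (f w) <= itv_int (- s) s (square_sum g s).
    rewrite ler_pdivlMl// in csq; apply: le_trans csq.
    by rewrite mulrA ler_wpM2r ?cnorm_ge0//; lra.
  apply: (@le_trans _ _ (itv_int (- s) s (square_sum g s))%:E); first by rewrite lee_fin.
  rewrite /itv_int /Rintegral fineK; last exact: integrable_fin_num (integrable_itv sqc).
  set S := (X in (_ <= \int[_]_x X x)%E).
  have mS : measurable_fun setT S.
    have mGp (p q : MR -> MR) : measurable_fun setT p -> measurable_fun setT q ->
      measurable_fun setT (fun t => G (p t, q t)).
      by move=> mp mq; apply: (measurableT_comp mG); exact: measurable_fun_pair.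
    have mT (c : R) : measurable_fun setT (fun t : MR => c + t : MR) by exact: measurable_funD.
    by apply: emeasurable_funD; apply: emeasurable_funD; apply: mGp; (exact: mT || exact: measurable_cst).
  have S0 x : (0 <= S x)%E by rewrite /S !adde_ge0// h0.
  apply: (@le_trans _ _ (\int[leb]_(x in `[(- s)%R, s]) S x)%E); last first.
    by apply: ge0_subset_integral; [exact: measurable_itv|exact: measurableT|exact: mS|by []|exact: subsetT].
  rewrite le_eqVlt; apply/orP; left; apply/eqP; apply: eq_integral => t; rewrite inE/= in_itv/= => tI.
  have ts : `|t| <= 2 * r by apply: le_trans s2; rewrite ler_norml.
  by rewrite /S !GE ?normrN// -!EFinD.
have := @area_mean R G (tnth X j) (tnth Y j) r (4 * r * cnorm (f w)) mG (fun _ => h0 _) r0 main.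
set I := (\int[leb]_x _)%E => H.
(* [area_mean] gives [4 * r * |f w| * r <= 4 * I], hence the factor [r ^- 2]. *)
have -> : cnorm (f w) = r ^- 2 * (4^-1 * (4 * r * cnorm (f w) * r)) by field; rewrite gt_eqF.
rewrite EFinM lee_wpmul2l ?lee_fin// EFinM.
apply: (@le_trans _ _ ((4^-1)%:E * (4%:E * I))%E).
  by rewrite lee_wpmul2l// lee_fin invr_ge0.
by rewrite muleA -EFinM mulVf// mul1e.
Qed.
End local_mean.

(** * Limits along an ultrafilter *)

Section ultralimit.
Context {R : realType} (G : set_system nat) {GU : UltraFilter G}.

(** The limit is the supremum of the [t] with [t <= u k] for almost all [k] in the sense of [G].
    Above it the ultrafilter, which decides every set, contains the complementary sets. *)
Lemma real_ultralimit (u : nat -> R) (M : R) : (forall k, `|u k| <= M) ->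
  exists l, forall e, 0 < e -> G [set k | `|u k - l| <= e].
Proof.
move=> uM; pose S := [set t : R | G [set k | t <= u k]].
have GT : G setT by exact: filterT.
have S0 : S (- M) by apply: filterS GT => k _ /=; have := uM k; rewrite ler_norml => /andP[].
have SM t : S t -> t <= M.
  by move=> /filter_ex[k /= /le_trans]; apply; have := uM k; rewrite ler_norml => /andP[].
have supS : has_sup S by split; [exists (- M)|exists M => t; exact: SM].
exists (sup S) => e e0.
have [t St lt] := sup_adherent e0 supS.
have nS : G (~` [set k | sup S + e <= u k]).
  have [H|//] := in_ultra_setVsetC [set k | sup S + e <= u k] GU.
  have /(ub_le_sup (proj2 supS)) : S (sup S + e) by exact: H.
  by rewrite gerDl leNgt e0.
apply: filterS (filterI St nS) => k /= [h1 /negP]; rewrite -ltNge => h2.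
by rewrite ler_distl; lra.
Qed.

Lemma complex_ultralimit (u : nat -> R[i]) (M : R) : (forall k, cnorm (u k) <= M) ->
  exists l, forall e, 0 < e -> G [set k | cnorm (u k - l) <= e].
Proof.
move=> uM.
have [x xP] := @real_ultralimit (fun k => complex.Re (u k)) M (fun k => le_trans (normRe _) (uM k)).
have [y yP] := @real_ultralimit (fun k => complex.Im (u k)) M (fun k => le_trans (normIm _) (uM k)).
exists (x +i* y) => e e0; have e2 : 0 < e / 2 by rewrite divr_gt0.
apply: filterS (filterI (xP _ e2) (yP _ e2)) => k /= [].
case: (u k) => a b /= h1 h2; apply: le_trans (cnorm_le _ _) _; lra.
Qed.

End ultralimit.

(** * Local bounds by the energy *)

Section energy.
Context {R : realType} {n : nat}.
Local Notation C := R[i].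
Local Notation Cn := 'rV[R[i]]_n.
Local Notation cp := (@cpoint R n).
Local Notation mu := (lebesgue_tuple R n \x lebesgue_tuple R n)%E.
Variables (p : R) (U : set Cn).
Hypotheses (p1 : 1 <= p) (oU : open U).
Implicit Types (f : Cn -> C) (w z : Cn).

Definition energy f : \bar R := (\int[mu]_(x in cp @^-1` U) ((cnorm (f (cp x))) `^ p)%:E)%E.

Let mU : measurable (cp @^-1` U). Proof. exact: measurable_open_preimage. Qed.

Lemma energy_ge0 f : (0 <= energy f)%E.
Proof. by apply: integral_ge0 => x _; rewrite lee_fin powR_ge0. Qed.

Lemma measurable_cnorm f : holo U f -> measurable_fun (cp @^-1` U) (fun x => cnorm (f (cp x))).
Proof.
move=> fU; apply: (measurable_continuous (F := fun w => cnorm (f w))) => // w /fU[a fa].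
exact: cgrad_continuous_cnorm fa.
Qed.

Lemma measurable_energy f : holo U f -> measurable_fun (cp @^-1` U) (fun x => ((cnorm (f (cp x))) `^ p)%:E).
Proof.
move=> fU; apply/measurable_EFinP.
exact: (measurableT_comp (measurable_powR p) (measurable_cnorm fU)).
Qed.

Lemma energy_scale k f : holo U f -> energy (fun w => k * f w) = ((cnorm k `^ p)%:E * energy f)%E.
Proof.
move=> fU; rewrite /energy -ge0_integralZl_EFin//; last 3 first.
- by move=> x _; rewrite lee_fin powR_ge0.
- exact: measurable_energy.
- exact: powR_ge0.
by apply: eq_integral => x _; rewrite cnormM powRM ?cnorm_ge0// EFinM.
Qed.

(** Takes the place of Hölder's inequality in passing from the mean of [|f|] over a box of finite
    measure to that of [|f| ^ p]. *)
Lemma le1_powR (t : R) : 0 <= t -> t <= 1 + t `^ p.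
Proof.
move=> t0; have [t1|/ltW t1] := leP t 1; first by rewrite (le_trans t1)// lerDl powR_ge0.
by apply: (le_trans (le1r_powR t1 p1)); rewrite lerDr.
Qed.

Lemma open_ball z : U z -> exists2 d : R, 0 < d & forall w, vnorm (w - z) < d -> U w.
Proof.
move=> Uz; have /nbhs_vnorm[d d0 hd] : \forall w \near z, U w by exact: open_nbhs_nbhs.
by exists d => // w /hd; rewrite addrC subrK.
Qed.

Lemma coord_box_shift z w (d e : R) : vnorm (w - z) <= d -> coord_box w e `<=` coord_box z (e + d).
Proof.
move=> wz x [/= h1 h2].
have Hj j : cnorm (w 0 j - z 0 j) <= d.
  by apply: le_trans wz; apply: le_trans (cnorm_coord _ j); rewrite !mxE.
split => j /=.
  rewrite -(subrK (complex.Re (w 0 j)) (tnth x.1 j)) -addrA; apply: le_trans (ler_normD _ _) _.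
  apply: lerD (h1 j) _; apply: le_trans (Hj j); case: (w 0 j) => ? ?; case: (z 0 j) => ? ?; exact: (normRe ((_ +i* _) - (_ +i* _))).
rewrite -(subrK (complex.Im (w 0 j)) (tnth x.2 j)) -addrA; apply: le_trans (ler_normD _ _) _.
apply: lerD (h2 j) _; apply: le_trans (Hj j); case: (w 0 j) => ? ?; case: (z 0 j) => ? ?; exact: (normIm ((_ +i* _) - (_ +i* _))).
Qed.

Lemma local_bound z : U z -> exists d A : R, [/\ 0 < d, 0 <= A,
  forall w, vnorm (w - z) <= d -> U w &
  forall f (e : R), holo U f -> (energy f <= e%:E)%E -> forall w, vnorm (w - z) <= d -> cnorm (f w) <= A * (1 + e)].
Proof.
move=> /open_ball[d d0 hd]; pose r := d / 16.
have r0 : 0 < r by rewrite divr_gt0.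
(* This box contains the boxes around all the [w] considered, so a single constant serves them all;
   [r = d / 16] keeps the balls of radius [4 * r] around those [w] inside [U]. *)
pose m := mu (coord_box z (2 * r + d / 2)).
have m_lty : (m < +oo)%E by exact: coord_box_lty.
have m_ge0 : (0 <= m)%E by exact: measure_ge0.
have mE : (fine m)%:E = m by rewrite fineK// ge0_fin_numE.
have m0 : 0 <= fine m by rewrite fine_ge0.
have K0 : 0 <= (r ^- 2) ^+ n by rewrite exprn_ge0// invr_ge0 sqr_ge0.
exists (d / 2), ((r ^- 2) ^+ n * (1 + fine m)); split; first by rewrite divr_gt0.
- by rewrite mulr_ge0// addr_ge0.
- by move=> w wz; apply: hd; lra.
move=> f e fU fe w wz.
have wU v : vnorm (v - w) <= 4 * r -> U v.
  move=> vw; apply: hd; rewrite -(subrK w v) -addrA; apply: le_lt_trans (vnormD _ _) _.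
  by rewrite /r in vw; lra.
have := local_mean oU fU r0 wU; set B := coord_box w (2 * r) => H.
have mB : measurable B by exact: measurable_coord_box.
have BU : B `<=` cp @^-1` U.
  move=> x Bx; apply: wU; have r20 : 0 <= 2 * r by lra.
  by have := coord_box_vnorm r20 Bx; lra.
rewrite -lee_fin; apply: le_trans H _; rewrite -mulrA EFinM lee_wpmul2l ?lee_fin//.
have e0 : 0 <= e by rewrite -lee_fin (le_trans _ fe)// energy_ge0.
apply: (@le_trans _ _ (\int[mu]_(x in B) (1 + ((cnorm (f (cp x))) `^ p)%:E))%E).
  apply: ge0_le_integral => //.
  - by move=> x _; rewrite lee_fin cnorm_ge0.
  - by apply/measurable_EFinP; exact: (measurable_funS mU BU (measurable_cnorm fU)).
  - apply: emeasurable_funD; first exact: measurable_cst.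
    exact: (measurable_funS mU BU (measurable_energy fU)).
  - by move=> x _; rewrite -EFinD lee_fin le1_powR// cnorm_ge0.
rewrite ge0_integralD//; last 2 first.
- by move=> x _; rewrite lee_fin powR_ge0.
- exact: (measurable_funS mU BU (measurable_energy fU)).
rewrite integral_cst// mul1e.
have h1 : (mu B <= m)%E.
  by apply: le_measure; rewrite ?inE//; [exact: measurable_coord_box|exact: coord_box_shift].
have h2 : (\int[mu]_(x in B) ((cnorm (f (cp x))) `^ p)%:E <= e%:E)%E.
  apply: le_trans fe; apply: ge0_subset_integral => //; first exact: measurable_energy.
  by move=> x _; rewrite lee_fin powR_ge0.
apply: le_trans (leeD h1 h2) _; rewrite -mE -EFinD lee_fin; nra.
Qed.

End energy.

(** The case [l = 0] is separate because the power need not be differentiable there. *)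
Lemma cvg_powR (R : realType) (T : Type) (F : set_system T) {FF : Filter F} (u : T -> R) (l p : R) :
  0 < p -> (forall j, 0 <= u j) -> 0 <= l -> u j @[j --> F] --> l -> u j `^ p @[j --> F] --> l `^ p.
Proof.
move=> p0 u0; rewrite le_eqVlt => /predU1P[<-|l0] ul.
  rewrite powR0 ?gt_eqF//; apply/cvgrPdist_le => e e0.
  have d0 : 0 < e `^ p^-1 by rewrite powR_gt0.
  have /cvgrPdist_le/(_ _ d0) := ul; apply: filterS => j.
  rewrite !sub0r !normrN !ger0_norm ?powR_ge0// => ue.
  rewrite -[leRHS]powRr1 ?(ltW e0)// -(mulVf (lt0r_neq0 p0)) powRrM.
  by rewrite ge0_ler_powR ?nnegrE ?powR_ge0// ltW.
have cp : {for l, continuous (fun t : R => t `^ p)}.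
  by apply: differentiable_continuous; apply/derivable1_diffP; apply: derivable_powR; rewrite in_itv/= andbT.
exact: (cvg_comp _ _ ul cp).
Qed.

(** * Normal families of bounded energy *)

Section montel.
Context {R : realType} {n : nat}.
Local Notation C := R[i].
Local Notation Cn := 'rV[R[i]]_n.
Local Notation cp := (@cpoint R n).
Local Notation mu := (lebesgue_tuple R n \x lebesgue_tuple R n)%E.
Variables (p : R) (U : set Cn).
Hypotheses (p1 : 1 <= p) (oU : open U).
Variables (G : set_system nat) (GU : UltraFilter G).
Variables (F : nat -> Cn -> C) (B : R).
Hypotheses (FU : forall k, holo U (F k)) (FB : forall k, (energy p U (F k) <= B%:E)%E).

Let bnd z : U z -> exists d M : R, [/\ 0 < d, 0 <= M,
  forall w, vnorm (w - z) <= d -> U w & forall k w, vnorm (w - z) <= d -> cnorm (F k w) <= M].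
Proof.
move=> Uz; have [d [A [d0 A0 dU H]]] := local_bound p1 oU Uz.
have B0 : 0 <= B by rewrite -lee_fin (le_trans _ (FB 0%N))// energy_ge0.
exists d, (A * (1 + B)); split => //; first by rewrite mulr_ge0// addr_ge0.
by move=> k w wz; apply: H.
Qed.

Section limit.
Variable h : Cn -> C.
Hypothesis Fh : forall w, U w -> forall e : R, 0 < e -> G [set k | cnorm (F k w - h w) <= e].

(** By Cauchy's estimate the gradients at [z] are bounded, so they have a limit [b] coordinate by
    coordinate. Taylor's estimate, with one constant [K] for all [k], passes to the limit and
    identifies [b] as the gradient of [h]. *)
Lemma limit_gradient z (a : nat -> Cn) : U z -> (forall k, cgrad (F k) z (a k)) ->
  exists2 b, cgrad h z b & forall e : R, 0 < e -> G [set k | forall v, cnorm (cdot (a k) v - cdot b v) <= e * vnorm v].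
Proof.
move=> Uz Fa; have [d [M [d0 M0 dU FM]]] := bnd Uz.
have Fd k w : vnorm (w - z) <= d -> exists a, cgrad (F k) w a by move=> /dU; exact: FU.
have aB k j : cnorm (a k 0 j) <= 8 * M / d.
  have := cgrad_bound d0 (Fd k) (FM k) (delta_mx 0 j) (Fa k).
  rewrite (_ : cdot _ _ = a k 0 j).
    move=> /le_trans; apply; rewrite ler_piMr ?divr_ge0 ?(ltW d0)//; first by rewrite mulr_ge0// ler0n.
    apply: vnorm_le => // i; rewrite mxE eqxx/=; case: (i == j); first by rewrite cnorm1.
    by rewrite cnorm0.
  rewrite /cdot (bigD1 j)//= big1 ?addr0 => [|i /negbTE ij]; first by rewrite mxE !eqxx mulr1.
  by rewrite mxE eqxx ij mulr0.
have [b bP] := choice (fun j => complex_ultralimit (u := fun k => a k 0 j) (aB ^~ j)).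
have ab e : 0 < e -> G [set k | forall v, cnorm (cdot (a k) v - cdot (\row_j b j) v) <= e * vnorm v].
  move=> e0; have e1 : 0 < e / n.+1%:R by rewrite divr_gt0.
  have : G [set k | forall j, cnorm (a k 0 j - b j) <= e / n.+1%:R].
    by apply: filter_forall => j; exact: bP.
  apply: filterS => k /= H v; rewrite -cdotBl; apply: le_trans (cdot_le _ _) _.
  rewrite ler_wpM2r ?vnorm_ge0//; apply: (@le_trans _ _ (\sum_(j < n) e / n.+1%:R)).
    by apply: ler_sum => j _; rewrite !mxE; exact: H.
  rewrite sumr_const card_ord -[leLHS]mulr_natr mulrAC ler_pdivrMr// ler_wpM2l ?(ltW e0)//.
  by rewrite ler_nat.
exists (\row_j b j) => // e e0.
pose K := 512 * M / d ^+ 2.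
have K0 : 0 <= K by apply: divr_ge0; [apply: mulr_ge0 M0; exact: ler0n|exact/exprn_ge0/ltW].
exists (Num.min (d / 4) (e / (1 + K))).
  by rewrite lt_min !divr_gt0// ltr_pwDl.
move=> v; rewrite lt_min => /andP[v1]; rewrite ltr_pdivlMr ?ltr_pwDl// => v2.
have tay k : cnorm (F k (z + v) - F k z - cdot (a k) v) <= K * vnorm v ^+ 2.
  exact: (taylor d0 (Fd k) (FM k) (ltW v1) (Fa k)).
apply: (@le_trans _ _ (K * vnorm v ^+ 2)).
  (* The slack [c] permits choosing [k] after [v]: pointwise convergence at [z] and [z + v]
     suffices. *)
  apply/ler_addgt0Pr => c c0; have c3 : 0 < c / 3 by rewrite divr_gt0.
  have Uzv : U (z + v) by apply: dU; rewrite addrC addKr; lra.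
  have V0 := vnorm_ge0 v.
  have c3' : 0 < c / 3 / (1 + vnorm v) by rewrite divr_gt0// ltr_pwDl.
  have [k /= [[k1 k2] /(_ v) k3]] := filter_ex (filterI (filterI (Fh Uzv c3) (Fh Uz c3)) (ab _ c3')).
  rewrite (_ : h (z + v) - h z - cdot _ v = (F k (z + v) - F k z - cdot (a k) v) -
    ((F k (z + v) - h (z + v)) - (F k z - h z) - (cdot (a k) v - cdot (\row_j b j) v))); last by ring.
  apply: le_trans (cnormB _ _) _; apply: lerD (tay k) _.
  apply: le_trans (cnormB _ _) _; have := cnormB (F k (z + v) - h (z + v)) (F k z - h z).
  have : c / 3 / (1 + vnorm v) * vnorm v <= c / 3.
    by rewrite mulrAC ler_pdivrMr ?ltr_pwDl//; nra.
  lra.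
rewrite expr2 mulrA ler_wpM2r ?vnorm_ge0//.
by have := vnorm_ge0 v; nra.
Qed.

Lemma limit_holo : holo U h.
Proof.
move=> z Uz; have [a aP] := choice (fun k => FU k Uz).
by have [b hb _] := limit_gradient Uz aP; exists b.
Qed.

(* Fatou needs a sequence converging pointwise: it is extracted from the ultrafilter
   by controlling the values at finitely many rational points at each step, the
   common Lipschitz bounds extending the convergence to all of [U]. *)
Lemma limit_energy (B' : R) : (forall e : R, 0 < e -> G [set k | (energy p U (F k) <= (B' + e)%:E)%E]) ->
  (energy p U h <= B'%:E)%E.
Proof.
move=> HB.
(* Enumerates the rational points; codes that decode to nothing give 0, and [q i] is used only when
   it lies in [U]. *)
pose q i : Cn := if unpickle i is Some t then rat_point t else 0.
have qd w (e : R) : 0 < e -> exists i, vnorm (q i - w) < e.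
  by move=> /(rat_point_dense w)[t tw]; exists (pickle t); rewrite /q pickleK.
have i0 j : 0 < j.+1%:R^-1 :> R by rewrite invr_gt0.
have kex j : exists k, (energy p U (F k) <= (B' + j.+1%:R^-1)%:E)%E /\
    forall i, (i <= j)%N -> U (q i) -> cnorm (F k (q i) - h (q i)) <= j.+1%:R^-1.
  have : G [set k | forall i : 'I_j.+1, U (q i) -> cnorm (F k (q i) - h (q i)) <= j.+1%:R^-1].
    apply: filter_forall => i; have [Uq|nUq] := pselect (U (q i)); first by apply: filterS (Fh Uq (i0 j)).
    by apply: filterS filterT => ? _ /nUq.
  move=> /(filterI (HB _ (i0 j)))/filter_ex[k [k1 k2]]; exists k; split => // i; rewrite -ltnS => ij.
  exact: (k2 (Ordinal ij)).
have [k kP] := choice kex.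
have small (c : R) : 0 < c -> \forall j \near \oo, j.+1%:R^-1 <= c.
  move=> c0; exists (Num.Def.archi_bound c^-1) => // j /= cj.
  rewrite -[leRHS]invrK lef_pV2 ?posrE ?invr_gt0//.
  apply: (@le_trans _ _ (Num.Def.archi_bound c^-1)%:R); last by rewrite ler_nat ltnW.
  by apply/ltW/archi_boundP; rewrite invr_ge0 ltW.
have cv w : U w -> forall e : R, 0 < e -> \forall j \near \oo, cnorm (F (k j) w - h w) <= e.
  move=> Uw e e0; have [d [M [d0 M0 dU FM]]] := bnd Uw.
  have e3 : 0 < e / 3 by rewrite divr_gt0.
  have [a ha] := limit_holo Uw.
  have [d1 d10 hd1] : exists2 d1 : R, 0 < d1 & forall v, vnorm v < d1 -> `|cnorm (h (w + v) - h w)| <= e / 3.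
    have [d1 d10 hd] := ha 1 ltr01; have K0 : 0 < 1 + cdot_norm a by rewrite ltr_pwDl// cdot_norm_ge0.
    exists (Num.min d1 (e / 3 / (1 + cdot_norm a))); first by rewrite lt_min d10 divr_gt0.
    move=> v; rewrite lt_min ltr_pdivlMr// => /andP[/hd h1 h2].
    rewrite ger0_norm ?cnorm_ge0// -(subrK (cdot a v) (h _ - _)); apply: le_trans (cnormD _ _) _.
    by have := cdot_le a v; lra.
  pose L := 16 * M / d.
  have L0 : 0 <= L by rewrite divr_ge0 ?(ltW d0)// mulr_ge0// ler0n.
  pose d2 := Num.min d1 (Num.min (d / 2) (e / 3 / (1 + L))).
  have d20 : 0 < d2 by rewrite !lt_min d10 !divr_gt0// ltr_pwDl.
  have [i iw] := qd w d2 d20.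
  move: iw; rewrite !lt_min => /and3P[i1 i2]; rewrite ltr_pdivlMr ?ltr_pwDl// => i3.
  have qE : q i = w + (q i - w) by rewrite addrC subrK.
  have V0 := vnorm_ge0 (q i - w).
  have Uq : U (q i) by apply: dU; lra.
  near=> j.
  have c1 : cnorm (F (k j) (q i) - h (q i)) <= e / 3.
    apply: (@le_trans _ _ j.+1%:R^-1); last by near: j; exact: small.
    by apply: (proj2 (kP j)) => //; near: j; exists i.
  have c2 : cnorm (F (k j) (q i) - F (k j) w) <= e / 3.
    rewrite qE; have Fd w' : vnorm (w' - w) <= d -> exists a, cgrad (F (k j)) w' a by move=> /dU; exact: FU.
    apply: le_trans (lipschitz_half d0 Fd (FM (k j)) _ _) _.
    - by rewrite subrr vnorm0 divr_ge0// ltW.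
    - by rewrite -qE ltW.
    - by rewrite -/L; nra.
  have c3 : cnorm (h (q i) - h w) <= e / 3.
    by rewrite qE; apply: le_trans (ler_norm _) (hd1 _ i1).
  rewrite (_ : _ - _ = (F (k j) (q i) - h (q i)) - (F (k j) (q i) - F (k j) w) + (h (q i) - h w)); last by ring.
  apply: le_trans (cnormD _ _) _; have := cnormB (F (k j) (q i) - h (q i)) (F (k j) (q i) - F (k j) w); lra.
have mU : measurable (cp @^-1` U) by exact: measurable_open_preimage.
have cvp x : U (cp x) -> ((cnorm (F (k j) (cp x))) `^ p)%:E @[j --> \oo] --> ((cnorm (h (cp x))) `^ p)%:E.
  move=> Ux; apply: cvg_EFin; first by near=> j.
  have cc : cnorm (F (k j) (cp x)) @[j --> \oo] --> cnorm (h (cp x)).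
    apply/cvgrPdist_le => e /(cv _ Ux); apply: filterS => j.
    by rewrite distrC; apply: le_trans; exact: cnorm_dist.
  by apply: cvg_powR cc; rewrite ?cnorm_ge0 ?(lt_le_trans ltr01 p1)// => j; exact: cnorm_ge0.
have := @fatou _ _ R mu (cp @^-1` U) mU (fun j x => ((cnorm (F (k j) (cp x))) `^ p)%:E).
move=> /(_ _ _)/le_trans H.
rewrite /energy.
rewrite (_ : integral _ _ _ = \int[mu]_(x in cp @^-1` U) limn_einf (fun j => ((cnorm (F (k j) (cp x))) `^ p)%:E))%E; last first.
  by apply: eq_integral => x; rewrite inE => /cvp/cvg_limn_einf_sup[-> _].
apply: H; first by move=> j; exact: measurable_energy.
  by move=> j x _; rewrite lee_fin powR_ge0.
rewrite limn_einf_lim; apply: lime_le; first exact: is_cvg_einfs.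
(* Each tail infimum is bounded by the energy of an arbitrarily late term, which is at most
   [B' + e]. *)
near=> m; apply/lee_addgt0Pr => e e0.
near \oo => j.
apply: (@le_trans _ _ (energy p U (F (k j)))).
  by apply: ereal_inf_lbound; exists j => //=; near: j; exists m.
apply: le_trans (proj1 (kP j)) _; rewrite -EFinD lee_fin lerD2l.
by near: j; exact: small.
Unshelve. all: by end_near. Qed.
End limit.
End montel.

(** * Minimizers *)

Section minimizer.
Context {R : realType} {n : nat}.
Local Notation C := R[i].
Local Notation Cn := 'rV[R[i]]_n.
Local Notation cp := (@cpoint R n).
Variables (p : R) (U : set Cn).
Hypotheses (p1 : 1 <= p) (oU : open U) (bU : bounded_set U).
Implicit Types (f g : Cn -> C) (w z : Cn) (e : R).

Let p0 : 0 < p. Proof. exact: lt_le_trans ltr01 p1. Qed.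
Let mU : measurable (cp @^-1` U). Proof. exact: measurable_open_preimage. Qed.

Lemma holo_scale k f : holo U f -> holo U (fun w => k * f w).
Proof.
move=> fU w /fU[a fa]; exists (k *: a) => e e0.
have K0 : 0 < 1 + cnorm k by rewrite ltr_pwDl// cnorm_ge0.
have [d d0 hd] := fa _ (divr_gt0 e0 K0); exists d => // v /hd H.
have -> : cdot (k *: a) v = k * cdot a v.
  by rewrite /cdot mulr_sumr; apply: eq_bigr => j _; rewrite mxE mulrA.
rewrite -!mulrBr cnormM; apply: le_trans (ler_wpM2l (cnorm_ge0 k) H) _.
rewrite mulrA ler_wpM2r ?vnorm_ge0// mulrA ler_pdivrMr//.
by have := cnorm_ge0 k; nra.
Qed.

Lemma holo_cst k : holo U (fun=> k).
Proof.
move=> w _; exists 0 => e e0; exists 1 => // v _.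
have -> : cdot 0 v = 0 by rewrite /cdot big1// => j _; rewrite mxE mul0r.
by rewrite subrr subr0 cnorm0 mulr_ge0 ?vnorm_ge0// ltW.
Qed.

(** Boundedness of [U] makes the constant 1 a competitor of finite energy, so the infimum is
    finite. *)
Lemma energy1_lty : (energy p U (fun=> 1%R) < +oo)%E.
Proof.
have [M UM] : exists M : R, forall w, U w -> vnorm w <= M.
  have [M [Mr HM]] := bU; exists (complex.Re (M + 1)) => w Uw.
  have : `|w| <= M + 1 by apply: HM => //; rewrite ltrDl.
  by rewrite vnormE -lecR RRe_real// realD// real1.
apply: le_lt_trans (coord_box_lty (0 : Cn) M).
rewrite /energy; under eq_integral do rewrite cnorm1 powR1.
rewrite integral_cst// mul1e; apply: le_measure; rewrite ?inE//; first exact: measurable_coord_box.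
by move=> x /= /UM xM; apply: vnorm_coord_box; rewrite subr0.
Qed.

(** [e] is the p-th power of m_p(z). Competitors range over all holomorphic functions normalized at
    [z], those of infinite energy satisfying the bound trivially. *)
Definition is_min z f e := [/\ holo U f, f z = 1, energy p U f = e%:E, 0 < e &
  forall g, holo U g -> g z = 1 -> (e%:E <= energy p U g)%E].

(** Direct method: a minimizing sequence is locally bounded, its ultrafilter limit is holomorphic
    with value 1 at [z], and Fatou's lemma bounds its energy. *)
Lemma exists_min z : U z -> exists f e, is_min z f e.
Proof.
move=> Uz; pose S := [set t : R | exists f, [/\ holo U f, f z = 1 & (energy p U f <= t%:E)%E]].
have fine1 : (fine (energy p U (fun=> 1)))%:E = energy p U (fun=> 1).
  by rewrite fineK// ge0_fin_numE ?energy_ge0// energy1_lty.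
have Sge t : S t -> 0 <= t.
  by move=> [f [_ _]]; rewrite -lee_fin; apply: le_trans; exact: energy_ge0.
have infS : has_inf S.
  split; last by exists 0 => t; exact: Sge.
  exists (fine (energy p U (fun=> 1))), (fun=> 1).
  by split => //; [exact: holo_cst|rewrite fine1].
have [G [GU Goo]] := ultraFilterLemma (eventually_filter).
have kex (k : nat) : exists f, [/\ holo U f, f z = 1 & (energy p U f <= (inf S + k.+1%:R^-1)%:E)%E].
  have k0 : 0 < k.+1%:R^-1 :> R by rewrite invr_gt0.
  have [t [f [f1 f2 f3]] tk] := inf_adherent k0 infS.
  by exists f; split => //; rewrite (le_trans f3)// lee_fin ltW.
have [F FP] := choice kex.
have FU k : holo U (F k) by have [] := FP k.
have FB k : (energy p U (F k) <= (inf S + 1)%:E)%E.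
  have [_ _ H] := FP k; apply: le_trans H _; rewrite lee_fin lerD2l invf_le1//.
  by rewrite ler1n.
have hex w : exists l, U w -> forall e, 0 < e -> G [set k | cnorm (F k w - l) <= e].
  have [Uw|] := pselect (U w); last by exists 0.
  have [d [A [d0 A0 dU H]]] := local_bound p1 oU Uw.
  have [|l lP] := @complex_ultralimit _ G GU (fun k => F k w) (A * (1 + (inf S + 1))).
    by move=> k; apply: H; rewrite ?subrr ?vnorm0// ltW.
  by exists l.
have [h hP] := choice hex.
have hU : holo U h by exact: (limit_holo p1 oU GU FU FB hP).
have h1 : h z = 1.
  apply/eqP; rewrite eq_sym -subr_eq0 -cnorm_eq0 eq_le cnorm_ge0 andbT.
  apply/ler_addgt0Pr => e e0; rewrite add0r.
  by have [k /=] := filter_ex (hP z Uz e e0); have [_ -> _] := FP k.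
have he : (energy p U h <= (inf S)%:E)%E.
  apply: (limit_energy p1 oU GU FU FB hP) => e e0.
  apply: Goo; exists (Num.Def.archi_bound e^-1) => // k /= ke.
  have [_ _ H] := FP k; apply: le_trans H _; rewrite lee_fin lerD2l.
  rewrite -[leRHS]invrK lef_pV2 ?posrE ?invr_gt0//.
  apply: (@le_trans _ _ (Num.Def.archi_bound e^-1)%:R); last by rewrite ler_nat ltnW.
  by apply/ltW/archi_boundP; rewrite invr_ge0 ltW.
have lb g : holo U g -> g z = 1 -> ((inf S)%:E <= energy p U g)%E.
  move=> gU g1; have [glty|] := ltP (energy p U g) +oo%E; last by rewrite leye_eq => /eqP ->; rewrite leey.
  have gE : (fine (energy p U g))%:E = energy p U g by rewrite fineK// ge0_fin_numE ?energy_ge0.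
  by rewrite -gE lee_fin; apply: ge_inf; [exists 0 => t; exact: Sge|exists g; rewrite gE].
have hE : energy p U h = (inf S)%:E by apply/le_anti; rewrite he lb.
exists h, (inf S); split => //.
rewrite lt_neqAle eq_sym Sge ?andbT; last by exists h.
(* If the minimum were 0, the multiple [(A + 1) * h] would also have energy 0, and the local bound
   at [z] would read [A + 1 <= A]. *)
apply/eqP => S0.
have [d [A [d0 A0 dU H]]] := local_bound p1 oU Uz.
have := H (fun w => (A + 1)%:C * h w) 0 (holo_scale _ hU).
rewrite energy_scale// hE S0 mule0 => /(_ _ z); rewrite subrr vnorm0 h1 mulr1 addr0 mulr1 cnorm_real.
move=> /(_ (lexx _) (ltW d0)); rewrite ger0_norm ?addr_ge0//; lra.
Qed.

Lemma is_min_unique z f e f' e' : is_min z f e -> is_min z f' e' -> e = e'.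
Proof.
move=> [f1 f2 f3 f4 f5] [g1 g2 g3 g4 g5]; apply/le_anti; rewrite -!lee_fin.
by rewrite -{1}g3 -{2}f3 f5// g5.
Qed.

Lemma pnormE f : pnorm p U f = (energy p U f `^ p^-1)%E.
Proof. by []. Qed.

Lemma energyE f : energy p U f = (pnorm p U f `^ p)%E.
Proof. by rewrite pnormE -poweRrM mulVf ?gt_eqF// poweRe1// energy_ge0. Qed.

Lemma bergman_spaceP f : bergman_space p U f <-> holo U f /\ (energy p U f < +oo)%E.
Proof.
split=> [[f1 f2]|[f1 f2]]; split.
- by move=> w /f1/cgradP.
- by rewrite energyE poweR_lty.
- by move=> w /f1 H; apply/cgradP.
- by rewrite pnormE poweR_lty.
Qed.

(** [exists_min] supplies the witness that gives the choice in [bergman_minimizer] its meaning; the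
    increasing map [t ^ (1 / p)] turns least energy into least norm. *)
Lemma minimizer_is_min z : U z -> exists e, is_min z (bergman_minimizer p U z) e.
Proof.
move=> Uz; have [f [e [f1 f2 f3 f4 f5]]] := exists_min Uz.
have minE : pnorm p U f = bergman_min p U z.
  apply/le_anti/andP; split.
    apply: le_ereal_inf_tmp => _ [g [/bergman_spaceP[gU _] g1] <-].
    rewrite !pnormE; apply: gt0_ler_poweR; rewrite ?in_itv/= ?energy_ge0 ?leey ?invr_ge0 ?(ltW p0)//.
    by rewrite f3 f5.
  apply: ereal_inf_lbound; exists f => //; split => //.
  by apply/bergman_spaceP; rewrite f3 ltry.
have : [/\ bergman_space p U (bergman_minimizer p U z), bergman_minimizer p U z z = 1
             & pnorm p U (bergman_minimizer p U z) = bergman_min p U z].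
  apply: (@getPex _ [set f | [/\ bergman_space p U f, f z = 1 & pnorm p U f = bergman_min p U z]]).
  by exists f; split => //; apply/bergman_spaceP; rewrite f3 ltry.
move=> [/bergman_spaceP[g1 g2] g3 g4]; exists e; split => //.
by rewrite energyE g4 -minE -energyE.
Qed.

(** A function [g] of norm 1 with [g z != 0] yields the competitor [g / g z], whence the upper
    bound; the multiple of [f] by [e ^ (- 1 / p)] has norm 1 and attains it. *)
Lemma kernelE z f e : is_min z f e -> bergman_kernel p U z = e^-1.
Proof.
move=> [f1 f2 f3 f4 f5]; rewrite /bergman_kernel.
set S := [set _ | _ in _].
have Sub t : S t -> t <= e^-1.
  move=> [g [/bergman_spaceP[gU _] gp] <-]; rewrite -/(cnorm (g z)).
  have ge1 : energy p U g = 1%E by rewrite energyE gp poweR1r.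
  have [->|gz] := eqVneq (g z) 0; first by rewrite cnorm0 powR0 ?gt_eqF// invr_ge0 ltW.
  have := f5 (fun w => (g z)^-1 * g w) (holo_scale _ gU).
  rewrite mulVf// energy_scale// ge1 mule1 lee_fin => /(_ erefl) H.
  have N0 : 0 < cnorm (g z) `^ p by rewrite powR_gt0// cnorm_gt0.
  have E : cnorm (g z)^-1 `^ p * cnorm (g z) `^ p = 1.
    by rewrite -powRM ?cnorm_ge0// -cnormM mulVf// cnorm1 powR1.
  by rewrite -[leRHS]mul1r ler_pdivlMr// -E mulrC ler_wpM2r// ltW.
have e0 : 0 < e^-1 by rewrite invr_gt0.
have Se : S e^-1.
  pose k := e^-1 `^ p^-1.
  have kp : k `^ p = e^-1 by rewrite /k -powRrM mulVf ?gt_eqF// powRr1// ltW.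
  have k0 : 0 <= k by exact: powR_ge0.
  have kE : energy p U (fun w => k%:C * f w) = 1%E.
    by rewrite energy_scale// f3 cnorm_real ger0_norm// kp -EFinM mulVf// gt_eqF.
  exists (fun w => k%:C * f w); last by rewrite f2 mulr1 -/(cnorm _) cnorm_real ger0_norm.
  split; last by rewrite pnormE kE poweR1r.
  by apply/bergman_spaceP; split; [exact: holo_scale|rewrite kE ltry].
apply/le_anti/andP; split; first by apply: ge_sup => //; exists e^-1.
by apply: ub_le_sup => //; exists e^-1.
Qed.

End minimizer.

(** * All minimizers at a point have the same gradient *)

Section minimizer_gradient.
Context {R : realType} {n : nat}.
Local Notation C := R[i].
Local Notation Cn := 'rV[R[i]]_n.
Local Notation cp := (@cpoint R n).
Local Notation mu := (lebesgue_tuple R n \x lebesgue_tuple R n)%E.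
Variables (p : R) (U : set Cn).
Hypotheses (p1 : 1 <= p) (oU : open U).
Implicit Types (f g : Cn -> C) (w z : Cn) (e : R).

Let p0 : 0 < p. Proof. exact: lt_le_trans ltr01 p1. Qed.
Let mU : measurable (cp @^-1` U). Proof. exact: measurable_open_preimage. Qed.

(** The mean value inequality for the constant 1 would fail on a null box. *)
Lemma coord_box_gt0 z (r : R) : 0 < r -> (forall w, vnorm (w - z) <= 4 * r -> U w) ->
  (0 < mu (coord_box z (2 * r)%R))%E.
Proof.
move=> r0 rU; have := local_mean oU (@holo_cst _ _ U 1) r0 rU.
rewrite cnorm1 integral_cst ?mul1e; last exact: measurable_coord_box.
move=> H; rewrite lt0e measure_ge0 andbT; apply/negP => /eqP E; move: H.
by rewrite [X in (_ * X)%E]E mule0 lee_fin ler10.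
Qed.

Lemma continuous_integral_eq0 (D : Cn -> R) : (forall w, U w -> {for w, continuous D}) ->
  (forall w, U w -> 0 <= D w) -> (\int[mu]_(x in cp @^-1` U) (D (cp x))%:E <= 0)%E ->
  forall w, U w -> D w = 0.
Proof.
move=> Dc D0 I0 w Uw; apply/eqP; rewrite eq_le D0// andbT leNgt; apply/negP => Dw.
have Dn : nbhs (D w) `](D w / 2), +oo[%classic.
  by apply: open_nbhs_nbhs; split; [exact: rray_open|rewrite /= in_itv/= andbT; lra].
have /nbhs_vnorm[d d0 hD] : nbhs w (D @^-1` `](D w / 2), +oo[) by exact: (Dc w Uw _ Dn).
have hd v : vnorm v < d -> D w / 2 < D (w + v) by move=> /hD /=; rewrite in_itv/= andbT.
have [d' d'0 hd'] := open_ball oU Uw.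
pose r := Num.min d d' / 8; have m0 : 0 < Num.min d d' by rewrite lt_min d0.
have r0 : 0 < r by rewrite divr_gt0.
have rm : 4 * r < Num.min d d' by rewrite /r; lra.
move: (rm); rewrite lt_min => /andP[rd rd'].
have rU v : vnorm (v - w) <= 4 * r -> U v by move=> vw; apply: hd'; exact: le_lt_trans vw rd'.
have B0 := coord_box_gt0 r0 rU.
have BU x : coord_box w (2 * r) x -> vnorm (cp x - w) <= 4 * r.
  have r20 : 0 <= 2 * r by lra.
  by move=> /(coord_box_vnorm r20) ; lra.
have mD : measurable_fun (cp @^-1` U) (fun x => (D (cp x))%:E).
  by apply/measurable_EFinP; exact: measurable_continuous.
have BS : coord_box w (2 * r) `<=` cp @^-1` U by move=> x /BU; exact: rU.
move: I0; rewrite leNgt => /negP; apply.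
apply: (@lt_le_trans _ _ ((D w / 2)%:E * mu (coord_box w (2 * r)))%E).
  by rewrite mule_gt0// lte_fin divr_gt0.
rewrite -integral_cst; last exact: measurable_coord_box.
apply: (@le_trans _ _ (\int[mu]_(x in coord_box w (2 * r)) (D (cp x))%:E)%E).
  apply: ge0_le_integral.
  - exact: measurable_coord_box.
  - by move=> x _; rewrite lee_fin divr_ge0// ltW.
  - exact: measurable_cst.
  - exact: measurable_funS mD.
  - move=> x Bx; rewrite lee_fin; apply: ltW; rewrite -(subrK w (cp x)) addrC; apply: hd.
    exact: le_lt_trans (BU x Bx) rd.
apply: ge0_subset_integral => //; first exact: measurable_coord_box.
by move=> x Ux; rewrite lee_fin D0.
Qed.

Lemma midpoint_powR (x y : R) : 0 <= x -> 0 <= y -> ((x + y) / 2) `^ p <= (x `^ p + y `^ p) / 2.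
Proof.
move=> x0 y0.
have h0 : 0 <= 2^-1 :> R by rewrite invr_ge0.
have h1 : 2^-1 <= 1 :> R by rewrite invf_le1// ler1n.
have := @convex_powR R p p1 (Itv01 h0 h1) x y.
rewrite !inE /= !in_itv/= !andbT => /(_ x0 y0).
have cE (a b : R) : conv (Itv01 h0 h1) (a : R^o) (b : R^o) = (a + b) / 2.
  by rewrite convRE /= /unstable.onem; field.
by rewrite !cE => H; rewrite -(cE x y); exact: H.
Qed.

Lemma cnorm_half : cnorm (2^-1 : C) = 2^-1.
Proof. by rewrite cnormV (_ : 2 = 2%:C) ?cnorm_real ?ger0_norm// realcD. Qed.

(** Convexity and strict monotonicity of the power force [|a + b| = |a| + |b|], so [a] times the
    conjugate of [b] equals [|a| * |b|]. Strict convexity is not involved, which covers [p = 1]. *)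
Lemma mid_equality (a b : C) : cnorm ((a + b) / 2) `^ p = (cnorm a `^ p + cnorm b `^ p) / 2 ->
  complex.Im (a * (b^*)%C) = 0.
Proof.
move=> E; have a0 := cnorm_ge0 a; have b0 := cnorm_ge0 b.
have E1 : cnorm (a + b) = cnorm a + cnorm b.
  apply/le_anti; rewrite cnormD/= leNgt; apply/negP => H.
  have := midpoint_powR a0 b0; rewrite -E leNgt => /negP; apply.
  rewrite cnormM cnorm_half; apply: gt0_ltr_powR; rewrite ?nnegrE ?divr_ge0 ?addr_ge0 ?cnorm_ge0//.
  by rewrite ltr_pM2r.
have S (c : C) : cnorm c ^+ 2 = complex.Re c ^+ 2 + complex.Im c ^+ 2.
  by case: c => u v; rewrite /cnorm/= sqr_sqrtr// addr_ge0// sqr_ge0.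
have /(congr1 (fun t => t ^+ 2)) := E1; rewrite sqrrD !S => E2.
have E3 : complex.Re (a * (b^*)%C) = cnorm a * cnorm b.
  by move: E2; case: (a) => ? ?; case: (b) => ? ? /= ; lra.
have := S (a * (b^*)%C); rewrite E3 cnormM.
have -> : cnorm (b^*)%C = cnorm b by case: (b) => u v; rewrite /cnorm/= sqrrN.
by move=> H; apply/eqP; rewrite -sqrf_eq0; apply/eqP; lra.
Qed.

Lemma cgrad_continuous f z a : cgrad f z a -> forall e, 0 < e ->
  exists2 d : R, 0 < d & forall v, vnorm v < d -> cnorm (f (z + v) - f z) <= e.
Proof.
move=> fa e e0; have [d d0 hd] := fa 1 ltr01.
have K0 : 0 < 1 + cdot_norm a by rewrite ltr_pwDl// cdot_norm_ge0.
exists (Num.min d (e / (1 + cdot_norm a))); first by rewrite lt_min d0 divr_gt0.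
move=> v; rewrite lt_min => /andP[/hd h1]; rewrite ltr_pdivlMr// => h2.
rewrite -(subrK (cdot a v) (_ - _)); apply: le_trans (cnormD _ _) _.
by have := cdot_le a v; lra.
Qed.

(* [f / g] is real near [z], and equals [1] at [z], so its differential, which is
   complex linear, takes real values only. *)
Lemma gradient_eq_of_real f g z a b v (d : R) : 0 < d ->
  (forall w, vnorm w < d -> complex.Im (f (z + w) * ((g (z + w))^*)%C) = 0) ->
  f z = 1 -> g z = 1 -> cgrad f z a -> cgrad g z b -> cdot a v = cdot b v.
Proof.
move=> d0 fg f1 g1 fa gb.
have qc := cgradB fa gb; set c := a - b in qc; pose q w := f w - g w.
(* Applied to ['i *: v] as well, this also removes the real part. *)
suff ImZ u : complex.Im (cdot c u) = 0.
  apply/eqP; rewrite -subr_eq0 -cdotBl -/c eq_complex ImZ eqxx andbT.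
  have := ImZ ('i *: v); rewrite cdot_scale; case: (cdot c v) => x y /= <-; apply/eqP; ring.
have Kc := cdot_norm_ge0 c; have N0 := vnorm_ge0 u.
set K := cdot_norm c in Kc; set N := vnorm u in N0.
apply/eqP; rewrite -normr_le0; apply/ler_addgt0Pr => e e0; rewrite add0r.
have e1 : 0 < e / (2 * (1 + N)) by rewrite divr_gt0// mulr_gt0// ltr_pwDl.
have e2 : 0 < e / (2 * (1 + N)) / (1 + K) by rewrite divr_gt0// ltr_pwDl.
have [r1 r10 h1] := qc 1 ltr01.
have [r2 r20 h2] := qc _ e1.
have [r3 r30 h3] := cgrad_continuous gb e2.
pose m := Num.min d (Num.min r1 (Num.min r2 r3)).
have m0 : 0 < m by rewrite !lt_min d0 r10 r20.
pose t := m / (1 + N); have t0 : 0 < t by rewrite divr_gt0// ltr_pwDl.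
have tN : vnorm (t%:C *: u) = t * N by rewrite vnormZ cnorm_real gtr0_norm.
have : t * N < m.
  by rewrite /t mulrAC ltr_pdivrMr ?ltr_pwDl// ltr_pM2l// ltrDr.
rewrite /m !lt_min -tN => /and4P[t1 t2 t3 t4].
have E := fg _ t1; have E1 := h1 _ t2; have E2 := h2 _ t3; have E3 := h3 _ t4.
rewrite tN in E1 E2; rewrite g1 in E3.
rewrite f1 g1 subrr subr0 cdot_scale in E1 E2.
set fw := f (z + _) in E E1 E2; set gw := g (z + _) in E E1 E2 E3.
have Q1 : cnorm (fw - gw) <= (1 + K) * (t * N).
  rewrite -(subrK (t%:C * cdot c u) (fw - gw)); apply: le_trans (cnormD _ _) _.
  rewrite mulrDl lerD// cnormM cnorm_real gtr0_norm//.
  by rewrite mulrCA ler_pM2l// cdot_le.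
(* The difference times the conjugate of [gw] has zero imaginary part, so the imaginary part of
   [fw - gw] is that of a product of two small factors. *)
have Q2 : complex.Im (fw - gw) = - complex.Im ((fw - gw) * ((gw - 1)^*)%C).
  by move: E; case: (fw) => ? ?; case: (gw) => ? ? /= ; lra.
have Q3 : `|complex.Im (fw - gw)| <= t * (e / 2).
  rewrite Q2 normrN; apply: le_trans (normIm _) _; rewrite cnormM.
  have -> : cnorm ((gw - 1)^*)%C = cnorm (gw - 1) by case: (gw - 1) => ? ?; rewrite /cnorm/= sqrrN.
  apply: le_trans (ler_pM (cnorm_ge0 _) (cnorm_ge0 _) Q1 E3) _.
  rewrite (_ : (1 + K) * (t * N) * (e / (2 * (1 + N)) / (1 + K)) = t * (e / 2) * (N / (1 + N))); last by field; rewrite !gt_eqF// ltr_pwDl.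
  apply: ler_piMr; first by apply: mulr_ge0; [exact: ltW|apply: divr_ge0 => //; exact: ltW].
  by rewrite ler_pdivrMr ?ltr_pwDl// mul1r lerDr.
have Q4 : `|complex.Im (t%:C * cdot c u)| <= t * e.
  rewrite -(subKr (fw - gw) (t%:C * cdot c u)).
  have -> : complex.Im ((fw - gw) - (fw - gw - t%:C * cdot c u)) = complex.Im (fw - gw) - complex.Im (fw - gw - t%:C * cdot c u).
    by case: (fw - gw) => ? ?; case: (_ * _).
  apply: le_trans (ler_normB _ _) _.
  have : e / (2 * (1 + N)) * (t * N) <= t * (e / 2).
    rewrite (_ : e / (2 * (1 + N)) * (t * N) = t * (e / 2) * (N / (1 + N))); last by field; rewrite !gt_eqF// ltr_pwDl.
    apply: ler_piMr; first by apply: mulr_ge0; [exact: ltW|apply: divr_ge0 => //; exact: ltW].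
  by rewrite ler_pdivrMr ?ltr_pwDl// mul1r lerDr.
  by have := normIm (fw - gw - t%:C * cdot c u); lra.
have : t * `|complex.Im (cdot c u)| <= t * e.
  apply: le_trans Q4; rewrite -[t in leLHS]gtr0_norm// -normrM.
  by case: (cdot c u) => ? ?; rewrite /= mul0r addr0.
by rewrite ler_pM2l.
Qed.

Lemma holoB f g : holo U f -> holo U g -> holo U (fun w => f w - g w).
Proof.
by move=> fU gU w Uw; have [a fa] := fU w Uw; have [b gb] := gU w Uw; exists (a - b); exact: cgradB.
Qed.

(** The midpoint [m] is a competitor, so the convexity defect [D >= 0] has integral at most 0. Being
    continuous, it vanishes on [U], and the case of equality holds at every point. *)
Lemma minimizer_gradient z f g e e' a b v : U z -> is_min p U z f e -> is_min p U z g e' ->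
  cgrad f z a -> cgrad g z b -> cdot a v = cdot b v.
Proof.
move=> Uz fm gm fa gb.
have ee : e = e' := is_min_unique fm gm; subst e'.
have [fU f1 fe _ emin] := fm; have [gU g1 ge _ _] := gm.
pose m w := 2^-1 * (f w - (-1) * g w).
have mE w : m w = (f w + g w) / 2 by rewrite /m; field.
have mH : holo U m by apply: holo_scale; apply: holoB => //; exact: holo_scale.
have em : (e%:E <= energy p U m)%E by apply: emin => //; rewrite mE f1 g1 -[1 + 1]/2 divff// pnatr_eq0.
pose P (k : Cn -> C) w := cnorm (k w) `^ p.
have Pge k w : 0 <= P k w by exact: powR_ge0.
pose D w := P f w + P g w - (P m w + P m w).
have D0 w : 0 <= D w.
  rewrite subr_ge0; have := midpoint_powR (cnorm_ge0 (f w)) (cnorm_ge0 (g w)).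
  have : P m w <= ((cnorm (f w) + cnorm (g w)) / 2) `^ p.
    rewrite /P mE; apply: ge0_ler_powR; rewrite ?nnegrE ?divr_ge0 ?addr_ge0 ?cnorm_ge0 ?(ltW p0)//.
    by rewrite cnormM cnorm_half ler_pM2r// cnormD.
  rewrite -/(P f w) -/(P g w); lra.
have Pc k w : holo U k -> U w -> {for w, continuous (P k)}.
  move=> kU /kU[c kc]; apply: (cvg_powR (FF := nbhs_filter w)) => //; rewrite ?cnorm_ge0//.
    by move=> ?; exact: cnorm_ge0.
  exact: cgrad_continuous_cnorm kc.
have Dc w : U w -> {for w, continuous D}.
  by move=> Uw; apply: continuousB; apply: continuousD; exact: Pc.
have mP k : holo U k -> measurable_fun (cp @^-1` U) (fun x => (P k (cp x))%:E).
  by move=> kU; exact: (measurable_energy p oU kU).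
have mD : measurable_fun (cp @^-1` U) (fun x => (D (cp x))%:E).
  by apply/measurable_EFinP; exact: measurable_continuous.
have ID : (\int[mu]_(x in cp @^-1` U) (D (cp x))%:E + (energy p U m + energy p U m) = (e + e)%:E)%E.
  rewrite EFinD -{1}fe -{1}ge /energy -!ge0_integralD//; try by [move=> x _; rewrite lee_fin Pge|exact: mP].
  - by apply: eq_integral => x _; rewrite -!EFinD /D subrK.
  - by move=> x _; rewrite lee_fin D0.
  - by move=> x _; rewrite adde_ge0 ?lee_fin ?powR_ge0.
  - by apply: emeasurable_funD; exact: mP.
have I0 : (\int[mu]_(x in cp @^-1` U) (D (cp x))%:E <= 0)%E.
  rewrite -(@leeD2rE _ (e + e)%:E)// add0e -[leRHS]ID leeD2l//.
  by rewrite EFinD leeD.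
have DE := continuous_integral_eq0 Dc (fun w _ => D0 w) I0.
have [d d0 dU] := open_ball oU Uz.
apply: (gradient_eq_of_real v d0 _ f1 g1 fa gb) => w wd.
apply: mid_equality; have := DE (z + w); rewrite /D /P mE => H.
by have := H (dU _ _); rewrite addrC addKr => /(_ wd) ; lra.
Qed.
End minimizer_gradient.

(** * First-order expansion of the kernel *)

Section little_o.
Context {R : realType} {n : nat}.
Local Notation C := R[i].
Local Notation Cn := 'rV[R[i]]_n.
Implicit Types (r s : Cn -> R) (v : Cn).

(** An upper bound only: [r] is meant to be a norm or a sum of norms. *)
Definition little r := forall e : R, 0 < e -> exists2 d : R, 0 < d & forall v, vnorm v < d -> r v <= e * vnorm v.

Lemma littleD r s : little r -> little s -> little (fun v => r v + s v).
Proof.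
move=> hr hs e e0; have e2 : 0 < e / 2 by rewrite divr_gt0.
have [d d0 hd] := hr _ e2; have [d' d'0 hd'] := hs _ e2.
exists (Num.min d d'); first by rewrite lt_min d0.
by move=> v; rewrite lt_min => /andP[/hd h1 /hd' h2]; lra.
Qed.

Lemma littleZ (k : R) r : 0 <= k -> little r -> little (fun v => k * r v).
Proof.
move=> k0 hr e e0; have K0 : 0 < 1 + k by rewrite ltr_pwDl.
have [d d0 hd] := hr _ (divr_gt0 e0 K0); exists d => // v /hd H.
apply: le_trans (ler_wpM2l k0 H) _; rewrite mulrA ler_wpM2r ?vnorm_ge0//.
by rewrite mulrA ler_pdivrMr//; nra.
Qed.

Lemma little_le r s (d : R) : 0 < d -> (forall v, vnorm v < d -> r v <= s v) -> little s -> little r.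
Proof.
move=> d0 rs hs e e0; have [d' d'0 hd'] := hs e e0; exists (Num.min d d'); first by rewrite lt_min d0.
by move=> v; rewrite lt_min => /andP[/rs h1 /hd' h2]; exact: le_trans h2.
Qed.

Lemma little_sqr (k : R) : 0 <= k -> little (fun v => k * vnorm v ^+ 2).
Proof.
move=> k0 e e0; have K0 : 0 < 1 + k by rewrite ltr_pwDl.
exists (e / (1 + k)); first by rewrite divr_gt0.
move=> v; rewrite ltr_pdivlMr// => H; rewrite expr2 mulrA ler_wpM2r ?vnorm_ge0//.
by have := vnorm_ge0 v; nra.
Qed.

Lemma powR_diff1 (q e : R) : 0 < e ->
  exists2 d : R, 0 < d & forall t : R, `|t - 1| < d -> `|t `^ q - 1 - q * (t - 1)| <= e * `|t - 1|.
Proof.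
move=> e0; have D := is_derive1_powR q (@ltr01 R); rewrite powR1 mulr1 in D.
have df : differentiable (fun t : R => t `^ q) (1 : R) by apply/derivable1_diffP; exact: ex_derive.
have := differentiable_eps df e0 => /nbhs_ballP[d /= d0 hd]; exists d => // t td.
have := hd (t - 1); rewrite /ball/= sub0r normrN => /(_ td); rewrite subrK powR1.
have -> : 'd (fun t : R => t `^ q) (1 : R) (t - 1) = q * (t - 1).
  transitivity ((t - 1) *: 'd (fun t : R => t `^ q) (1 : R) (1 : R)); first by rewrite -linearZ /GRing.scale/= mulr1.
  by rewrite -deriveE// derive_val; exact: mulrC.
exact: id.
Qed.

(** With [N = |1 + s|], the product [(N - 1 - x) * (N + 1 + x)] equals [y ^ 2], and its second
    factor is at least 1 when [|s| <= 1 / 2]. *)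
Lemma cnorm_expansion (s : C) : cnorm s <= 2^-1 -> `|cnorm (1 + s) - 1 - complex.Re s| <= cnorm s ^+ 2.
Proof.
case: s => x y hs; have hx : `|x| <= cnorm (x +i* y) := normRe (x +i* y).
rewrite -[complex.Re _]/x.
have S : cnorm (x +i* y) ^+ 2 = x ^+ 2 + y ^+ 2 by rewrite /cnorm/= sqr_sqrtr// addr_ge0// sqr_ge0.
have T : cnorm (1 + (x +i* y)) ^+ 2 = (1 + x) ^+ 2 + y ^+ 2.
  by rewrite /cnorm/= add0r sqr_sqrtr// addr_ge0// sqr_ge0.
have N0 := cnorm_ge0 (1 + (x +i* y)); rewrite S.
move: T N0; set N := cnorm (1 + _) => T N0.
have x1 : - 2^-1 <= x by move: (le_trans hx hs); rewrite ler_norml => /andP[].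
have N1 : 1 + x <= N.
  by rewrite -(@ler_pXn2r _ 2) ?nnegrE//; [rewrite T lerDl sqr_ge0|lra].
have y2 : 0 <= y ^+ 2 by exact: sqr_ge0.
have x2 : 0 <= x ^+ 2 by exact: sqr_ge0.
have E : (N - 1 - x) * (N + (1 + x)) = y ^+ 2.
  by transitivity (N ^+ 2 - (1 + x) ^+ 2); [ring|rewrite T; ring].
rewrite ger0_norm; last lra.
suff : N - 1 - x <= y ^+ 2 by lra.
rewrite -E ler_peMr; lra.
Qed.

Lemma cnorm_powR_expansion (q : R) (e : R) : 0 < e ->
  exists2 d : R, 0 < d & forall s : C, cnorm s < d ->
    `|cnorm (1 + s) `^ q - 1 - q * complex.Re s| <= e * cnorm s.
Proof.
move=> e0; have e2 : 0 < e / 2 by rewrite divr_gt0.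
have [d d0 hd] := powR_diff1 q e2.
have K0 : 0 < 1 + `|q| by rewrite ltr_pwDl.
exists (Num.min d (Num.min 2^-1 (e / 2 / (1 + `|q|)))); first by rewrite !lt_min d0 invr_gt0 ltr0n/= divr_gt0.
move=> s; rewrite !lt_min => /and3P[h1 h2]; rewrite ltr_pdivlMr// => h3.
have t1 : `|cnorm (1 + s) - 1| <= cnorm s.
  by have := cnorm_dist (1 + s) 1; rewrite cnorm1 [1 + s - 1]addrC addKr.
have H := hd _ (le_lt_trans t1 h1).
have X := cnorm_expansion (ltW h2).
rewrite (_ : _ - q * complex.Re s = (cnorm (1 + s) `^ q - 1 - q * (cnorm (1 + s) - 1)) + q * (cnorm (1 + s) - 1 - complex.Re s)); last by ring.
apply: le_trans (ler_normD _ _) _; rewrite normrM.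
have s0 := cnorm_ge0 s; have q0 := normr_ge0 q.
have : `|q| * `|cnorm (1 + s) - 1 - complex.Re s| <= `|q| * cnorm s ^+ 2 by exact: ler_wpM2l.
have : `|q| * cnorm s ^+ 2 <= e / 2 * cnorm s.
  by rewrite expr2 mulrA ler_wpM2r//; nra.
have : e / 2 * `|cnorm (1 + s) - 1| <= e / 2 * cnorm s by rewrite ler_wpM2l// ltW.
lra.
Qed.

End little_o.

(** * Dependence of the minimizer and the minimum on the base point *)

Section variation.
Context {R : realType} {n : nat}.
Local Notation C := R[i].
Local Notation Cn := 'rV[R[i]]_n.
Variables (p : R) (U : set Cn).
Hypotheses (p1 : 1 <= p) (oU : open U).
Implicit Types (f g : Cn -> C) (w z : Cn) (e : R).

Let p0 : 0 < p. Proof. exact: lt_le_trans ltr01 p1. Qed.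

Lemma is_min_le w z f g e e' : is_min p U z f e -> is_min p U w g e' -> f w != 0 ->
  e' <= e * cnorm (f w) `^ (- p).
Proof.
move=> [fU f1 fe _ _] [_ _ _ _ gmin] fw.
have := gmin (fun v => (f w)^-1 * f v) (holo_scale _ fU).
rewrite mulVf// energy_scale// fe -EFinM lee_fin => /(_ erefl).
suff -> : cnorm (f w)^-1 `^ p = cnorm (f w) `^ (- p) by rewrite mulrC.
have N0 : cnorm (f w) `^ p != 0 by rewrite gt_eqF// powR_gt0// cnorm_gt0.
apply: (mulIf N0); rewrite -powRM ?cnorm_ge0// -cnormM mulVf// cnorm1 powR1.
by rewrite powRN mulVf.
Qed.

Variables (M : Cn -> Cn -> C) (I : Cn -> R) (z : Cn).
Hypotheses (Uz : U z) (MI : forall w, U w -> is_min p U w (M w) (I w)).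

(** The expansion of M_w(z) is put as the impossibility of a bad sequence, the form in which
    compactness applies: a limit of the minimizers at [z + v k] is a minimizer at [z], with gradient
    [a]. *)
Lemma minimizer_sequence (a : Cn) (v : nat -> Cn) (e : R) : cgrad (M z) z a -> 0 < e ->
  (forall d : R, 0 < d -> \forall k \near \oo, vnorm (v k) < d) ->
  (forall k, U (z + v k)) ->
  ~ (forall k, e * vnorm (v k) < cnorm (M (z + v k) z - 1 + cdot a (v k))).
Proof.
move=> Ma e0 v0 Uv Hv.
have [MzU Mz1 Mze Iz0 Mzmin] := MI Uz.
have [d [A [d0 A0 dU HA]]] := local_bound p1 oU Uz.
have Ik (c : R) : 0 < c -> \forall k \near \oo, I (z + v k) <= I z + c.
  move=> c0; have [d1 d10 h1] := @cnorm_powR_expansion R (- p) 1 ltr01.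
  have P1 : 0 < I z * (1 + p) by rewrite mulr_gt0// ltr_pwDl// ltW.
  (* The first bound gives [|s| < d1], the second keeps [1 + s] away from 0, and the third makes
     [I z * (1 + p) * |s|] at most [c]. *)
  pose m := Num.min (d1 / 2) (Num.min (2^-1) (c / (I z * (1 + p)))).
  have m0 : 0 < m by rewrite !lt_min !divr_gt0// invr_gt0 ltr0n.
  have [d2 d20 h2] := cgrad_continuous Ma m0.
  apply: filterS (v0 _ d20) => k /h2; rewrite Mz1; set s := _ - 1.
  rewrite !le_min => /and3P[s1 s2 s3]; rewrite ler_pdivlMr// in s3.
  have ME : M z (z + v k) = 1 + s by rewrite /s; ring.
  have s1' : cnorm s < d1 by apply: le_lt_trans s1 _; rewrite ltr_pdivrMr// ltr_pMr// ltr1n.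
  have n0 : 1 + s != 0.
    by apply: contraTneq s2 => /eqP; rewrite addrC addr_eq0 => /eqP ->; rewrite cnormN cnorm1 -ltNge invf_lt1// ltr1n.
  have := is_min_le (MI Uz) (MI (Uv k)); rewrite ME => /(_ n0)/le_trans; apply.
  have := h1 s s1'; rewrite mul1r ler_norml => /andP[_ h3].
  have := normRe s; rewrite ler_norml => /andP[h4 _].
  have : cnorm (1 + s) `^ (- p) <= 1 + (1 + p) * cnorm s.
    by have := p0; have := cnorm_ge0 s; nra.
  by rewrite -(ler_pM2l Iz0) => /le_trans; apply; nra.
(* Dropping the first [N] terms bounds all energies by [I z + 1]. *)
have [N _ HN] := Ik 1 ltr01.
pose F k := M (z + v (N + k)%N).
have FU k : holo U (F k) by have [] := MI (Uv (N + k)%N).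
have F1 k : F k (z + v (N + k)%N) = 1 by have [] := MI (Uv (N + k)%N).
have FE k : energy p U (F k) = (I (z + v (N + k)%N))%:E by have [] := MI (Uv (N + k)%N).
have FB k : (energy p U (F k) <= (I z + 1)%:E)%E by rewrite FE lee_fin; apply: HN; rewrite /= leq_addr.
have [G [GU Goo]] := ultraFilterLemma (eventually_filter).
have Gv (c : R) : 0 < c -> G [set k | vnorm (v (N + k)%N) < c].
  move=> /v0[m _ mP]; apply: Goo; exists m => // k /= mk; apply: mP => /=.
  exact: leq_trans mk (leq_addl _ _).
pose B := A * (1 + (I z + 1)).
have B0 : 0 <= B by rewrite mulr_ge0// !addr_ge0// ltW.
have FM k w : vnorm (w - z) <= d -> cnorm (F k w) <= B by move=> wz; exact: HA.
have Fd k w : vnorm (w - z) <= d -> exists a, cgrad (F k) w a by move=> /dU; exact: FU.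
have hex w : exists l, U w -> forall e, 0 < e -> G [set k | cnorm (F k w - l) <= e].
  have [Uw|] := pselect (U w); last by exists 0.
  have [d' [A' [d'0 A'0 d'U H]]] := local_bound p1 oU Uw.
  have [|l lP] := @complex_ultralimit _ G GU (fun k => F k w) (A' * (1 + (I z + 1))).
    by move=> k; apply: H; rewrite ?subrr ?vnorm0// ltW.
  by exists l.
have [h hP] := choice hex.
have hU : holo U h by exact: (limit_holo p1 oU GU FU FB hP).
pose L := 16 * B / d.
have L0 : 0 <= L by rewrite divr_ge0 ?(ltW d0)// mulr_ge0// ler0n.
(* [F k] equals 1 at the moving point [z + v (N + k)], not at [z]; the common Lipschitz constant [L]
   carries the value over. *)
have h1 : h z = 1.
  apply/eqP; rewrite eq_sym -subr_eq0 -cnorm_eq0 eq_le cnorm_ge0 andbT.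
  apply/ler_addgt0Pr => c c0; rewrite add0r; have c2 : 0 < c / 2 by rewrite divr_gt0.
  have c3 : 0 < Num.min (d / 2) (c / 2 / (1 + L)) by rewrite lt_min !divr_gt0// ltr_pwDl.
  have [k /= [k1]] := filter_ex (filterI (hP z Uz _ c2) (Gv _ c3)).
  rewrite lt_min => /andP[k2]; rewrite ltr_pdivlMr ?ltr_pwDl// => k3.
  have := lipschitz_half (w := z) (h := v (N + k)%N) d0 (Fd k) (FM k); rewrite subrr vnorm0 F1 -/L.
  rewrite [z + _ - z]addrC addKr => /(_ _ (ltW k2)) H.
  have {}H := H (divr_ge0 (ltW d0) (ler0n _ 2)).
  rewrite (_ : 1 - h z = (1 - F k z) + (F k z - h z)); last by ring.
  apply: le_trans (cnormD _ _) _; have := vnorm_ge0 (v (N + k)%N); nra.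
have he : (energy p U h <= (I z)%:E)%E.
  apply: (limit_energy p1 oU GU FU FB hP) => c /Ik[m _ mP].
  apply: Goo; exists m => // k /= mk; rewrite FE lee_fin; apply: mP => /=.
  exact: leq_trans mk (leq_addl _ _).
have hmin : is_min p U z h (I z) by split => //; apply/le_anti; rewrite he Mzmin.
have [ak akP] := choice (fun k => FU k z Uz).
have [b hb bP] := limit_gradient p1 oU GU FU FB hP Uz akP.
(* The limit [h] need not be identified with [M z]: equality of gradients is enough. *)
have ab u : cdot b u = cdot a u := minimizer_gradient p1 oU u Uz hmin (MI Uz) hb Ma.
pose K := 512 * B / d ^+ 2.
have K0 : 0 <= K by apply: divr_ge0; [apply: mulr_ge0 B0; exact: ler0n|exact/exprn_ge0/ltW].
have e2 : 0 < e / 2 by rewrite divr_gt0.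
have c3 : 0 < Num.min (d / 4) (e / 2 / (1 + K)) by rewrite lt_min !divr_gt0// ltr_pwDl.
have [k /= [k1]] := filter_ex (filterI (bP _ e2) (Gv _ c3)).
rewrite lt_min => /andP[k2]; rewrite ltr_pdivlMr ?ltr_pwDl// => k3.
have := Hv (N + k)%N; rewrite -/(F k) ltNge => /negP; apply.
set vk := v (N + k)%N in k1 k2 k3 *.
(* The expansion is centred at [z] and evaluated at [z + vk], where [F k] is 1; this determines
   [F k z] to first order. *)
have := taylor d0 (Fd k) (FM k) (ltW k2) (akP k); rewrite F1 -/K => T.
rewrite (_ : F k z - 1 + cdot a vk = - ((1 - F k z - cdot (ak k) vk) + (cdot (ak k) vk - cdot b vk))); last by rewrite ab; ring.
rewrite cnormN; apply: le_trans (cnormD _ _) _; have := k1 vk; have V0 := vnorm_ge0 vk.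
have : K * vnorm vk ^+ 2 <= e / 2 * vnorm vk by rewrite expr2 mulrA ler_wpM2r//; nra.
lra.
Qed.

Lemma minimizer_expansion (a : Cn) : cgrad (M z) z a ->
  little (fun v => cnorm (M (z + v) z - 1 + cdot a v)).
Proof.
move=> Ma e e0; apply: contrapT => H.
have [dU dU0 HU] := open_ball oU Uz.
have vex (k : nat) : exists v, [/\ vnorm v < k.+1%:R^-1, vnorm v < dU & e * vnorm v < cnorm (M (z + v) z - 1 + cdot a v)].
  apply: contrapT => H'; apply: H.
  exists (Num.min k.+1%:R^-1 dU); first by rewrite lt_min invr_gt0 ltr0n.
  by move=> v; rewrite lt_min => /andP[v1 v2]; rewrite leNgt; apply/negP => v3; apply: H'; exists v.
have [v vP] := choice vex.
apply: (minimizer_sequence (v := v) Ma e0).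
- move=> d d0; exists (Num.Def.archi_bound d^-1) => // k /= dk.
  have [H1 _ _] := vP k; apply: lt_le_trans H1 _.
  rewrite -[leRHS]invrK lef_pV2 ?posrE ?invr_gt0//.
  apply: (@le_trans _ _ (Num.Def.archi_bound d^-1)%:R); last by rewrite ler_nat ltnW.
  by apply/ltW/archi_boundP; rewrite invr_ge0 ltW.
- by move=> k; have [_ H2 _] := vP k; apply: HU; rewrite addrC addKr.
- by move=> k; have [] := vP k.
Qed.

Lemma little_powR (q c d : R) (s : Cn -> C) : 0 < d -> 0 <= c ->
  (forall v, vnorm v < d -> cnorm (s v) <= c * vnorm v) ->
  little (fun v => `|cnorm (1 + s v) `^ q - 1 - q * complex.Re (s v)|).
Proof.
move=> d0 c0 sc e e0; have C0 : 0 < 1 + c by rewrite ltr_pwDl.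
have [d1 d10 h1] := cnorm_powR_expansion q (divr_gt0 e0 C0).
exists (Num.min d (d1 / (1 + c))); first by rewrite lt_min d0 divr_gt0.
move=> v; rewrite lt_min => /andP[/sc sv]; rewrite ltr_pdivlMr// => v1.
have V0 := vnorm_ge0 v.
have sd : cnorm (s v) < d1 by apply: le_lt_trans sv _; nra.
apply: le_trans (h1 _ sd) _; apply: le_trans (ler_wpM2l (ltW (divr_gt0 e0 C0)) sv) _.
by rewrite mulrA ler_wpM2r// mulrAC ler_pdivrMr//; nra.
Qed.

(** The ratio [kap v = I z / I (z + v)] contributes [p Re (a.v)] by the sandwich, and [M (z + v) z]
    contributes [- a.v]. *)
Lemma kernel_expansion (a : Cn) : cgrad (M z) z a ->
  little (fun v => cnorm ((I (z + v))^-1%:C * M (z + v) z - (I z)^-1%:C * M z z -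
    (I z)^-1%:C * ((p * complex.Re (cdot a v))%:C - cdot a v))).
Proof.
move=> Ma; have [_ Mz1 _ Iz0 _] := MI Uz.
pose s v := M z (z + v) - 1; pose s' v := M (z + v) z - 1.
pose Ka := cdot_norm a; have Ka0 : 0 <= Ka := cdot_norm_ge0 a.
have S1 : little (fun v => cnorm (s v - cdot a v)).
  by move=> e /Ma[d d0 hd]; exists d => // v /hd; rewrite Mz1.
have S2 : little (fun v => cnorm (s' v + cdot a v)) := minimizer_expansion Ma.
have [d1 d10 b1] : exists2 d : R, 0 < d & forall v, vnorm v < d -> cnorm (s v) <= (1 + Ka) * vnorm v.
  have [d d0 hd] := S1 1 ltr01; exists d => // v /hd; rewrite mul1r => H.
  rewrite -(subrK (cdot a v) (s v)); apply: le_trans (cnormD _ _) _; rewrite mulrDl mul1r.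
  by apply: lerD H (cdot_le _ _).
have [d2 d20 b2] : exists2 d : R, 0 < d & forall v, vnorm v < d -> cnorm (s' v) <= (1 + Ka) * vnorm v.
  have [d d0 hd] := S2 1 ltr01; exists d => // v /hd; rewrite mul1r => H.
  rewrite -(addrK (cdot a v) (s' v)); apply: le_trans (cnormB _ _) _; rewrite mulrDl mul1r.
  by apply: lerD H (cdot_le _ _).
have K1 : 0 <= 1 + Ka by rewrite addr_ge0.
have L1 := little_powR p d10 K1 b1.
have L2 := little_powR (- p) d20 K1 b2.
pose kap v := I z / I (z + v).
have [dU dU0 HU] := open_ball oU Uz.
have c10 : 0 < 2^-1 / (1 + Ka) by rewrite divr_gt0// ?invr_gt0 ?ltr_pwDl.
pose m := Num.min dU (Num.min d1 (Num.min d2 (2^-1 / (1 + Ka)))).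
have m0 : 0 < m by rewrite !lt_min dU0 d10 d20.
have near0 v : vnorm v < m -> [/\ U (z + v), cnorm (s v) <= 2^-1 & cnorm (s' v) <= 2^-1].
  rewrite /m !lt_min => /and4P[v1 /b1 v2 /b2 v3]; rewrite ltr_pdivlMr ?ltr_pwDl// => v4.
  by split; [apply: HU; rewrite addrC addKr|lra|lra].
have nz (t : C) : cnorm t <= 2^-1 -> 1 + t != 0.
  move=> t2; apply: contraTneq t2 => /eqP; rewrite addrC addr_eq0 => /eqP ->.
  by rewrite cnormN cnorm1 -ltNge invf_lt1// ltr1n.
have Lk : little (fun v => `|kap v - 1 - p * complex.Re (cdot a v)|).
  apply: (little_le m0); last exact: (littleD (littleD L1 (littleZ (ltW p0) S1)) (littleD L2 (littleZ (ltW p0) S2))).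
  move=> v /near0[Uv sv s'v].
  have [_ _ _ Iv0 _] := MI Uv.
  have ME : M z (z + v) = 1 + s v by rewrite /s; ring.
  have ME' : M (z + v) z = 1 + s' v by rewrite /s'; ring.
  have lo : cnorm (1 + s v) `^ p <= kap v.
    have := is_min_le (MI Uz) (MI Uv); rewrite ME => /(_ (nz _ sv)).
    have N0 : 0 < cnorm (1 + s v) `^ p by rewrite powR_gt0// cnorm_gt0 nz.
    by rewrite powRN ler_pdivlMr// /kap ler_pdivlMr// mulrC.
  have up : kap v <= cnorm (1 + s' v) `^ (- p).
    have := is_min_le (MI Uv) (MI Uz); rewrite ME' => /(_ (nz _ s'v)).
    by rewrite /kap ler_pdivrMr// mulrC.
  have R1 : `|complex.Re (s v) - complex.Re (cdot a v)| <= cnorm (s v - cdot a v).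
    by apply: le_trans (normRe _); case: (s v) => ? ?; case: (cdot a v).
  have R2 : `|complex.Re (s' v) + complex.Re (cdot a v)| <= cnorm (s' v + cdot a v).
    by apply: le_trans (normRe _); case: (s' v) => ? ?; case: (cdot a v).
  have /(ler_wpM2l (ltW p0)) A1 : - (complex.Re (s v) - complex.Re (cdot a v)) <= cnorm (s v - cdot a v).
    by apply: le_trans R1; rewrite -normrN ler_norm.
  have /(ler_wpM2l (ltW p0)) A2 : - (complex.Re (s' v) + complex.Re (cdot a v)) <= cnorm (s' v + cdot a v).
    by apply: le_trans R2; rewrite -normrN ler_norm.
  set T1 := `|_ `^ p - 1 - _|; set T2 := `|_ `^ (- p) - 1 - _|.
  have : - (cnorm (1 + s v) `^ p - 1 - p * complex.Re (s v)) <= T1 by rewrite /T1 -normrN ler_norm.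
  have : cnorm (1 + s' v) `^ (- p) - 1 - (- p) * complex.Re (s' v) <= T2 by exact: ler_norm.
  have T10 : 0 <= T1 by exact: normr_ge0.
  have T20 : 0 <= T2 by exact: normr_ge0.
  have C1 : 0 <= p * cnorm (s v - cdot a v) by rewrite mulr_ge0 ?cnorm_ge0 ?(ltW p0).
  have C2 : 0 <= p * cnorm (s' v + cdot a v) by rewrite mulr_ge0 ?cnorm_ge0 ?(ltW p0).
  by rewrite ler_norml; lra.
have Ks : 0 <= p * Ka * (1 + Ka) by rewrite !mulr_ge0// ltW.
apply: (little_le m0 _ (littleZ (_ : 0 <= (I z)^-1) (littleD (littleD (littleZ (ler0n _ 2) Lk) S2) (little_sqr Ks)))); last first.
  by rewrite invr_ge0 ltW.
move=> v vm; have [Uv sv s'v] := near0 v vm.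
move: vm; rewrite /m !lt_min => /and4P[_ _ /b2 bs' _].
have [_ _ _ Iv0 _] := MI Uv.
(* The remainder of the product splits into the error of [kap] times [1 + s'], of modulus at most 2,
   the error of [s'], and a quadratic cross term. *)
have -> : (I (z + v))^-1%:C * M (z + v) z - (I z)^-1%:C * M z z -
    (I z)^-1%:C * ((p * complex.Re (cdot a v))%:C - cdot a v) =
  (I z)^-1%:C * ((kap v - 1 - p * complex.Re (cdot a v))%:C * (1 + s' v) + (s' v + cdot a v) +
     (p * complex.Re (cdot a v))%:C * s' v).
  have -> : (I (z + v))^-1 = (I z)^-1 * kap v by rewrite /kap; field; rewrite !gt_eqF.
  have -> : (kap v - 1 - p * complex.Re (cdot a v))%:C = (kap v)%:C - 1 - (p * complex.Re (cdot a v))%:C.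
    by rewrite !(rmorphB (@real_complex R)).
  rewrite realcM Mz1 /s'; ring.
rewrite cnormM cnorm_real ger0_norm ?invr_ge0 ?(ltW Iz0)// ler_wpM2l ?invr_ge0 ?(ltW Iz0)//.
apply: le_trans (cnormD _ _) _; apply: lerD.
  apply: le_trans (cnormD _ _) _; rewrite lerD2r cnormM cnorm_real mulrC ler_wpM2r//.
  by apply: le_trans (cnormD _ _) _; rewrite cnorm1; lra.
rewrite cnormM cnorm_real normrM (ger0_norm (ltW p0)).
have V0 := vnorm_ge0 v.
have H1 : `|complex.Re (cdot a v)| <= Ka * vnorm v by apply: le_trans (normRe _) (cdot_le _ _).
apply: (@le_trans _ _ (p * (Ka * vnorm v) * ((1 + Ka) * vnorm v))).
  by apply: ler_pM; rewrite ?mulr_ge0 ?cnorm_ge0 ?(ltW p0)// ler_wpM2l ?(ltW p0).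
by rewrite le_eqVlt; apply/orP; left; apply/eqP; ring.
Qed.
End variation.

(** * Passage to real coordinates *)

Section real_part.
Context {R : realType} {n : nat}.
Local Notation C := R[i].
Local Notation Cn := 'rV[R[i]]_n.
Local Notation V := ('rV[R]_n * 'rV[R]_n)%type.
Implicit Types (u : V) (v : Cn).

Definition cpair u : Cn := cvec (u.1 ord0) (u.2 ord0).

Lemma cpairD u u' : cpair (u + u') = cpair u + cpair u'.
Proof. by apply/rowP => j; rewrite !mxE. Qed.

Lemma cpairZ (k : R) u : cpair (k *: u) = k%:C *: cpair u.
Proof. by apply/rowP => j; rewrite !mxE /=; apply/eqP; rewrite eq_complex /= !mul0r subr0 addr0 !eqxx. Qed.

Lemma vnorm_cpair u : vnorm (cpair u) <= 2 * `|u|.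
Proof.
apply: vnorm_le => [|j]; first by rewrite mulr_ge0.
have coord (x : 'rV[R]_n) : `|x 0 j| <= `|x|.
  rewrite {2}/Num.Def.normr/= mx_normE -[leLHS]nngE num_le.
  by apply: (le_bigmax _ (fun i => `|x i.1 i.2|%:nng) (0, j)).
rewrite mxE; apply: le_trans (cnorm_le _ _) _; rewrite mulr_natl mulr2n.
apply: lerD; apply: le_trans (coord _) _; rewrite prod_normE le_max lexx ?orbT//.
Qed.

Definition realify (l : Cn -> C) u : R * R := (complex.Re (l (cpair u)), complex.Im (l (cpair u))).

Lemma norm_pair_le (c : C) : `|(complex.Re c, complex.Im c) : R * R| <= cnorm c.
Proof. by rewrite prod_normE ge_max normRe normIm. Qed.

(** [l] is described by additivity and real homogeneity because the differential of the kernel has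
    an antilinear part; [realify l] is then packed as a real linear map. *)
Lemma real_differentiable_of (g : Cn -> C) (z : Cn) (l : Cn -> C) (B : R) :
  (forall v v', l (v + v') = l v + l v') ->
  (forall (k : R) v, l (k%:C *: v) = k%:C * l v) ->
  (forall v, cnorm (l v) <= B * vnorm v) ->
  little (fun v => cnorm (g (z + v) - g z - l v)) -> real_differentiable g z.
Proof.
move=> lD lZ lB H.
have lin : linear (realify l).
  move=> k u u'; rewrite /realify cpairD cpairZ lD lZ; case: (l _) => a b; case: (l _) => c d.
  by congr pair; rewrite /GRing.scale/= ?mul0r ?subr0 ?addr0.
pose LM := GRing.isLinear.Build R V (R * R)%type *:%R (realify l) lin.
pose df := HB.pack_for {linear V -> (R * R)%type} (realify l) LM.
have dfB u : `|df u| <= (1 + `|B|) * 2 * `|u|.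
  apply: le_trans (norm_pair_le _) _; apply: le_trans (lB _) _.
  have := vnorm_cpair u; have := vnorm_ge0 (cpair u); have := ler_norm B; have := normr_ge0 B; nra.
have B0 : 0 < (1 + `|B|) * 2 by rewrite mulr_gt0// ltr_pwDl.
pose z' : V := (map_mx (@complex.Re R) z, map_mx (@complex.Im R) z).
suff : differentiable (fun u => (complex.Re (g (cpair u)), complex.Im (g (cpair u))) : R * R) z' by [].
apply: (@differentiable_of _ _ _ _ _ df).
  move=> u; apply/cvgrPdist_le => e e0; apply/(@nbhs_ballP _ V).
  exists (e / ((1 + `|B|) * 2)); first by rewrite /= divr_gt0.
  move=> u'; rewrite -ball_normE/= ltr_pdivlMr// mulrC => /ltW; apply: le_trans.
  by have := dfB (u - u'); rewrite linearB.
move=> e e0; have [|d d0 hd] := H (e / 2); first by rewrite divr_gt0.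
apply/nbhs_ballP; exists (d / 2); first by rewrite /= divr_gt0.
move=> u; rewrite -ball_normE/= sub0r normrN => ud.
have z'E : cpair z' = z by apply/rowP => j; rewrite !mxE; case: (z _ _).
have zE : cpair (u + z') = z + cpair u by rewrite cpairD z'E addrC.
have := vnorm_cpair u => v2; have /hd h : vnorm (cpair u) < d by lra.
have : cnorm (g (z + cpair u) - g z - l (cpair u)) <= e * `|u| by apply: le_trans h _; nra.
apply: le_trans; apply: le_trans (norm_pair_le _).
rewrite zE z'E /=.
rewrite /realify.
by case: (g (z + cpair u)) => x y; case: (g z) => x1 y1; case: (l (cpair u)).
Qed.
End real_part.

Theorem corollary1p4 (R : realType) (n : nat) (n_gt0 : (0 < n)%N)
    (Omega : set 'rV[R[i]]_n) (Omega_open : open Omega)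
    (Omega_connected : connected Omega) (Omega_bounded : bounded_set Omega)
    (p : R) (p_ge1 : 1 <= p) (z : 'rV[R[i]]_n) (Omega_z : Omega z) :
  real_differentiable (fun w => bergman_offdiag p Omega z w) z.
Proof.
pose M := bergman_minimizer p Omega.
(* The value 0 outside [Omega] is a placeholder. *)
have /choice[I IP] : forall w, exists e, Omega w -> is_min p Omega w (M w) e.
  move=> w; have [Uw|] := pselect (Omega w); last by exists 0.
  by have [e H] := minimizer_is_min p_ge1 Omega_open Omega_bounded Uw; exists e.
have offE w : Omega w -> bergman_offdiag p Omega z w = (I w)^-1%:C * M w z.
  by move=> Uw; rewrite /bergman_offdiag (kernelE p_ge1 Omega_open (IP w Uw)).
have [holoM _ _ Iz0 _] := IP z Omega_z.
have [a Ma] := holoM z Omega_z.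
have [d d0 dU] := open_ball Omega_open Omega_z.
have p0 : 0 <= p by lra.
apply: (@real_differentiable_of _ _ _ _ (fun v => (I z)^-1%:C * ((p * complex.Re (cdot a v))%:C - cdot a v)) ((I z)^-1 * ((p + 1) * cdot_norm a))).
- move=> v v'; have -> : cdot a (v + v') = cdot a v + cdot a v' by rewrite linearD.
  have -> : complex.Re (cdot a v + cdot a v') = complex.Re (cdot a v) + complex.Re (cdot a v').
    by case: (cdot a v) => ? ?; case: (cdot a v').
  by rewrite [p * _]mulrDr realcD; ring.
- move=> k v; rewrite cdot_scale (_ : complex.Re (k%:C * _) = k * complex.Re (cdot a v)); last by case: (cdot a v) => ? ? /=; ring.
  by rewrite mulrCA realcM; ring.
- move=> v; rewrite cnormM cnorm_real gtr0_norm ?invr_gt0// -!mulrA ler_wpM2l ?invr_ge0 ?(ltW Iz0)//.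
  apply: le_trans (cnormB _ _) _; rewrite cnorm_real normrM (ger0_norm p0) mulrDl mul1r.
  by apply: lerD (cdot_le _ _); rewrite ler_wpM2l//; exact: le_trans (normRe _) (cdot_le _ _).
apply: (little_le d0) (kernel_expansion p_ge1 Omega_open Omega_z IP Ma) => v vd.
by rewrite !offE//; apply: dU; rewrite addrC addKr.
Qed.
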